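(* Let $0<s\le 1$ and $\nu>0$. Let $\sigma\in(\frac1s,2)$ and let $\theta_0\in\dot H^{\sigma s}(\mathbb{T}^2)$ be real-valued with $\hat\theta_0(0)=0$ and $$\big\|e^{\alpha|\nabla|^s}\theta_0\big\|_{\dot H^{\sigma s}}=:E<\frac{\nu^2}{2}$$ for some $\alpha>0$, where $E>0$. Then there exists $\beta=\beta(\nu,E)$ with $0<\beta<E$ such that for every $\epsilon\in(0,\alpha)$ the stochastic surface quasi-geostrophic equation $$d\theta+R^\perp\theta\cdot\nabla\theta\,dt=\nu|\nabla|^s\theta\,dW_t,\qquad \theta(0)=\theta_0,$$ has a pathwise unique, global solution $\theta\in C^0([0,\infty),\dot H^{\sigma s})$ with probability $$p(\alpha,\epsilon,\nu,E)\ge 1-e^{-2\frac{(\alpha-\epsilon)\beta}{\nu^2}}.$$ In particular, for any given $p_0\in(0,1)$ and $E>0$, there exist $\nu>0$ and $\alpha>0$ such that if mean-zero initial data $\theta_0\in\dot H^{\sigma s}$ satisfy $\|e^{\alpha|\nabla|^s}\theta_0\|_{\dot H^{\sigma s}}=E<\frac{\nu^2}{2}$ for these values, then with probability at least $p_0$ there is a pathwise unique global solution.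
   Context: Torus and Fourier conventions: $\mathbb{T}^2=(\mathbb{R}/2\pi\mathbb{Z})^2$, $\hat f(k)$, $k\in\mathbb{Z}^2$, are the Fourier coefficients ($f=\sum_k\hat f(k)e^{ik\cdot x}$). Functions are real-valued with mean zero ($\hat f(0)=0$). $|\nabla|^a$ is the Fourier multiplier $|k|^a$, $e^{c|\nabla|^s}$ is the Fourier multiplier $e^{c|k|^s}$, and $\|f\|_{\dot H^{a}}^2=\sum_{k\ne0}|k|^{2a}|\hat f(k)|^2$. $R^\perp=(-R_2,R_1)$ with $R_j$ the Riesz transforms (multiplier $-ik_j/|k|$). $W_t$, $t\ge0$, is a standard one-dimensional Wiener process (continuous paths, $W_0=0$) on a probability space, constant in $x$. The equation is written as an Itô stochastic integral and is solved pathwise via the following transformation. Set $A=|\nabla|^{2s}$ and $\Gamma(t)=e^{-\nu W_t|\nabla|^s}$. By Itô's formula, $u(t)=\Gamma(t)\theta(t)$ satisfies, for each fixed path $t\mapsto W_t(\omega)$, the deterministic equation $$\partial_t u+\Gamma\big(R^\perp\Gamma^{-1}u\cdot\nabla\Gamma^{-1}u\big)=-\tfrac12\nu^2|\nabla|^{2s}u,\qquad u(0)=\theta_0 ,$$ understood in the mild (Duhamel) sense $u(t)=e^{-\frac t2\nu^2A}\theta_0-\int_0^te^{-\frac{t-\tau}{2}\nu^2A}\,\Gamma(R^\perp\Gamma^{-1}u\cdot\nabla\Gamma^{-1}u)(\tau)\,d\tau$. For a path in the relevant event, a solution $\theta$ of the stochastic equation is $\theta=\Gamma^{-1}u$ with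 $u$ a solution of this equation in $C^0([0,\infty),\mathcal G^\sigma_\phi)$, where $\phi(t)=(\alpha-\epsilon)+\beta t$ and this space consists of those $u$ such that $t\mapsto e^{\phi(t)|\nabla|^s}u(t)$ is continuous and bounded with values in $\dot H^{\sigma s}$. ''Pathwise unique'' means that for each fixed path $t\mapsto W_t(\omega)$ in the event there is exactly one such solution. ''With probability $p$'' means that this holds for all paths in an event of probability $p$. *)

(* Defs.v *)
From HB Require Import structures.
From mathcomp Require Import all_boot all_order all_algebra.
From mathcomp Require Import all_classical all_reals all_analysis.
From mathcomp Require Import complex.

Set Implicit Arguments.
Unset Strict Implicit.
Unset Printing Implicit Defensive.

Import Order.TTheory GRing.Theory Num.Theory.
Import numFieldNormedType.Exports.

Local Open Scope classical_set_scope.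
Local Open Scope complex_scope.
Local Open Scope ring_scope.

Definition freq : Type := (int * int)%type.

(* A function (or distribution) on the torus (R/2piZ)^2 is represented by its
   family of Fourier coefficients, f = \sum_k f k e^{i k.x}. *)
Definition coeffs (R : realType) : Type := freq -> R[i].

Section torus.
Context {R : realType}.
Implicit Types (f g : coeffs R) (k : freq) (a c s : R).

Definition fnorm k : R := Num.sqrt (k.1%:~R ^+ 2 + k.2%:~R ^+ 2).

Definition real_valued f := forall k, f (- k) = conjc (f k).

Definition mean_zero f := f 0 = 0.

Definition hnorm a f : \bar R :=
  ((\esum_(k in [set k : freq | k != 0%R])
      (fnorm k `^ (2 * a) * ComplexField.Normc.normc (f k) ^+ 2)%:E) `^ 2^-1)%E.

Definition Hdot a : set (coeffs R) :=
  [set f | [/\ real_valued f, mean_zero f & (hnorm a f < +oo)%E]].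

Definition multiplier (m : freq -> R[i]) f : coeffs R := fun k => m k * f k.

Definition exp_grad c s : coeffs R -> coeffs R :=
  multiplier (fun k => (expR (c * fnorm k `^ s))%:C).

Definition heat c s : coeffs R -> coeffs R :=
  multiplier (fun k => (expR (- c * fnorm k `^ (2 * s)))%:C).

Definition riesz1 : coeffs R -> coeffs R :=
  multiplier (fun k => 0 -i* (k.1%:~R / fnorm k)).

Definition riesz2 : coeffs R -> coeffs R :=
  multiplier (fun k => 0 -i* (k.2%:~R / fnorm k)).

Definition partial1 : coeffs R -> coeffs R :=
  multiplier (fun k => 0 +i* k.1%:~R).

Definition partial2 : coeffs R -> coeffs R :=
  multiplier (fun k => 0 +i* k.2%:~R).

Definition csummable (z : freq -> R[i]) :=
  summable [set: freq] (fun j => (complex.Re (z j))%:E) /\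
  summable [set: freq] (fun j => (complex.Im (z j))%:E).

(* The sum of an absolutely summable family of reals, as the difference of the
   sums of its positive and negative parts. *)
Definition rsum (x : freq -> R) : R :=
  fine (\esum_(j in [set: freq]) (Num.max (x j) 0)%:E) -
  fine (\esum_(j in [set: freq]) (Num.max (- x j) 0)%:E).

Definition csum (z : freq -> R[i]) : R[i] :=
  rsum (fun j => complex.Re (z j)) +i* rsum (fun j => complex.Im (z j)).

(* Fourier coefficients of the pointwise product: since f = \sum_k f k e^{ik.x}
   carries no normalising constant, neither does the convolution. *)
Definition product_defined f g :=
  forall k, csummable (fun j => f j * g (k - j)).

Definition product f g : coeffs R :=
  fun k => csum (fun j => f j * g (k - j)).

Definition nonlinearity_defined f :=
  product_defined (\- riesz2 f) (partial1 f) /\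
  product_defined (riesz1 f) (partial2 f).

(* R^\perp f . \nabla f, with R^\perp = (- R_2, R_1) *)
Definition nonlinearity f : coeffs R :=
  product (\- riesz2 f) (partial1 f) \+ product (riesz1 f) (partial2 f).

Definition cintegrable (D : set R) (z : R -> R[i]) :=
  (@lebesgue_measure R).-integrable D (fun x => (complex.Re (z x))%:E) /\
  (@lebesgue_measure R).-integrable D (fun x => (complex.Im (z x))%:E).

Definition cintegral (D : set R) (z : R -> R[i]) : R[i] :=
  (\int[@lebesgue_measure R]_(x in D) complex.Re (z x)) +i*
  (\int[@lebesgue_measure R]_(x in D) complex.Im (z x)).

(* C^0([0, oo), \dot H^a) *)
Definition continuous_Hdot a (v : R -> coeffs R) :=
  (forall t, 0 <= t -> Hdot a (v t)) /\
  (forall t, 0 <= t ->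
     hnorm a (v r \- v t) @[r --> within [set r | 0 <= r] (nbhs t)] --> 0%E).

Definition bounded_Hdot a (v : R -> coeffs R) :=
  exists M : R, forall t, 0 <= t -> (hnorm a (v t) <= M%:E)%E.

(* C^0([0, oo), G^sigma_phi) *)
Definition gevrey_space s sigma (phi : R -> R) : set (R -> coeffs R) :=
  [set u | continuous_Hdot (sigma * s) (fun t => exp_grad (phi t) s (u t)) /\
           bounded_Hdot (sigma * s) (fun t => exp_grad (phi t) s (u t))].

Section path.
Variables (s sigma nu : R) (phi : R -> R) (theta0 : coeffs R) (w : R -> R).

Definition Gamma t : coeffs R -> coeffs R := exp_grad (- nu * w t) s.
Definition Gamma_inv t : coeffs R -> coeffs R := exp_grad (nu * w t) s.

Definition duhamel_integrand (u : R -> coeffs R) t tau : coeffs R :=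
  heat ((t - tau) / 2 * nu ^+ 2) s
    (Gamma tau (nonlinearity (Gamma_inv tau (u tau)))).

Definition mild_solution (u : R -> coeffs R) :=
  [/\ gevrey_space s sigma phi u,
      forall t, 0 <= t -> nonlinearity_defined (Gamma_inv t (u t)),
      forall t k, 0 <= t ->
        cintegrable `[0, t] (fun tau => duhamel_integrand u t tau k) &
      forall t k, 0 <= t ->
        u t k = heat (t / 2 * nu ^+ 2) s theta0 k -
                cintegral `[0, t] (fun tau => duhamel_integrand u t tau k)].

(* d theta + R^\perp theta . \nabla theta dt = nu |\nabla|^s theta dW, solved
   along the path w through theta = Gamma^{-1} u *)
Definition sqg_solution (theta : R -> coeffs R) :=
  exists2 u, mild_solution u &
    forall t, 0 <= t -> theta t = Gamma_inv t (u t).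

Definition unique_global_solution :=
  exists theta, [/\ continuous_Hdot (sigma * s) theta, sqg_solution theta &
    forall theta', sqg_solution theta' ->
      forall t, 0 <= t -> theta' t = theta t].

End path.
End torus.

(* The increments are only required to be Gaussian over nondegenerate
   intervals: normal_prob 0 0 is not the Dirac mass at 0. *)
Record standard_wiener (R : realType) (d : measure_display)
    (Omega : measurableType d) (P : probability Omega R)
    (W : R -> Omega -> R) : Prop := {
  wiener_measurable : forall t : R, 0 <= t -> measurable_fun [set: Omega] (W t);
  wiener_start : forall omega, W 0 omega = 0;
  wiener_continuous : forall omega,
    {within [set t : R | 0 <= t], continuous (fun t => W t omega)};
  wiener_gaussian : forall r t : R, 0 <= r -> r < t ->
    forall B : set R, measurable B ->
      P [set omega | B (W t omega - W r omega)] =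
      normal_prob 0 (Num.sqrt (t - r)) B;
  wiener_independent : forall (n : nat) (t : nat -> R) (B : nat -> set R),
    0 <= t 0%N -> (forall i, t i < t i.+1) ->
    (forall i, measurable (B i)) ->
      P [set omega | forall i, (i < n)%N ->
           B i (W (t i.+1) omega - W (t i) omega)] =
      (\prod_(i < n) P [set omega | B i (W (t i.+1) omega - W (t i) omega)%R])%E
}.

(* With probability p (on the probability space of W) there is a pathwise
   unique global solution. *)
Definition solvable_with_probability (R : realType) (d : measure_display)
    (Omega : measurableType d) (P : probability Omega R) (W : R -> Omega -> R)
    (s sigma nu : R) (phi : R -> R) (theta0 : coeffs R) (p : R) :=
  exists A : set Omega, [/\ measurable A, P A = p%:E &
    forall omega, A omega ->
      unique_global_solution s sigma nu phi theta0 (fun t => W t omega)].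

(* Main.v *)
(* Let a = sigma s, so that 1 < a < 2s, and let phi(t) = (alpha - epsilon) + beta t
   and delta(t) = phi(t) - nu W_t.  If u solves the conjugated equation, then
   v = e^{phi |\nabla|^s} u solves, mode by mode,
     v_k' = - (nu^2/2 |k|^{2s} - beta |k|^s) v_k
            - \sum_{j + l = k} (j x l)/|j| e^{- delta (|j|^s + |l|^s - |k|^s)} v_j v_l.
   As long as delta >= 0 the exponential weight is at most 1.  Symmetrising the
   \dot H^a energy of the nonlinear term over the triples j + l + m = 0 gains
   enough cancellation to bound it by ||v||_a ||v||_{a+s}^2, with constant 1; the
   linear term dissipates at least (nu^2/2 - beta) ||v||_{a+s}^2, so ||v||_a stays
   below its initial value E < nu^2/2 - beta.  This bound holds uniformly for
   the Galerkin truncations.  The bilinear term maps \dot H^a into \dot H^{a-1},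
   and since 2s > 1 the linear flow recovers the lost derivative with an
   integrable singularity in time: this gives a contraction in a norm with an
   exponential weight in time, hence convergence of the truncations and
   uniqueness.  Finally delta >= 0 means that W stays below the line
   ((alpha - epsilon) + beta t) / nu, which has probability at least
   1 - e^{- 2 (alpha - epsilon) beta / nu^2} by the exponential martingale
   e^{2cW - 2c^2 t}, c = beta/nu, on dyadic grids. *)
Require Import Defs.
From HB Require Import structures.
From mathcomp Require Import all_boot all_order all_algebra.
From mathcomp Require Import all_classical all_reals all_analysis.
From mathcomp Require Import measurable_realfun.
From mathcomp Require Import complex.
From mathcomp Require Import ring lra zify.

Set Implicit Arguments.
Unset Strict Implicit.
Unset Printing Implicit Defensive.

Import Order.TTheory GRing.Theory Num.Theory.
Import numFieldNormedType.Exports.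

Local Open Scope classical_set_scope.
Local Open Scope complex_scope.
Local Open Scope ring_scope.

(** The obstacle is the constant 1 in the energy estimate: the threshold $\nu^2/2$ leaves no room
    for an unspecified constant, so every loss in the trilinear bound is budgeted. After
    symmetrisation only triples of lengths $x<y\le z$ remain (those with $x=y$ cancel), and the
    kernel is at most $\frac12(xy)^{-1/2}(xyz)^a(yz)^s$. A weighted Young inequality splits the sum
    in two, each part worth $E/2$: one since at most one of $j,-j$ satisfies $|j+m|\le|m|$, the
    other since $\sum_{0<|j|<y}|j|^{-1}\le8y$. The kernel bound rests on explicit rational
    constants, proved for $y\ge2$; the only other lattice configuration, with lengths
    $1,\sqrt2,\sqrt5$, is treated by itself. The Galerkin system is quadratic, so global existence
    and the energy bound depend on each other. The state is clamped to make the field bounded and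
    Lipschitz, and a barrier argument shows that the clamp never acts. In the limit, differential
    inequalities replace singular Duhamel integrals. *)

Local Notation cn := ComplexField.Normc.normc.

(** * Elementary inequalities for powers and exponentials *)

Section real_inequalities.
Context {R : realType}.
Implicit Types (x y z a s t : R).

Lemma le_of_derive (f df : R -> R) (b c : R) : b <= c ->
  (forall x, b < x < c -> is_derive x 1 f (df x)) ->
  (forall x, b < x < c -> df x <= 0) ->
  {within `[b, c], continuous f} -> f c <= f b.
Proof.
move=> + fdf df0 fc; rewrite le_eqVlt => /predU1P[->//|bc].
have fdf' x : x \in `]b, c[ -> is_derive x 1 f (df x) by rewrite in_itv => /fdf.
have [e] := MVT bc fdf' fc.
rewrite in_itv /= => /df0 dfe fcb.
by rewrite -subr_le0 fcb mulr_le0_ge0// subr_ge0 ltW.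
Qed.

Lemma powR_ge1 (b th : R) : 1 <= b -> 0 <= th -> 1 <= b `^ th.
Proof. by move=> b1 th0; rewrite -(powRr0 b); exact: ler_powR. Qed.

(** The tangent of $\exp$ at $\theta\ln b$ lies below $\exp$ at the points $0$ and $\ln b$;
    averaging these two bounds with weights $1-\theta$ and $\theta$ cancels the slope. *)
Lemma powR_le_chord (b th : R) : 0 < b -> 0 <= th <= 1 ->
  b `^ th <= 1 + th * (b - 1).
Proof.
move=> b0 /andP[th0 th1]; rewrite /powR gt_eqF//.
set m := th * ln b; set e := expR m.
have e0 : 0 < e by exact: expR_gt0.
have h1 : e * (1 - m) <= 1.
  rewrite -ler_pdivlMl// mulr1 /e -expRN; exact: expR_ge1Dx.
have h2 : e * (1 + ln b - m) <= b.
  rewrite -[leRHS]lnK ?posrE// -ler_pdivlMl// /e -expRN -expRD.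
  by apply: le_trans (expR_ge1Dx _); lra.
have : (1 - th) * (e * (1 - m)) + th * (e * (1 + ln b - m)) <= (1 - th) + th * b.
  by rewrite lerD// ?ler_wpM2l// ler_piMr//; lra.
have -> : (1 - th) * (e * (1 - m)) + th * (e * (1 + ln b - m)) =
  e * (1 - m + th * ln b) by ring.
rewrite -/m; lra.
Qed.

(** The chord bound for the base $b^a$ and the exponent $1/a\le1$. *)
Lemma bernoulli_powR (b a : R) : 0 < b -> 1 <= a -> 1 + a * (b - 1) <= b `^ a.
Proof.
move=> b0 a1; have a0 : 0 < a by lra.
have ba0 : 0 < b `^ a by exact: powR_gt0.
have : 0 <= a^-1 <= 1 by rewrite invr_ge0 ltW//= invf_le1.
move=> /(powR_le_chord ba0); rewrite -powRrM mulfV ?gt_eqF// powRr1; last exact: ltW.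
by rewrite -lerBlDl -ler_pdivrMl ?invr_gt0// invrK; lra.
Qed.

(** Convexity of $\sinh$ with $\sinh0=0$. The difference has derivative $2\rho(\cosh\rho x-\cosh
    x)\le0$, which is the monotonicity of $P\mapsto P+P^{-1}$ for $P\ge1$. *)
Lemma sinh_le (rho X : R) : 0 <= rho <= 1 -> 0 <= X ->
  expR (rho * X) - expR (- (rho * X)) <= rho * (expR X - expR (- X)).
Proof.
move=> /andP[r0 r1] X0; rewrite -subr_le0.
pose f x := expR (rho * x) - expR (- (rho * x)) - rho * (expR x - expR (- x)).
pose df x := rho * expR (rho * x) + rho * expR (- (rho * x))
              - rho * (expR x + expR (- x)).
have fdf x : is_derive x 1 f (df x).
  by rewrite /f; apply: is_derive_eq; rewrite /df !scaler1 /GRing.scale/=; ring.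
have -> : 0 = f 0 by rewrite /f mulr0 oppr0 expR0; ring.
rewrite -/(f X); apply: (@le_of_derive f df) => //.
  move=> x /andP[x0 _]; rewrite /df -mulrDr -mulrBr mulr_ge0_le0// subr_le0.
  rewrite !expRN; set p := expR (rho * x); set P := expR x.
  have p1 : 1 <= p by rewrite -expR0 ler_expR mulr_ge0// ltW.
  have pP : p <= P by rewrite ler_expR ler_piMl// ltW.
  rewrite -subr_ge0.
  have -> : P + P^-1 - (p + p^-1) = (P - p) * (p * P - 1) / (p * P).
    by field; rewrite !gt_eqF//; lra.
  by rewrite divr_ge0 ?mulr_ge0 ?subr_ge0// ?mulr_ege1//; lra.
apply: derivable_within_continuous => x _.
exact: (@ex_derive _ _ _ _ _ _ _ (fdf x)).
Qed.

(* The supremum over the width [X] of the Gevrey weight is one of these two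
   values, as hyperbolic sine and cosine are convex. *)
Lemma gevrey_factor_le (mu rho X : R) : 1 <= mu -> 0 <= rho <= 1 -> 0 <= X ->
  let f := mu * expR (- (X * (1 - rho))) - expR (- (X * (1 + rho))) in
  f <= mu - 1 \/ f <= 2^-1 * ((mu + 1) * rho + mu - 1).
Proof.
move=> mu1 rho01 X0 f.
have s1 := sinh_le rho01 X0; have /andP[r0 r1] := rho01.
have c1 : expR (rho * X) + expR (- (rho * X)) <= expR X + expR (- X).
  rewrite !expRN; set p := expR (rho * X); set P := expR X.
  have p1 : 1 <= p by rewrite -expR0 ler_expR mulr_ge0// ltW.
  have pP : p <= P by rewrite ler_expR ler_piMl// ltW.
  rewrite -subr_ge0.
  have -> : P + P^-1 - (p + p^-1) = (P - p) * (p * P - 1) / (p * P).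
    by field; rewrite !gt_eqF//; lra.
  by rewrite divr_ge0 ?mulr_ge0 ?subr_ge0// ?mulr_ege1//; lra.
have fE : f = expR (- X) * (mu * expR (rho * X) - expR (- (rho * X))).
  rewrite mulrBr mulrCA -!expRD /f.
  by congr (_ * expR _ - expR _); ring.
(* With $E=e^{-2X}\in(0,1]$ the hyperbolic estimates bound [f] by an affine function of $E$. Its
   values at $E=1$ and $E=0$ are the two alternatives, and the later case split is on the sign of
   its slope. *)
pose E := expR (- X) ^+ 2.
have E1 : E <= 1.
  by rewrite /E exprn_ile1// ?expR_ge0// -[leRHS]expR0 ler_expR oppr_le0.
have XX : expR (- X) * expR X = 1 by rewrite expRN mulVf ?gt_eqF ?expR_gt0.
have E0 : 0 <= expR (- X) by exact: expR_ge0.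
have : f <= 2^-1 * ((mu + 1) * rho * (1 - E) + (mu - 1) * (1 + E)).
  rewrite fE.
  have -> : 2^-1 * ((mu + 1) * rho * (1 - E) + (mu - 1) * (1 + E)) =
    expR (- X) * (2^-1 * ((mu + 1) * (rho * (expR X - expR (- X))) +
                  (mu - 1) * (expR X + expR (- X)))).
    rewrite /E expr2 -XX; ring.
  rewrite ler_wpM2l//.
  have : (mu + 1) * (expR (rho * X) - expR (- (rho * X))) <=
         (mu + 1) * (rho * (expR X - expR (- X))) by rewrite ler_wpM2l//; lra.
  have : (mu - 1) * (expR (rho * X) + expR (- (rho * X))) <=
         (mu - 1) * (expR X + expR (- X)) by rewrite ler_wpM2l//; lra.
  lra.
have E20 : 0 <= E by rewrite sqr_ge0.
have [h|h] := leP ((mu + 1) * rho) (mu - 1).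
  move=> fl; left; apply: (le_trans fl).
  have : (1 - E) * ((mu + 1) * rho) <= (1 - E) * (mu - 1) by rewrite ler_wpM2l//; lra.
  lra.
move=> fl; right; apply: (le_trans fl).
have : E * (mu - 1) <= E * ((mu + 1) * rho) by rewrite ler_wpM2l// ltW.
lra.
Qed.

(** $41/29$ is a convergent of $\sqrt2$: $2\cdot29^2=41^2+1$. *)
Lemma sqrt_half_le : Num.sqrt (2^-1 : R) <= 29 / 41.
Proof.
rewrite -[leRHS]ger0_norm ?divr_ge0// -sqrtr_sqr ler_sqrt ?sqr_ge0//; lra.
Qed.

(** The worst case is $b=2$, where the maximum, at $a=1/\ln2$, is about $1.062$; $13/12$ is a
    convenient rational above it. *)
Lemma sub_mulr_powR_le (a b : R) : 1 <= a <= 2 -> 2 <= b ->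
  a * b `^ (1 - a) <= 13 / 12.
Proof.
move=> /andP[a1 a2] b2.
have b0 : 0 < b by lra.
pose q := Num.sqrt (2^-1 : R).
have q0 : 0 < q by rewrite sqrtr_gt0 invr_gt0.
have qq : q ^+ 2 = 2^-1 by rewrite sqr_sqrtr// invr_ge0.
have q1 : q <= 29 / 41 := sqrt_half_le.
have le2 : b `^ (1 - a) <= 2^-1 `^ (a - 1).
  rewrite -(opprB a 1) powRN -[2^-1]powR_inv1// -powRrM mulN1r powRN.
  rewrite lef_pV2 ?posrE ?powR_gt0//.
  by rewrite ge0_ler_powR ?nnegrE//; lra.
suff : a * 2^-1 `^ (a - 1) <= 13 / 12.
  by apply: le_trans; rewrite ler_wpM2l//; lra.
(* One chord of $2^{1-a}$ over $[1,2]$ would give $9/8$ at $a=3/2$, which is too much. Chords over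
   the two halves, meeting at $q=2^{-1/2}$, leave two quadratics in $a$, settled by the squares
   supplied to [lra]. *)
have [h|h] := leP (a - 1) 2^-1.
  have -> : 2^-1 `^ (a - 1) = q `^ (2 * (a - 1)).
    by rewrite powRrM -qq powR_mulrn// ltW.
  have /(powR_le_chord q0) h1 : 0 <= 2 * (a - 1) <= 1 by lra.
  apply: (@le_trans _ _ (a * (1 + 2 * (a - 1) * (q - 1)))).
    by rewrite ler_wpM2l//; lra.
  have : (a * (a - 1)) * q <= (a * (a - 1)) * (29 / 41).
    by apply: ler_wpM2l q1; rewrite mulr_ge0//; lra.
  have : 0 <= (a - 27 / 20) ^+ 2 by exact: sqr_ge0.
  lra.
have -> : 2^-1 `^ (a - 1) = q * q `^ (2 * (a - 1) - 1).
  rewrite -[X in X * _](powRr1 (ltW q0)) -(@powRD _ q); last by rewrite (gt_eqF q0) implybT.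
  have -> : 1 + (2 * (a - 1) - 1) = 2 * (a - 1) by ring.
  by rewrite powRrM -qq powR_mulrn// ltW.
have /(powR_le_chord q0) h1 : 0 <= 2 * (a - 1) - 1 <= 1 by lra.
apply: (@le_trans _ _ (a * (q * (1 + (2 * (a - 1) - 1) * (q - 1))))).
  by rewrite ler_wpM2l// ?ler_wpM2l// ?ltW//; lra.
have -> : a * (q * (1 + (2 * (a - 1) - 1) * (q - 1))) =
   a * (q * (4 - 2 * a) + (2 * a - 3) * q ^+ 2) by ring.
rewrite qq.
have : (a * (4 - 2 * a)) * q <= (a * (4 - 2 * a)) * (29 / 41).
  by apply: ler_wpM2l q1; rewrite mulr_ge0//; lra.
have : 0 <= (a - 8 / 5) ^+ 2 by exact: sqr_ge0.
lra.
Qed.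

(** At the worst case $b=2$ the left side is $2^{-1/2}s\,2^{1-s}$, and $s\,2^{1-s}\le
    s(2-s)\le1$. *)
Lemma mulr_powR_le2 (s b : R) : 2^-1 <= s <= 1 -> 2 <= b ->
  s * b `^ (2^-1 - s) <= 29 / 41.
Proof.
move=> /andP[s1 s2] b2.
pose q := Num.sqrt (2^-1 : R).
have q0 : 0 < q by rewrite sqrtr_gt0 invr_gt0.
have qq : q ^+ 2 = 2^-1 by rewrite sqr_sqrtr// invr_ge0.
have q1 : q <= 29 / 41 := sqrt_half_le.
have le2 : b `^ (2^-1 - s) <= q * 2 `^ (1 - s).
  apply: (@le_trans _ _ (2 `^ (2^-1 - s))).
    rewrite -(opprB s) !powRN lef_pV2 ?posrE ?powR_gt0//; last lra.
    by rewrite ge0_ler_powR ?nnegrE//; lra.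
  have -> : 2^-1 - s = (- 2^-1) + (1 - s) by lra.
  rewrite powRD ?implybT// ?pnatr_eq0 ?implybT// powRN powR12_sqrt// /q.
  by rewrite sqrtrV.
have /powR_le_chord h1 : 0 <= 1 - s <= 1 by lra.
have {}h1 := h1 2 ltac:(lra).
have {}h1 : 2 `^ (1 - s) <= 2 - s by lra.
apply: (@le_trans _ _ (s * (q * (2 - s)))).
  rewrite ler_wpM2l//; first lra.
  by apply: (le_trans le2); rewrite ler_wpM2l// ltW.
have : (s * (2 - s)) * q <= 1 * q.
  rewrite ler_pM2r//; have : 0 <= (s - 1) ^+ 2 by exact: sqr_ge0.
  lra.
lra.
Qed.

(** This is [sub_mulr_powR_le] with exponent $2s$ and base $\sqrt b\ge2$. The smaller constant is
    available for triangles with a short side, $4x\le y$. *)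
Lemma mulr_powR_le4 (s b : R) : 2^-1 <= s <= 1 -> 4 <= b ->
  s * b `^ (2^-1 - s) <= 13 / 24.
Proof.
move=> s12 b4.
have /(sub_mulr_powR_le) h : 1 <= 2 * s <= 2 by lra.
have {h} : 2 * s * (Num.sqrt b) `^ (1 - 2 * s) <= 13 / 12.
  apply: h; have -> : (2 : R) = Num.sqrt (2 ^+ 2) by rewrite sqrtr_sqr ger0_norm.
  by rewrite ler_sqrt; lra.
have -> : Num.sqrt b `^ (1 - 2 * s) = b `^ (2^-1 - s).
  by rewrite -powR12_sqrt ?powRrM//; [rewrite -powRrM; congr (_ `^ _); lra|lra].
lra.
Qed.

End real_inequalities.

(** * Unconditional sums over the lattice *)

Section families.
Context {R : realType} {T : choiceType}.
Implicit Types (F G : T -> R) (s : seq T).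

(* [F] is nonnegative in all uses, so that [sumle F B] says that the
   unconditional sum of [F] is at most [B]. *)
Definition sumle F (B : R) := forall s, uniq s -> \sum_(k <- s) F k <= B.

Lemma ler_sum_sub F s t : (forall k, 0 <= F k) -> uniq s -> uniq t ->
  {subset s <= t} -> \sum_(k <- s) F k <= \sum_(k <- t) F k.
Proof.
move=> F0 us ut st.
have -> : \sum_(k <- s) F k = \sum_(k <- t | k \in s) F k.
  rewrite -[RHS]big_filter; apply: perm_big; apply: uniq_perm => //.
    exact: filter_uniq.
  move=> k; rewrite mem_filter andb_idr//; exact: st.
by rewrite [leRHS](bigID (mem s))/= lerDl sumr_ge0.
Qed.

Lemma sumle_ge0 F B : sumle F B -> 0 <= B.
Proof. by move=> /(_ [::] isT); rewrite big_nil. Qed.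

Lemma sumleW F G B : (forall k, F k <= G k) -> sumle G B -> sumle F B.
Proof. by move=> FG GB s us; apply: le_trans (GB s us); exact: ler_sum. Qed.

Lemma sumle_wk F B C : B <= C -> sumle F B -> sumle F C.
Proof. by move=> BC FB s us; exact: le_trans (FB s us) BC. Qed.

Lemma sumleD F G B C : sumle F B -> sumle G C -> sumle (fun k => F k + G k) (B + C).
Proof. by move=> FB GC s us; rewrite big_split lerD ?FB ?GC. Qed.

Lemma sumleZ F B c : 0 <= c -> sumle F B -> sumle (fun k => c * F k) (c * B).
Proof. by move=> c0 FB s us; rewrite -mulr_sumr ler_wpM2l ?FB. Qed.

Lemma sumle_inj F B (f : T -> T) : injective f -> sumle F B -> sumle (F \o f) B.
Proof.
by move=> fi FB s us; have := FB (map f s); rewrite map_inj_uniq// big_map; apply.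
Qed.

Lemma sumle_le F B k : sumle F B -> F k <= B.
Proof. by move=> /(_ [:: k] isT); rewrite big_seq1. Qed.

(** Convergence along the directed set of finite subsets. [rsum] is a difference of two extended
    sums, which is awkward to compute with; [has_sum] is linear and has unique limits, so identities
    between infinite sums go through it. *)
Definition has_sum F (S : R) := forall e : R, 0 < e ->
  exists s0, uniq s0 /\ forall s, uniq s -> {subset s0 <= s} ->
    `|S - \sum_(k <- s) F k| <= e.

Lemma has_sum_bound F S B : has_sum F S -> sumle (fun k => `|F k|) B -> `|S| <= B.
Proof.
move=> hS FB; apply/ler_addgt0Pr => e e0.
have [s [us /(_ s us (fun _ => id)) h]] := hS e e0.
have -> : S = (S - \sum_(k <- s) F k) + \sum_(k <- s) F k by rewrite subrK.
rewrite addrC; apply: le_trans (ler_normD _ _) _; rewrite lerD//.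
exact: le_trans (ler_norm_sum _ _ _) (FB s us).
Qed.

Lemma has_sumD F G S S' : has_sum F S -> has_sum G S' ->
  has_sum (fun k => F k + G k) (S + S').
Proof.
move=> hF hG e e0.
have [s1 [us1 h1]] := hF (e / 2) ltac:(by rewrite divr_gt0).
have [s2 [us2 h2]] := hG (e / 2) ltac:(by rewrite divr_gt0).
exists (undup (s1 ++ s2)); split; first exact: undup_uniq.
move=> s us sub; rewrite big_split/= opprD addrACA (splitr e).
apply: le_trans (ler_normD _ _) _; apply: lerD.
  by apply: h1 => // k ks; apply: sub; rewrite mem_undup mem_cat ks.
by apply: h2 => // k ks; apply: sub; rewrite mem_undup mem_cat ks orbT.
Qed.

Lemma has_sumZ F S c : has_sum F S -> has_sum (fun k => c * F k) (c * S).
Proof.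
move=> hF e e0; have c1 : 0 < `|c| + 1 by rewrite ltr_wpDl.
have [s0 [us0 h]] := hF (e / (`|c| + 1)) ltac:(by rewrite divr_gt0).
exists s0; split => // s us sub.
rewrite -mulr_sumr -mulrBr normrM.
apply: le_trans (ler_wpM2l (normr_ge0 c) (h s us sub)) _.
rewrite mulrCA ler_piMr ?(ltW e0)// ler_pdivrMr// mul1r; lra.
Qed.

Lemma has_sumN F S : has_sum F S -> has_sum (fun k => - F k) (- S).
Proof.
by move=> /(has_sumZ (- 1)); rewrite mulN1r; congr has_sum; apply/funext => k; rewrite mulN1r.
Qed.

Lemma has_sumB F G S S' : has_sum F S -> has_sum G S' ->
  has_sum (fun k => F k - G k) (S - S').
Proof. by move=> hF /has_sumN; exact: has_sumD. Qed.

Lemma has_sum0 : has_sum (fun=> 0) 0.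
Proof.
move=> e e0; exists [::]; split => // s _ _; rewrite big1// subrr normr0; exact: ltW.
Qed.

Lemma has_sum_unique F S S' : has_sum F S -> has_sum F S' -> S = S'.
Proof.
move=> h h'; apply/eqP; rewrite -subr_eq0 -normr_le0.
apply: (has_sum_bound (has_sumB h h')) => s us.
by rewrite big1// => k _; rewrite subrr normr0.
Qed.

Lemma has_sum_finite F s : uniq s -> (forall k, k \notin s -> F k = 0) ->
  has_sum F (\sum_(k <- s) F k).
Proof.
move=> us Fs e e0; exists s; split => // t ut st.
rewrite [X in _ - X](bigID (mem s))/= [X in _ - (_ + X)]big1; last by move=> k /Fs.
rewrite addr0 -[X in _ - X]big_filter.
suff /(perm_big _)/= -> : perm_eq [seq x <- t | x \in s] s by rewrite subrr normr0 ltW.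
apply: uniq_perm => //; first exact: filter_uniq.
move=> k; rewrite mem_filter andb_idr//; exact: st.
Qed.

(** A finite set whose sum comes within [e] of the supremum of all finite sums: a disjoint finite
    set can add at most [e]. *)
Lemma sumle_tail F B (e : R) : 0 < e ->
  sumle (fun k => `|F k|) B -> exists s0, uniq s0 /\
    sumle (fun k => if k \in s0 then 0 else `|F k|) e.
Proof.
move=> e0 FB.
pose P := [set x : R | exists2 s, uniq s & x = \sum_(k <- s) `|F k|].
have P0 : P !=set0 by exists 0, [::] => //; rewrite big_nil.
have hP : has_sup P by split => //; exists B => _ [s us ->]; exact: FB.
have [_ [s us ->] hs] := sup_adherent e0 hP.
exists s; split => // t ut.
have -> : \sum_(k <- t) (if k \in s then 0 else `|F k|) =
          \sum_(k <- [seq k <- t | k \notin s]) `|F k|.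
  by rewrite big_filter [RHS]big_mkcond; apply: eq_bigr => k _; case: (k \in s).
have : \sum_(k <- s ++ [seq k <- t | k \notin s]) `|F k| <= sup P.
  apply: ub_le_sup; first by case: hP.
  exists (s ++ [seq k <- t | k \notin s]) => //.
  rewrite cat_uniq us filter_uniq// andbT/=; apply/hasPn => k.
  by rewrite mem_filter => /andP[].
rewrite big_cat/=; lra.
Qed.

Lemma esum_le (D : set T) F B :
  (forall s, uniq s -> (forall k, k \in s -> D k) -> \sum_(k <- s) F k <= B) ->
  (\esum_(k in D) (F k)%:E <= B%:E)%E.
Proof.
move=> FB; apply: ge_ereal_sup => _ [A [fA AD] <-].
rewrite fsbig_finite//= sumEFin lee_fin; apply: FB => // k.
by rewrite in_fset_set// inE => /AD.
Qed.

Lemma sum_le_esum (D : set T) F s : uniq s -> (forall k, k \in s -> D k) ->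
  ((\sum_(k <- s) F k)%:E <= \esum_(k in D) (F k)%:E)%E.
Proof.
move=> us sD; apply: esum_ge; exists [set` s]; first by split.
by rewrite -sumEFin -fsbig_seq.
Qed.

Lemma has_sum_esum F B : (forall k, 0 <= F k) -> sumle F B ->
  has_sum F (fine (\esum_(k in [set: T]) (F k)%:E)).
Proof.
move=> F0 FB e e0; set S := esum _ _.
have SB : (S <= B%:E)%E by apply: esum_le => s us _; exact: FB.
have S0 : (0 <= S)%E by apply: esum_ge0 => k _; rewrite lee_fin.
have Sf : S \is a fin_num by rewrite ge0_fin_numE// (le_lt_trans SB)// ltry.
have FB' : sumle (fun k => `|F k|) B.
  by apply: sumleW FB => k; rewrite ger0_norm.
have [s0 [us0 h0]] := sumle_tail e0 FB'.
exists s0; split => // s us sub.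
have h1 : \sum_(k <- s) F k <= fine S.
  by rewrite -lee_fin fineK//; apply: sum_le_esum.
rewrite ger0_norm ?subr_ge0// lerBlDl -lee_fin fineK//.
apply: esum_le => t ut _; rewrite (bigID (mem s0))/= lerD//.
  rewrite -big_filter; apply: ler_sum_sub => //; first exact: filter_uniq.
  by move=> k; rewrite mem_filter => /andP[/sub].
apply: le_trans (h0 t ut); rewrite big_mkcond/=; apply: ler_sum => k _.
by case: (k \in s0); rewrite //= ger0_norm.
Qed.

Lemma sumle_maxr F B : sumle (fun k => `|F k|) B ->
  sumle (fun k => Num.max (F k) 0) B /\ sumle (fun k => Num.max (- F k) 0) B.
Proof.
by move=> FB; split; apply: sumleW FB => k; rewrite ge_max normr_ge0 andbT ?ler_norm// -normrN ler_norm.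
Qed.

End families.

Section torus_sums.
Context {R : realType}.
Implicit Types (x : freq -> R).

Lemma maxr_sub (y : R) : y = Num.max y 0 - Num.max (- y) 0.
Proof.
case: (leP 0 y) => h.
  have -> : Num.max (- y) 0 = 0 by apply/max_idPr; lra.
  by rewrite subr0.
have -> : Num.max (- y) 0 = - y by apply/max_idPl; lra.
by rewrite sub0r opprK.
Qed.

Lemma has_sum_rsum x (B : R) : sumle (fun k => `|x k|) B -> has_sum x (rsum x).
Proof.
move=> xB; have [p n] := sumle_maxr xB.
suff : has_sum (fun k => Num.max (x k) 0 - Num.max (- x k) 0) (rsum x).
  by congr has_sum; apply/funext => k; rewrite -maxr_sub.
apply: has_sumB.
  by apply: has_sum_esum p => k; rewrite le_max lexx orbT.
by apply: has_sum_esum n => k; rewrite le_max lexx orbT.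
Qed.

Lemma summable_sumle x (B : R) : sumle (fun k => `|x k|) B ->
  summable [set: freq] (fun k => (x k)%:E).
Proof.
move=> xB; rewrite /summable; apply: (@le_lt_trans _ _ B%:E); last exact: ltry.
under eq_esum do rewrite abse_EFin.
by apply: esum_le => s us _; exact: xB.
Qed.

End torus_sums.

(** * Counting lattice points in sup-norm boxes *)

Fixpoint zrange (n : nat) : seq int :=
  if n is m.+1 then [:: n%:Z, - n%:Z & zrange m] else [:: 0].

Definition supnorm (k : freq) : nat := maxn `|k.1|%N `|k.2|%N.

Definition box n : seq freq :=
  [seq k <- [seq (i, j) | i <- zrange n, j <- zrange n] | k != 0].

Lemma mem_zrange n i : (i \in zrange n) = (`|i| <= n)%N.
Proof.
elim: n i => [|n IH] i; first by rewrite inE leqn0 absz_eq0.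
rewrite !inE IH; apply/idP/idP.
  by move=> /or3P[/eqP->|/eqP->|/leqW//]; rewrite ?abszN absz_nat.
rewrite leq_eqVlt ltnS => /predU1P[|->]; last by rewrite !orbT.
case: i => m /= mE; first by rewrite mE eqxx.
by rewrite NegzE mE eqxx.
Qed.

Lemma zrangeS n : zrange n.+1 = [:: n.+1%:Z, - n.+1%:Z & zrange n].
Proof. by []. Qed.

Lemma zrange_sumS (V : nmodType) (f : int -> V) n :
  \sum_(i <- zrange n.+1) f i =
    f n.+1%:Z + (f (- n.+1%:Z) + \sum_(i <- zrange n) f i).
Proof. by rewrite zrangeS !big_cons. Qed.

Lemma uniq_zrange n : uniq (zrange n).
Proof.
elim: n => // n IH; rewrite [zrange _]/= !cons_uniq IH andbT !inE !mem_zrange.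
rewrite abszN !absz_nat ltnn orbF andbT.
by rewrite -subr_eq0 opprK -PoszD.
Qed.

Lemma size_zrange n : size (zrange n) = n.*2.+1.
Proof. by elim: n => //= n ->; rewrite doubleS. Qed.

Lemma mem_box n k : (k \in box n) = (k != 0) && (supnorm k <= n)%N.
Proof.
rewrite mem_filter; congr andb.
rewrite /supnorm geq_max -!mem_zrange; apply/allpairsP/andP => [[[i j] [? ? ->]]//|[]].
by case: k => i j /= h1 h2; exists (i, j).
Qed.

Lemma uniq_box n : uniq (box n).
Proof.
apply: filter_uniq; apply: allpairs_uniq; try exact: uniq_zrange.
by move=> [i j] [i' j'] _ _ [-> ->].
Qed.

Lemma box_opp n k : (- k \in box n) = (k \in box n).
Proof. by rewrite !mem_box oppr_eq0 /supnorm /= !abszN. Qed.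

Section lattice.
Context {R : realType}.
Implicit Types (k j l : freq) (F : freq -> R).
Local Notation "`[ k ]" := (@fnorm R k).

Lemma fnorm_ge0 k : 0 <= `[k].
Proof. exact: sqrtr_ge0. Qed.

Lemma fnorm_sqr k : `[k] ^+ 2 = (k.1 ^+ 2 + k.2 ^+ 2)%:~R.
Proof. by rewrite sqr_sqrtr ?addr_ge0 ?sqr_ge0// rmorphD !rmorphXn. Qed.

Lemma fnorm0 : `[0] = 0.
Proof. by rewrite /fnorm expr0n addr0 sqrtr0. Qed.

Lemma fnormN k : `[- k] = `[k].
Proof. by rewrite /fnorm /= !rmorphN !sqrrN. Qed.

Lemma fnorm_ge1 k : k != 0 -> 1 <= `[k].
Proof.
move=> k0; rewrite -(@ler_pXn2r _ 2) ?nnegrE ?fnorm_ge0// expr1n fnorm_sqr.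
rewrite -[1]/(1%:~R) ler_int; move: k0; case: k => i j /=.
rewrite -[(0 : freq)]/(0, 0) xpair_eqE negb_and => ij.
have sq (m : int) : m != 0 -> 1 <= m ^+ 2.
  by move=> m0; rewrite -gtz0_ge1 exprn_even_gt0.
by case/orP: ij => /sq h; [rewrite (le_trans h)// lerDl sqr_ge0|rewrite (le_trans h)// lerDr sqr_ge0].
Qed.

Lemma fnorm_gt0 k : k != 0 -> 0 < `[k].
Proof. by move=> /fnorm_ge1; apply: lt_le_trans. Qed.

Lemma supnorm_le k : (supnorm k)%:R <= `[k].
Proof.
rewrite /supnorm; have h (i j : int) : (`|i|%N)%:R <= Num.sqrt (i%:~R ^+ 2 + j%:~R ^+ 2) :> R.
  rewrite -[leLHS]ger0_norm// -sqrtr_sqr ler_sqrt ?addr_ge0 ?sqr_ge0//.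
  by rewrite natr_absz intr_norm real_normK ?num_real// lerDl sqr_ge0.
rewrite natr_max ge_max /fnorm h/=; rewrite addrC; exact: h.
Qed.

Lemma supnorm_gt0 k : k != 0 -> (0 < supnorm k)%N.
Proof.
rewrite /supnorm lt0n; apply: contra; case: k => i j /=.
by rewrite -leqn0 geq_max !leqn0 !absz_eq0 => /andP[/eqP-> /eqP->].
Qed.

Definition dotp j l : int := j.1 * l.1 + j.2 * l.2.
Definition crossp j l : int := j.1 * l.2 - j.2 * l.1.

Lemma fnormD_sqr j l : `[j + l] ^+ 2 = `[j] ^+ 2 + `[l] ^+ 2 + 2 * (dotp j l)%:~R.
Proof.
rewrite !fnorm_sqr -[2 : R]/(2%:~R) -rmorphM -!rmorphD; congr (_%:~R).
by case: j l => [j1 j2] [l1 l2]; rewrite /dotp /=; ring.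
Qed.

Lemma crossp_sqr j l : (crossp j l)%:~R ^+ 2 = `[j] ^+ 2 * `[l] ^+ 2 - (dotp j l)%:~R ^+ 2.
Proof.
rewrite !fnorm_sqr -!rmorphXn -rmorphM -rmorphB; congr (_%:~R).
by case: j l => [j1 j2] [l1 l2]; rewrite /dotp /crossp /=; ring.
Qed.

Lemma dotp_le j l : `|(dotp j l)%:~R| <= `[j] * `[l].
Proof.
rewrite -(@ler_pXn2r _ 2) ?nnegrE ?mulr_ge0 ?fnorm_ge0// real_normK ?num_real//.
by rewrite exprMn -subr_ge0 -crossp_sqr sqr_ge0.
Qed.

Lemma crossp_le j l : `|(crossp j l)%:~R| <= `[j] * `[l].
Proof.
rewrite -(@ler_pXn2r _ 2) ?nnegrE ?mulr_ge0 ?fnorm_ge0// real_normK ?num_real//.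
by rewrite exprMn crossp_sqr lerBlDr lerDl sqr_ge0.
Qed.

Lemma ler_fnormD j l : `[j + l] <= `[j] + `[l].
Proof.
rewrite -(@ler_pXn2r _ 2) ?nnegrE ?addr_ge0 ?fnorm_ge0// fnormD_sqr sqrrD.
have := le_trans (ler_norm _) (dotp_le j l); lra.
Qed.

(** The sup-norm sphere of radius $m$ contains $8m$ lattice points. *)
Lemma box_sum (g : nat -> R) n :
  \sum_(k <- box n) g (supnorm k) = \sum_(1 <= m < n.+1) (8 * m)%:R * g m.
Proof.
pose h k := if k != 0 then g (supnorm k) else 0.
have -> : \sum_(k <- box n) g (supnorm k) =
    \sum_(i <- zrange n) \sum_(j <- zrange n) h (i, j).
  by rewrite big_filter big_mkcond big_allpairs.
elim: n => [|n IH].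
  by rewrite /= !big_seq1 /h eqxx big_geq.
pose r i := \sum_(j <- zrange n.+1) h (i, j).
rewrite big_nat_recr// -IH.
have hN (i j : int) : (maxn `|i| `|j| = n.+1)%N -> h (i, j) = g n.+1.
  move=> e; rewrite /h /supnorm/= e; case: eqP => // -[i0 j0].
  by move: e; rewrite i0 j0.
have row (i : int) : (`|i| = n.+1)%N -> \sum_(j <- zrange n) h (i, j) = n.*2.+1%:R * g n.+1.
  move=> iE; rewrite big_seq (eq_bigr (fun=> g n.+1)).
    by rewrite -big_seq big_const_seq count_predT size_zrange iter_addr_0 mulr_natl.
  move=> j; rewrite mem_zrange => jn; apply: hN; rewrite iE; apply/maxn_idPl; exact: leqW.
have Nn : `|n.+1%:Z|%N = n.+1 by [].
have NNn : `|- n.+1%:Z|%N = n.+1 by [].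
have rS i : r i = h (i, n.+1%:Z) + (h (i, - n.+1%:Z) + \sum_(j <- zrange n) h (i, j)).
  exact: zrange_sumS.
(* Passing from radius $n$ to $n+1$ adds two full rows of $2n+3$ points, and two points to each of
   the $2n+1$ old rows: $8(n+1)$ in all. *)
have rN i : (`|i| = n.+1)%N -> r i = n.*2.+3%:R * g n.+1.
  move=> iE; rewrite rS (row _ iE) !hN ?iE ?Nn ?NNn ?maxnn// -!natr1; ring.
have rn : \sum_(i <- zrange n) r i =
    n.*2.+1%:R * (2 * g n.+1) + \sum_(i <- zrange n) \sum_(j <- zrange n) h (i, j).
  transitivity (\sum_(i <- zrange n) (2 * g n.+1 + \sum_(j <- zrange n) h (i, j))).
    rewrite big_seq [RHS]big_seq; apply: eq_bigr => i; rewrite mem_zrange => i_n.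
    rewrite rS !hN ?Nn ?NNn; try (apply/maxn_idPr; exact: leqW).
    by ring.
  by rewrite big_split/= big_const_seq count_predT size_zrange iter_addr_0 -[_ *+ _]mulr_natl.
transitivity (r n.+1%:Z + (r (- n.+1%:Z) + \sum_(i <- zrange n) r i)).
  exact: zrange_sumS.
rewrite (rN _ Nn) (rN _ NNn) rn /= natrM -!natr1 -muln2 natrM; ring.
Qed.

(** Replacing $|k|$ by the smaller sup norm, each sphere contributes $8m\cdot m^{-1}=8$ and at most
    $y$ spheres occur. The explicit 8 enters the budget of the trilinear estimate. *)
Lemma inv_norm_sum (y : R) : 0 <= y ->
  sumle (fun k => if (k != 0) && (`[k] < y) then `[k]^-1 else 0) (8 * y).
Proof.
move=> y0 s us; pose n := Num.truncn y.
have ny : n%:R <= y by rewrite truncn_le.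
have -> : \sum_(k <- s) (if (k != 0) && (`[k] < y) then `[k]^-1 else 0) =
  \sum_(k <- [seq k <- s | (k != 0) && (`[k] < y)]) `[k]^-1.
  by rewrite big_filter -big_mkcond.
apply: (@le_trans _ _ (\sum_(k <- box n) (supnorm k)%:R^-1)); last first.
  rewrite (box_sum (fun m => m%:R^-1)).
  rewrite big_nat_cond (eq_bigr (fun=> 8)); last first.
    move=> m /andP[/andP[m0 _] _]; rewrite natrM mulfK// pnatr_eq0 -lt0n//.
  by rewrite -big_nat_cond sumr_const_nat subSS subn0 -[leLHS]mulr_natr ler_wpM2l.
apply: (@le_trans _ _ (\sum_(k <- [seq k <- s | (k != 0) && (`[k] < y)]) (supnorm k)%:R^-1)).
  rewrite big_filter [leRHS]big_filter; apply: ler_sum => k /andP[k0 _].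
  by rewrite lef_pV2 ?posrE ?fnorm_gt0 ?ltr0n ?supnorm_gt0// supnorm_le.
apply: ler_sum_sub; [by move=> k; rewrite invr_ge0|exact: filter_uniq|exact: uniq_box|].
move=> k; rewrite mem_filter mem_box => /andP[/andP[k0 ky] _]; rewrite k0/=.
rewrite -ltnS -(ltr_nat R); apply: le_lt_trans (supnorm_le k) _.
by apply: lt_trans ky _; rewrite truncnS_gt.
Qed.

(** Summing over spheres leaves $\sum_m 8m^{1-2a}$, which is dominated by the telescoping sum of
    $m^{-r}-(m+1)^{-r}\ge r\,m^{-r}/(m+1)$. The exponent is $r=\min(1,2a-2)$, as the chord bound
    needs $r\le1$, and $m+1\le2m$ turns 8 into 16. *)
Lemma inv_pow_sum (a : R) : 1 < a -> exists C : R, 0 < C /\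
  sumle (fun k => if k != 0 then `[k] `^ (- (2 * a)) else 0) C.
Proof.
move=> a1; pose r := Num.min 1 (2 * a - 2).
have r0 : 0 < r by rewrite lt_min ltr01/=; lra.
have r1 : r <= 1 by rewrite ge_min lexx.
have r2 : r <= 2 * a - 2 by rewrite ge_min lexx orbT.
exists (16 / r); split => [|s us]; first by rewrite divr_gt0.
have -> : \sum_(k <- s) (if k != 0 then `[k] `^ (- (2 * a)) else 0) =
  \sum_(k <- [seq k <- s | k != 0]) `[k] `^ (- (2 * a)) by rewrite big_filter -big_mkcond.
pose n := \max_(k <- s) supnorm k.
pose t (m : nat) : R := m%:R `^ (- (2 * a)).
apply: (@le_trans _ _ (\sum_(k <- box n) t (supnorm k))).
  apply: (@le_trans _ _ (\sum_(k <- [seq k <- s | k != 0]) t (supnorm k))).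
    rewrite big_filter [leRHS]big_filter; apply: ler_sum => k k0.
    rewrite /t !powRN lef_pV2 ?posrE ?powR_gt0 ?fnorm_gt0 ?ltr0n ?supnorm_gt0//.
    by rewrite ge0_ler_powR ?nnegrE ?fnorm_ge0 ?supnorm_le//; lra.
  apply: ler_sum_sub; [by move=> k; exact: powR_ge0|exact: filter_uniq|exact: uniq_box|].
  move=> k; rewrite mem_filter mem_box => /andP[-> ks]/=.
  by rewrite /n (big_rem k)//= leq_max leqnn.
rewrite box_sum.
pose q (m : nat) : R := m%:R `^ (- r).
apply: (@le_trans _ _ (\sum_(1 <= m < n.+1) 16 / r * (q m - q m.+1))).
  rewrite big_nat_cond [leRHS]big_nat_cond; apply: ler_sum => m /andP[/andP[m0 _] _].
  have m0' : 0 < m%:R :> R by rewrite ltr0n.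
  have m1' : 1 <= m%:R :> R by rewrite ler1n.
  have M0 : 0 < m.+1%:R :> R by rewrite ltr0n.
  have E1 : (8 * m)%:R * t m <= 8 * m%:R `^ (- 1 - r).
    rewrite natrM -mulrA ler_pM2l// /t -[X in X * _](powRr1 (ltW m0')) -powRD.
      by apply: ler_powR => //; lra.
    by rewrite (gt_eqF m0') implybT.
  apply: (le_trans E1).
  have E2 : q m.+1 = q m * (m%:R / m.+1%:R) `^ r.
    rewrite /q powRM ?invr_ge0 ?(ltW m0') ?(ltW M0)// mulrA -powRD ?(gt_eqF m0') ?implybT//.
    by rewrite addNr powRr0 mul1r -(powR_inv1 (ltW M0)) -powRrM mulN1r.
  have E3 : (m%:R / m.+1%:R) `^ r <= 1 - r / m.+1%:R.
    have /powR_le_chord h : 0 <= r <= 1 by rewrite (ltW r0).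
    apply: le_trans (h _ _) _; first exact: divr_gt0.
    rewrite le_eqVlt; apply/orP; left; apply/eqP.
    by rewrite -natr1; field; rewrite gt_eqF// natr1.
  have q0 : 0 < q m by exact: powR_gt0.
  have E4 : q m * (r / m.+1%:R) <= q m - q m.+1.
    by rewrite lerBrDr -lerBrDl -[X in _ <= X - _]mulr1 -mulrBr E2 ler_pM2l.
  have rr : 0 <= 16 / r by rewrite divr_ge0// ltW.
  apply: le_trans (ler_wpM2l rr E4).
  have -> : m%:R `^ (- 1 - r) = q m / m%:R.
    by rewrite /q -(powR_inv1 (ltW m0')) -powRD ?(gt_eqF m0') ?implybT// addrC.
  have -> : 16 / r * (q m * (r / m.+1%:R)) = q m * (16 / m.+1%:R).
    by field; rewrite !gt_eqF// natr1.
  rewrite mulrCA; apply: ler_wpM2l; first exact: ltW.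
  rewrite ler_pdivrMr// mulrAC ler_pdivlMr// -natr1; lra.
rewrite -mulr_sumr.
have -> : \sum_(1 <= m < n.+1) (q m - q m.+1) = q 1%N - q n.+1.
  under eq_bigr do rewrite -opprB.
  by rewrite sumrN telescope_sumr// opprB.
rewrite ler_piMr ?divr_ge0 ?(ltW r0)//.
rewrite /q powR1; have := powR_ge0 (n.+1%:R : R) (- r); lra.
Qed.

End lattice.

(** * The trilinear estimate *)

Section kernel.
Context {R : realType}.

(* Here and below [x <= y <= z] are the norms of frequencies [j], [l], [m] with
   [j + l + m = 0], and [S] is [|j x l|], twice the area of the triangle that
   they form. *)
Lemma triangle_area_le (x y z S : R) : 0 < x -> 0 < y -> y <= z <= x + y ->
  S ^+ 2 = x ^+ 2 * y ^+ 2 - ((z ^+ 2 - x ^+ 2 - y ^+ 2) / 2) ^+ 2 ->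
  4 * ((z - y) * S) ^+ 2 <= x ^+ 4 * (y * z).
Proof.
move=> x0 y0 /andP[yz zxy] SE; pose h := z - y.
have zE : z = y + h by rewrite /h; ring.
have h0 : 0 <= h by rewrite /h; lra.
have hx : h <= x by rewrite /h; lra.
(* Heron's formula in terms of $h=z-y$: the two sides differ by $(x^2-h^2)^2/4$. The conclusion then
   follows from $4h^2(x^2-h^2)\le x^4$. *)
have S2 : S ^+ 2 <= (x ^+ 2 - h ^+ 2) * (y * z).
  rewrite SE -subr_ge0.
  have -> : (x ^+ 2 - h ^+ 2) * (y * z) -
      (x ^+ 2 * y ^+ 2 - ((z ^+ 2 - x ^+ 2 - y ^+ 2) / 2) ^+ 2) =
      (x ^+ 2 - h ^+ 2) ^+ 2 / 4 by rewrite zE; field.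
  by rewrite divr_ge0 ?sqr_ge0.
rewrite exprMn -/h.
apply: (@le_trans _ _ (4 * (h ^+ 2 * ((x ^+ 2 - h ^+ 2) * (y * z))))).
  by rewrite ler_wpM2l// ler_wpM2l// sqr_ge0.
have -> : 4 * (h ^+ 2 * ((x ^+ 2 - h ^+ 2) * (y * z))) =
  (4 * (h ^+ 2 * (x ^+ 2 - h ^+ 2))) * (y * z) by ring.
apply: ler_wpM2r; first by rewrite mulr_ge0//; lra.
have : 0 <= (x ^+ 2 - 2 * h ^+ 2) ^+ 2 by exact: sqr_ge0.
lra.
Qed.

(** In the ratio $Z=z/y$ this is Bernoulli's inequality $1-Z^{-2a}\le a(1-Z^{-2})$. The leftover
    factor $a(xy)^{1-a}$ is at most $13/12$ because $xy\ge2$, and $a\le2s$ turns $(yz)^{a/2}$ into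
    $(yz)^s$. *)
Lemma powR_sub_le (x y z a s : R) : 1 <= x -> 2 <= y -> y <= z ->
  1 <= a <= 2 -> a <= 2 * s ->
  z `^ (2 * a) - y `^ (2 * a) <=
  13 / 12 * (z / y - y / z) / (x * y) * ((x * y * z) `^ a * (y * z) `^ s).
Proof.
move=> x1 y2 yz a12 as_; have /andP[a1 a2] := a12.
have x0 : 0 < x by lra.
have y0 : 0 < y by lra.
have z0 : 0 < z by lra.
pose Z := z / y; have zE : z = y * Z by rewrite /Z mulrCA mulfV ?mulr1// gt_eqF.
have Z1 : 1 <= Z by rewrite /Z ler_pdivlMr// mul1r.
have Z0 : 0 < Z by lra.
pose b := Z `^ (a / 2); pose Y := y `^ a; pose Xa := x `^ a.
have b0 : 0 < b by exact: powR_gt0.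
have Y0 : 0 < Y by exact: powR_gt0.
have Xa0 : 0 < Xa by exact: powR_gt0.
have bE : Z `^ a = b ^+ 2.
  by rewrite /b -powR_mulrn ?powR_ge0// -powRrM; congr (_ `^ _); lra.
have zaE : z `^ a = Y * b ^+ 2 by rewrite zE powRM ?ltW// bE.
have E1 : z `^ (2 * a) = (Y * b ^+ 2) ^+ 2.
  by rewrite (mulrC 2) powRrM zaE powR_mulrn// ltW// mulr_gt0// exprn_gt0.
have E2 : y `^ (2 * a) = Y ^+ 2 by rewrite (mulrC 2) powRrM powR_mulrn ?powR_ge0.
have E3 : (x * y * z) `^ a = Xa * Y * (Y * b ^+ 2).
  by rewrite !powRM ?mulr_ge0 ?ltW// zaE.
have yz1 : 1 <= y * z by rewrite mulr_ege1//; lra.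
have E4 : Y * b <= (y * z) `^ s.
  have -> : Y * b = (y * z) `^ (a / 2).
    rewrite zE mulrA -expr2 powRM ?exprn_ge0 ?(ltW y0) ?(ltW Z0)// -/b.
    by rewrite -(powR_mulrn 2 (ltW y0)) -powRrM /Y; congr (_ `^ _ * _); lra.
  by apply: ler_powR => //; lra.
have bZ : b <= Z.
  by rewrite /b -[leRHS]powRr1 ?(ltW Z0)//; apply: ler_powR => //; lra.
have E5 : 1 - (b ^+ 4)^-1 <= a * (1 - (Z ^+ 2)^-1).
  have ZN2 : Z `^ (- 2) = (Z ^+ 2)^-1 by rewrite powRN powR_mulrn ?ltW.
  have := @bernoulli_powR _ (Z `^ (- 2)) a (powR_gt0 _ Z0) a1.
  have -> : (Z `^ (- 2)) `^ a = (b ^+ 4)^-1.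
    have -> : b ^+ 4 = (Z `^ a) ^+ 2 by rewrite bE -exprM.
    by rewrite -powR_mulrn ?powR_ge0// -powRN -!powRrM; congr (_ `^ _); ring.
  rewrite ZN2; lra.
have R2 : 2 <= x * y.
  by rewrite -[2]mul1r ler_pM//; lra.
have E6 : a / (Xa * Y) <= 13 / 12 / (x * y).
  have := sub_mulr_powR_le a12 R2.
  have xy0 : 0 < x * y by lra.
  rewrite powRB; last by rewrite (gt_eqF xy0) implybT.
  rewrite powRr1 ?(ltW xy0)// (powRM _ (ltW x0) (ltW y0)) -/Xa -/Y => h.
  by rewrite ler_pdivlMr// mulrAC -mulrA.
rewrite E1 E2 E3.
have -> : z / y - y / z = Z * (1 - (Z ^+ 2)^-1).
  by rewrite {2}zE /Z; field; rewrite !gt_eqF.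
have ZZ : 0 <= 1 - (Z ^+ 2)^-1.
  by rewrite subr_ge0 invf_le1 ?exprn_gt0// expr_ge1// ltW.
apply: (@le_trans _ _ (a / (Xa * Y) * (Z * (1 - (Z ^+ 2)^-1)) *
                       (Xa * Y * (Y * b ^+ 2) * (Y * b)))).
  have -> : a / (Xa * Y) * (Z * (1 - (Z ^+ 2)^-1)) *
                       (Xa * Y * (Y * b ^+ 2) * (Y * b)) =
            Y ^+ 2 * b ^+ 3 * (Z * (a * (1 - (Z ^+ 2)^-1))).
    by field; rewrite !gt_eqF.
  have -> : (Y * b ^+ 2) ^+ 2 - Y ^+ 2 = Y ^+ 2 * b ^+ 3 * (b * (1 - (b ^+ 4)^-1)).
    by field; rewrite gt_eqF.
  rewrite ler_wpM2l ?mulr_ge0 ?exprn_ge0 ?(ltW b0) ?(ltW Y0)//.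
  apply: ler_pM => //; first exact: ltW.
  rewrite subr_ge0 invf_le1 ?exprn_gt0// expr_ge1 ?(ltW b0)//.
  by apply: powR_ge1 => //; lra.
have -> : 13 / 12 * (Z * (1 - (Z ^+ 2)^-1)) / (x * y) *
   (Xa * Y * (Y * b ^+ 2) * (y * z) `^ s) = 
   13 / 12 / (x * y) * (Z * (1 - (Z ^+ 2)^-1)) *
   (Xa * Y * (Y * b ^+ 2) * (y * z) `^ s) by ring.
have zz : 0 <= Z * (1 - (Z ^+ 2)^-1) by rewrite mulr_ge0// ltW.
have kk : 0 <= Xa * Y * (Y * b ^+ 2).
  by rewrite !mulr_ge0 ?exprn_ge0 ?(ltW b0) ?(ltW Y0) ?(ltW Xa0).
apply: ler_pM.
- by rewrite mulr_ge0// divr_ge0 ?mulr_ge0 ?(ltW Y0) ?(ltW Xa0)//; lra.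
- by rewrite mulr_ge0// mulr_ge0 ?(ltW Y0) ?(ltW b0).
- exact: ler_wpM2r.
- exact: ler_wpM2l.
Qed.

(** Concavity gives $z^s-y^s\le s\,y^{s-1}(z-y)$, which produces the factor $z-y$ that
    [triangle_area_le] can absorb; $(z/y)^a\le(z/y)^2$ and $x\le x^a$ remove the remaining
    dependence on $a$. *)
Lemma powR_add_le (x y z a s k : R) : 1 <= x -> 0 < y -> y <= z ->
  1 <= a <= 2 -> 0 <= s <= 1 -> s * (x * z) `^ (2^-1 - s) <= k ->
  2^-1 * (z `^ (2 * a) + y `^ (2 * a)) * ((z `^ s - y `^ s) / x `^ s) <=
  k * (2^-1 * ((z / y) ^+ 2 + (y / z) ^+ 2)) * (z - y) / (x * y * Num.sqrt (x * z)) *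
  ((x * y * z) `^ a * (y * z) `^ s).
Proof.
move=> x1 y0 yz /andP[a1 a2] /andP[s0 s1] hk.
have x0 : 0 < x by lra.
have z0 : 0 < z by lra.
have xz0 : 0 < x * z by exact: mulr_gt0.
pose Z := z / y; have zE : z = y * Z by rewrite /Z mulrCA mulfV ?mulr1// gt_eqF.
have Z1 : 1 <= Z by rewrite /Z ler_pdivlMr// mul1r.
have Z0 : 0 < Z by lra.
pose b := Z `^ a; pose Y := y `^ a; pose Xa := x `^ a.
have b0 : 0 < b by exact: powR_gt0.
have Y0 : 0 < Y by exact: powR_gt0.
have Xa0 : 0 < Xa by exact: powR_gt0.
have zaE : z `^ a = Y * b by rewrite zE powRM ?ltW.
have E1 : z `^ (2 * a) = (Y * b) ^+ 2.
  by rewrite (mulrC 2) powRrM zaE powR_mulrn// ltW// mulr_gt0.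
have E2 : y `^ (2 * a) = Y ^+ 2 by rewrite (mulrC 2) powRrM powR_mulrn ?powR_ge0.
have E3 : (x * y * z) `^ a = Xa * Y * (Y * b).
  by rewrite !powRM ?mulr_ge0 ?ltW// zaE.
have b1 : 1 <= b by apply: powR_ge1 => //; lra.
have bZ : b <= Z ^+ 2 by rewrite /b -powR_mulrn ?(ltW Z0)//; apply: ler_powR.
have Xx : x <= Xa by exact: le1r_powR.
have F1 : 2^-1 * ((Y * b) ^+ 2 + Y ^+ 2) <=
    2^-1 * ((z / y) ^+ 2 + (y / z) ^+ 2) / x * (Xa * Y * (Y * b)).
  have -> : y / z = Z^-1 by rewrite /Z invf_div.
  rewrite -/Z.
  have -> : 2^-1 * ((Y * b) ^+ 2 + Y ^+ 2) =
    2^-1 * (b + b^-1) / Xa * (Xa * Y * (Y * b)) by field; rewrite !gt_eqF.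
  rewrite ler_wpM2r ?mulr_ge0 ?(ltW b0) ?(ltW Y0) ?(ltW Xa0)//.
  apply: ler_pM.
  - by rewrite mulr_ge0// addr_ge0 ?invr_ge0// ltW.
  - by rewrite invr_ge0 ltW.
  - rewrite ler_pM2l// exprVn -subr_ge0; set T := Z ^+ 2.
    have T0 : 0 < T by rewrite exprn_gt0.
    have -> : T + T^-1 - (b + b^-1) = (T - b) * (b * T - 1) / (b * T).
      by field; rewrite !gt_eqF.
    have bT : 1 <= b * T by rewrite mulr_ege1// (le_trans b1 bZ).
    by apply: divr_ge0; [apply: mulr_ge0; rewrite subr_ge0|exact: ltW (mulr_gt0 b0 T0)].
  - by rewrite lef_pV2 ?posrE.
have F2 : (z `^ s - y `^ s) / x `^ s <=
   k * (z - y) / (y * Num.sqrt (x * z)) * (y * z) `^ s.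
  have ys0 : 0 < y `^ s by exact: powR_gt0.
  have xs0 : 0 < x `^ s by exact: powR_gt0.
  have zs0 : 0 < z `^ s by exact: powR_gt0.
  have c1 : z `^ s <= y `^ s * (1 + s * (Z - 1)).
    rewrite {1}zE powRM ?(ltW y0) ?(ltW Z0)// ler_wpM2l ?(ltW ys0)//.
    by apply: powR_le_chord => //; rewrite s0 s1.
  have sq0 : 0 < Num.sqrt (x * z) by rewrite sqrtr_gt0.
  have c2 : s / (x * z) `^ s <= k / Num.sqrt (x * z).
    move: hk; rewrite powRB; last by rewrite (gt_eqF xz0) implybT.
    rewrite powR12_sqrt ?(ltW xz0)// mulrCA mulrC => hk.
    by rewrite ler_pdivlMr// mulrC.
  apply: (@le_trans _ _ (y `^ s * (s * (Z - 1)) / x `^ s)).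
    by rewrite ler_wpM2r ?invr_ge0 ?(ltW xs0)//; lra.
  have -> : y `^ s * (s * (Z - 1)) / x `^ s =
     s / (x * z) `^ s * ((Z - 1) * (y * z) `^ s).
    by rewrite !powRM ?(ltW y0) ?(ltW x0) ?(ltW z0)//; field; rewrite !gt_eqF.
  have -> : k * (z - y) / (y * Num.sqrt (x * z)) * (y * z) `^ s =
     k / Num.sqrt (x * z) * ((Z - 1) * (y * z) `^ s).
    by rewrite /Z; field; rewrite !gt_eqF.
  by rewrite ler_wpM2r ?mulr_ge0 ?powR_ge0//; lra.
rewrite E1 E2 E3.
have -> : k * (2^-1 * ((z / y) ^+ 2 + (y / z) ^+ 2)) * (z - y) /
  (x * y * Num.sqrt (x * z)) * (Xa * Y * (Y * b) * (y * z) `^ s) =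
  (2^-1 * ((z / y) ^+ 2 + (y / z) ^+ 2) / x * (Xa * Y * (Y * b))) *
  (k * (z - y) / (y * Num.sqrt (x * z)) * (y * z) `^ s).
  by field; rewrite !gt_eqF ?sqrtr_gt0.
apply: ler_pM => //.
  by rewrite mulr_ge0// addr_ge0 ?sqr_ge0.
by rewrite divr_ge0 ?powR_ge0// subr_ge0 ge0_ler_powR ?nnegrE// ltW.
Qed.

(** Here $g=\sqrt{x/y}$ and $w=\sqrt{z/y}$, so that $w^2\le1+g^2$ is the triangle inequality. The
    targets $1/2$ and $1$ are what the two alternatives of [gevrey_factor_le] allow if the kernel
    constant is to be $1/2$. *)
Lemma univariate_le (g w k : R) : 0 < g < 1 -> 1 <= w -> w ^+ 2 <= 1 + g ^+ 2 ->
  (g ^+ 2 <= 4^-1 /\ k <= 13 / 24) \/ (4^-1 <= g ^+ 2 /\ k <= 29 / 41) ->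
  (1 - g ^+ 2) * (13 / 12 * g * (2^-1 * (w + w^-1))) <= 2^-1 /\
  (1 - g ^+ 2) * (k * (2^-1 * (w ^+ 4 + w ^- 4)) + 13 / 12 * g * (2^-1 * (w + w^-1))) <= 1.
Proof.
move=> /andP[g0 g1] w1 wg hk.
have w0 : 0 < w by lra.
set t := g ^+ 2 in wg hk *.
have t0 : 0 < t by rewrite exprn_gt0.
have t1 : t < 1 by rewrite expr_lt1// ltW.
have V : 2^-1 * (w + w^-1) <= 1 + t ^+ 2 / 8.
  have wt : (w ^+ 2 - 1) ^+ 2 <= t ^+ 2.
    by rewrite ler_pXn2r ?nnegrE//; [lra|rewrite subr_ge0 expr_ge1//; lra|lra].
  have -> : 2^-1 * (w + w^-1) = 1 + (w ^+ 2 - 1) ^+ 2 / (2 * w * (w + 1) ^+ 2).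
    by field; rewrite !gt_eqF//; lra.
  rewrite lerD2l; apply: ler_pM => //; first exact: sqr_ge0.
    by rewrite invr_ge0 mulr_ge0 ?sqr_ge0//; lra.
  rewrite lef_pV2 ?posrE ?mulr_gt0 ?exprn_gt0//; try lra.
  have : 2 ^+ 2 <= (w + 1) ^+ 2 by rewrite ler_pXn2r ?nnegrE//; lra.
  nra.
have V0 : 0 <= 2^-1 * (w + w^-1) by rewrite mulr_ge0// addr_ge0// ?invr_ge0 ltW.
have C : 2^-1 * (w ^+ 4 + w ^- 4) <= 2^-1 * ((1 + t) ^+ 2 + (1 + t) ^- 2).
  rewrite ler_pM2l// -subr_ge0.
  have -> : w ^+ 4 = (w ^+ 2) ^+ 2 by rewrite -exprM.
  set v := (w ^+ 2) ^+ 2; set T := (1 + t) ^+ 2.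
  have v1 : 1 <= v by rewrite !expr_ge1// ?exprn_ge0//; lra.
  have vT : v <= T by rewrite ler_pXn2r ?nnegrE ?exprn_ge0//; lra.
  have -> : T + T^-1 - (v + v^-1) = (T - v) * (v * T - 1) / (v * T).
    by field; rewrite !gt_eqF//; lra.
  have v0 : 0 <= v := le_trans ler01 v1; have T1 : 1 <= T := le_trans v1 vT.
  have T0 : 0 <= T := le_trans ler01 T1.
  apply: divr_ge0; last exact: mulr_ge0.
  by apply: mulr_ge0; rewrite subr_ge0//; exact: mulr_ege1.
have C0 : 0 <= 2^-1 * (w ^+ 4 + w ^- 4).
  by rewrite mulr_ge0// addr_ge0// ?invr_ge0 exprn_ge0// ltW.
(* Trading $g$ for $t=g^2$ makes the remaining bounds polynomial in $t$; equality holds at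
   $g=1/2$. *)
have g2 : g <= t + 4^-1.
  have : 0 <= (g - 2^-1) ^+ 2 by exact: sqr_ge0.
  rewrite /t; lra.
have g20 : 0 <= (1 - t) * (t + 4^-1) by rewrite mulr_ge0//; lra.
have V9 : 2^-1 * (w + w^-1) <= 9 / 8.
  apply: (le_trans V); have : t ^+ 2 <= 1 by rewrite exprn_ile1//; lra.
  lra.
have gV (v : R) : 0 <= v -> 2^-1 * (w + w^-1) <= v ->
    g * (2^-1 * (w + w^-1)) <= (t + 4^-1) * v by move=> v0 h; rewrite ler_pM// ltW.
have t10 : 0 <= 1 - t by lra.
split.
  have h := gV (9 / 8) ltac:(lra) V9.
  have {}h := ler_wpM2l t10 h.
  have : 0 <= (t - 3 / 8) ^+ 2 by exact: sqr_ge0.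
  lra.
have {}hk : (t <= 4^-1 /\ k * (2^-1 * (w ^+ 4 + w ^- 4)) <=
               13 / 24 * (2^-1 * ((1 + t) ^+ 2 + (1 + t) ^- 2))) \/
         (4^-1 <= t /\ k * (2^-1 * (w ^+ 4 + w ^- 4)) <=
               29 / 41 * (2^-1 * ((1 + t) ^+ 2 + (1 + t) ^- 2))).
  case: hk => -[tk kk]; [left|right]; split=> //.
    by apply: le_trans (ler_wpM2r C0 kk) _; rewrite ler_wpM2l//; lra.
  by apply: le_trans (ler_wpM2r C0 kk) _; rewrite ler_wpM2l//; lra.
case: hk => -[tk kk].
  have i1 : (1 + t) ^- 2 <= 1.
    have t2 : 1 <= 1 + t by rewrite lerDl ltW.
    have t3 : 0 < 1 + t := lt_le_trans ltr01 t2.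
    by rewrite invf_le1 ?exprn_gt0// expr_ge1// ltW.
  have i2 : (1 + t) ^+ 2 <= 1 + 9 / 4 * t.
    have : t * t <= t * 4^-1 by rewrite ler_wpM2l// ltW.
    rewrite expr2; lra.
  have V2 : 2^-1 * (w + w^-1) <= 129 / 128.
    apply: (le_trans V); have : t ^+ 2 <= 4^-1 ^+ 2 by rewrite ler_pXn2r ?nnegrE//; lra.
    lra.
  have h := gV (129 / 128) ltac:(lra) V2.
  apply: (@le_trans _ _ ((1 - t) * (13 / 24 * (1 + 9 / 8 * t) +
                                    13 / 12 * ((t + 4^-1) * (129 / 128))))).
    by apply: ler_wpM2l => //; lra.
  have : 0 <= (t - 4^-1) ^+ 2 by exact: sqr_ge0.
  nra.
(* The chord of the convex function $(1+t)^{-2}$ over $[1/4,1]$. *)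
have i1 : (1 + t) ^- 2 <= 77 / 100 - 13 / 25 * t.
  rewrite -[leLHS]mul1r ler_pdivrMr ?exprn_gt0//; last lra.
  rewrite -subr_ge0.
  have -> : (77 / 100 - 13 / 25 * t) * (1 + t) ^+ 2 - 1 =
     (1 - t) * (t - 4^-1) * (13 / 25 * t + 92 / 100) by field.
  by rewrite !mulr_ge0 ?subr_ge0//; lra.
have h := gV (1 + t ^+ 2 / 8) ltac:(rewrite addr_ge0// divr_ge0// sqr_ge0) V.
pose r := t - 4^-1; have tE : t = r + 4^-1 by rewrite /r; ring.
have r0 : 0 <= r by rewrite /r; lra.
apply: (@le_trans _ _ ((1 - t) * (29 / 82 * ((1 + t) ^+ 2 + (77 / 100 - 13 / 25 * t)) +
                                    13 / 12 * ((t + 4^-1) * (1 + t ^+ 2 / 8))))).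
  by apply: ler_wpM2l => //; lra.
rewrite tE.
have : 0 <= (r - 3 / 200) ^+ 2 by exact: sqr_ge0.
have : 0 <= r ^+ 2 by exact: sqr_ge0.
have : 0 <= r ^+ 3 by exact: exprn_ge0.
have : 0 <= r ^+ 4 by exact: exprn_ge0.
lra.
Qed.


(** The fractions $u=x/(x+y)$ and $u=y/(x+y)$ add up to 1, and $u\le u^s$ for each of them. *)
Lemma powR_subadditive (x y s : R) : 0 <= x -> 0 <= y -> 0 < s <= 1 ->
  (x + y) `^ s <= x `^ s + y `^ s.
Proof.
move=> x0 y0 /andP[s0 s1].
move: x0; rewrite le_eqVlt => /predU1P[<-|x0].
  by rewrite add0r powR0 ?gt_eqF// add0r.
move: y0; rewrite le_eqVlt => /predU1P[<-|y0].
  by rewrite !addr0 powR0 ?addr0// gt_eqF.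
have xy0 : 0 < x + y by lra.
have key (u : R) : 0 < u -> u <= 1 -> u <= u `^ s.
  move=> u0 u1; have ui : 0 < u^-1 by rewrite invr_gt0.
  have ui1 : 1 <= u^-1 by rewrite invr_ge1 ?unitfE ?gt_eqF.
  have us0 : 0 < u `^ s by exact: powR_gt0.
  have /(powR_le_chord ui) : 0 <= s <= 1 by lra.
  rewrite -(powR_inv1 (ltW u0)) -powRrM mulN1r powRN powR_inv1 ?(ltW u0)// => h.
  rewrite -lef_pV2 ?posrE//; apply: (le_trans h).
  have : (1 - s) * 1 <= (1 - s) * u^-1 by rewrite ler_wpM2l//; lra.
  lra.
have ex (v : R) : 0 < v -> v <= x + y -> v / (x + y) * (x + y) `^ s <= v `^ s.
  move=> v0 vxy.
  have : v / (x + y) <= (v / (x + y)) `^ s.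
    by apply: key; rewrite ?divr_gt0// ler_pdivrMr// mul1r.
  move=> /(ler_wpM2r (powR_ge0 (x + y) s)) /le_trans; apply.
  by rewrite -powRM ?divr_ge0 ?(ltW v0) ?(ltW xy0)// divfK ?gt_eqF.
have := lerD (ex x x0 ltac:(lra)) (ex y y0 ltac:(lra)).
by rewrite -mulrDl -mulrDl mulfV ?gt_eqF// mul1r.
Qed.

Lemma sub_weight_le (A B e1 e2 e : R) : 0 <= A -> 0 <= B -> 0 <= e2 -> 0 <= e ->
  e1 * e <= 1 -> (A * e1 - B * e2) * e <= A.
Proof.
move=> A0 B0 e20 e0 h; rewrite mulrBl -mulrA lerBlDr.
by apply: (@le_trans _ _ A); [rewrite ler_piMr|rewrite lerDl !mulr_ge0].
Qed.

(** Factoring out $y^{2a}$, the weighted difference becomes $\mu e^{-X(1-\rho)}-e^{-X(1+\rho)}$ with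
    $X=d\,x^s$, $\mu=(z/y)^{2a}$ and $\rho=(z^s-y^s)/x^s$, so [gevrey_factor_le] removes $d$. The
    area bound then replaces $(z-y)S$ by $\frac12x^2\sqrt{yz}$, and what remains depends on two
    ratios of sides. *)
Lemma kernel_main (x y z S a s d : R) :
  1 <= x -> x < y -> y <= z <= x + y -> 2 <= y ->
  1 <= a <= 2 -> a <= 2 * s -> s <= 1 -> 0 <= d -> 0 <= S ->
  S ^+ 2 = x ^+ 2 * y ^+ 2 - ((z ^+ 2 - x ^+ 2 - y ^+ 2) / 2) ^+ 2 ->
  S * ((x^-1 - y^-1) *
    (z `^ (2 * a) * expR (2 * d * z `^ s) - y `^ (2 * a) * expR (2 * d * y `^ s))) *
    expR (- (d * (x `^ s + y `^ s + z `^ s))) <=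
  2^-1 / Num.sqrt (x * y) * ((x * y * z) `^ a * (y * z) `^ s).
Proof.
move=> x1 xy yzx y2 a12 as_ s1 d0 S0 SE.
have /andP[yz zxy] := yzx; have /andP[a1 a2] := a12.
have x0 : 0 < x by lra.
have y0 : 0 < y by lra.
have z0 : 0 < z by lra.
have s2 : 2^-1 <= s by lra.
set N := (x * y * z) `^ a * (y * z) `^ s.
have N0 : 0 < N by rewrite mulr_gt0// powR_gt0// !mulr_gt0.
(* If $4x\le y$ then $xz\ge4$ and the better constant applies; otherwise only $xz\ge2$ is known. *)
pose k : R := if x / y <= 4^-1 then 13 / 24 else 29 / 41.
pose rho := (z `^ s - y `^ s) / x `^ s.
pose mu := z `^ (2 * a) / y `^ (2 * a).
have xs0 : 0 < x `^ s by exact: powR_gt0.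
have ya0 : 0 < y `^ (2 * a) by exact: powR_gt0.
have s0 : 0 <= s by apply: le_trans s2; rewrite invr_ge0.
have y0' := ltW y0; have z0' := ltW z0; have a0 : 0 <= 2 * a by rewrite mulr_ge0// (le_trans ler01).
have rho01 : 0 <= rho <= 1.
  have r0' : 0 <= z `^ s - y `^ s by rewrite subr_ge0 ge0_ler_powR.
  rewrite divr_ge0 ?(ltW xs0)//= ler_pdivrMr// mul1r lerBlDr.
  apply: le_trans (powR_subadditive (ltW x0) y0' _); last lra.
  by rewrite ge0_ler_powR// nnegrE addr_ge0// ltW.
have mu1 : 1 <= mu by rewrite ler_pdivlMr// mul1r ge0_ler_powR.
have B1 := powR_sub_le x1 y2 yz a12 as_.
have B2 : 2^-1 * (z `^ (2 * a) + y `^ (2 * a)) * rho <=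
  k * (2^-1 * ((z / y) ^+ 2 + (y / z) ^+ 2)) * (z - y) / (x * y * Num.sqrt (x * z)) * N.
  have s12 : 2^-1 <= s <= 1 by lra.
  apply: powR_add_le => //; first lra.
  rewrite /k; case: ifPn => [xy4|_].
    apply: mulr_powR_le4 => //.
    have : 4 * x <= y by move: xy4; rewrite ler_pdivrMr//; lra.
    have : 1 * z <= x * z by rewrite ler_wpM2r//; lra.
    lra.
  apply: mulr_powR_le2 => //.
  have : 1 * z <= x * z by rewrite ler_wpM2r//; lra.
  lra.
set p := Num.sqrt x; set q := Num.sqrt y; set r := Num.sqrt z.
have p0 : 0 < p by rewrite sqrtr_gt0.
have q0 : 0 < q by rewrite sqrtr_gt0.
have r0 : 0 < r by rewrite sqrtr_gt0.
have xE : x = p ^+ 2 by rewrite sqr_sqrtr// ltW.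
have yE : y = q ^+ 2 by rewrite sqr_sqrtr// ltW.
have zE : z = r ^+ 2 by rewrite sqr_sqrtr// ltW.
have sE1 : Num.sqrt (x * y) = p * q.
  by rewrite sqrtrM ?(ltW x0).
have sE2 : Num.sqrt (x * z) = p * r.
  by rewrite sqrtrM ?(ltW x0).
have T : (z - y) * S <= 2^-1 * x ^+ 2 * (q * r).
  rewrite -(@ler_pXn2r _ 2) ?nnegrE ?mulr_ge0 ?subr_ge0 ?exprn_ge0 ?(ltW x0) ?(ltW q0) ?(ltW r0)//.
  have := triangle_area_le x0 y0 yzx SE.
  have -> : x ^+ 4 * (y * z) = 4 * (2^-1 * x ^+ 2 * (q * r)) ^+ 2.
    by rewrite yE zE; field.
  by rewrite ler_pM2l.
pose g := p / q; pose w := r / q.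
have gE : g ^+ 2 = x / y by rewrite /g expr_div_n -xE -yE.
have wE : w ^+ 2 = z / y by rewrite /w expr_div_n -zE -yE.
have gw : (0 < g < 1 /\ 1 <= w) /\ w ^+ 2 <= 1 + g ^+ 2.
  rewrite gE wE divr_gt0//= ltr_pdivrMr// mul1r ltr_sqrt//.
  rewrite ler_pdivlMr// mul1r ler_sqrt; last exact: ltW.
  by rewrite xy yz ler_pdivrMr// mulrDl mul1r divfK ?gt_eqF// addrC.
have [[g01 w1] wg] := gw.
have hk : (g ^+ 2 <= 4^-1 /\ k <= 13 / 24) \/ (4^-1 <= g ^+ 2 /\ k <= 29 / 41).
  by rewrite gE /k; case: (leP (x / y)) => [h|/ltW h]; [left|right].
have [U1 U2] := univariate_le g01 w1 wg hk.
pose Dl := (z `^ (2 * a) * expR (2 * d * z `^ s) - y `^ (2 * a) * expR (2 * d * y `^ s)) *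
    expR (- (d * (x `^ s + y `^ s + z `^ s))).
have DlE : Dl = y `^ (2 * a) * (mu * expR (- (d * x `^ s * (1 - rho))) -
                                expR (- (d * x `^ s * (1 + rho)))).
  have rE : d * x `^ s * rho = d * (z `^ s - y `^ s).
    by rewrite /rho; field; rewrite gt_eqF.
  have muY : y `^ (2 * a) * mu = z `^ (2 * a) by rewrite mulrC divfK// gt_eqF.
  have e1 : expR (- (d * x `^ s * (1 - rho))) =
      expR (2 * d * z `^ s) * expR (- (d * (x `^ s + y `^ s + z `^ s))).
    by rewrite -expRD; congr expR; rewrite mulrBr mulr1 rE; ring.
  have e2 : expR (- (d * x `^ s * (1 + rho))) =
      expR (2 * d * y `^ s) * expR (- (d * (x `^ s + y `^ s + z `^ s))).
    by rewrite -expRD; congr expR; rewrite mulrDr mulr1 rE; ring.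
  rewrite /Dl e1 e2 -muY; ring.
have c0 : 0 <= S * (x^-1 - y^-1).
  by rewrite mulr_ge0// subr_ge0 lef_pV2 ?posrE// ltW.
have W1 : S * (x^-1 - y^-1) * (z `^ (2 * a) - y `^ (2 * a)) <=
   (1 - g ^+ 2) * (13 / 12 * g * (2^-1 * (w + w^-1))) / (p * q) * N.
  apply: le_trans (ler_wpM2l c0 B1) _.
  have -> : S * (x^-1 - y^-1) *
      (13 / 12 * (z / y - y / z) / (x * y) * ((x * y * z) `^ a * (y * z) `^ s)) =
    (z - y) * S * (13 / 12 * (y - x) * (z + y) / (y * z) / (x * y) ^+ 2 * N).
    by rewrite /N; field; rewrite !gt_eqF.
  have -> : (1 - g ^+ 2) * (13 / 12 * g * (2^-1 * (w + w^-1))) / (p * q) * N =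
    2^-1 * x ^+ 2 * (q * r) * (13 / 12 * (y - x) * (z + y) / (y * z) / (x * y) ^+ 2 * N).
    by rewrite /g /w xE yE zE; field; rewrite !gt_eqF.
  apply: ler_wpM2r => //; rewrite mulr_ge0 ?(ltW N0)// divr_ge0 ?sqr_ge0//.
  have yx0 : 0 <= y - x by rewrite subr_ge0 ltW.
  have zy0 : 0 <= z + y by rewrite addr_ge0 ?(ltW z0) ?(ltW y0).
  by rewrite divr_ge0 ?mulr_ge0 ?(ltW z0) ?(ltW y0).
have W2 : S * (x^-1 - y^-1) * (2^-1 * (z `^ (2 * a) + y `^ (2 * a)) * rho) <=
   2^-1 * (1 - g ^+ 2) * (k * (2^-1 * (w ^+ 4 + w ^- 4))) / (p * q) * N.
  apply: le_trans (ler_wpM2l c0 B2) _; rewrite sE2.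
  set C := 2^-1 * (_ + _).
  have C0 : 0 <= C by rewrite mulr_ge0// addr_ge0 ?sqr_ge0.
  have -> : 2^-1 * (w ^+ 4 + w ^- 4) = C.
    by rewrite /C /w yE zE; field; rewrite !gt_eqF.
  have k0 : 0 <= k by rewrite /k; case: ifP => _; rewrite divr_ge0.
  have -> : S * (x^-1 - y^-1) * (k * C * (z - y) / (x * y * (p * r)) * N) =
    (z - y) * S * (k * C * (y - x) / ((x * y) ^+ 2 * (p * r)) * N).
    by field; rewrite !gt_eqF.
  have -> : 2^-1 * (1 - g ^+ 2) * (k * C) / (p * q) * N =
    2^-1 * x ^+ 2 * (q * r) * (k * C * (y - x) / ((x * y) ^+ 2 * (p * r)) * N).
    by rewrite /g xE yE; field; rewrite !gt_eqF.
  apply: ler_wpM2r => //; rewrite mulr_ge0 ?(ltW N0)// divr_ge0//.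
    by apply: mulr_ge0; [exact: mulr_ge0|rewrite subr_ge0 ltW].
  by rewrite mulr_ge0 ?sqr_ge0// mulr_ge0// ltW.
rewrite (mulrA S) -(mulrA (S * _)) -/Dl.
rewrite sE1.
have pqN : 0 <= (p * q)^-1 * N.
  by rewrite mulr_ge0 ?invr_ge0 ?(ltW N0)// ltW// mulr_gt0.
have X0 : 0 <= d * x `^ s by rewrite mulr_ge0// ltW.
have muE : y `^ (2 * a) * mu = z `^ (2 * a) by rewrite mulrC divfK// gt_eqF.
have [h|h] := gevrey_factor_le mu1 rho01 X0.
  have {}h : Dl <= z `^ (2 * a) - y `^ (2 * a).
    rewrite DlE (le_trans (ler_wpM2l (ltW ya0) h))// mulrBr muE mulr1//.
  apply: le_trans (ler_wpM2l c0 h) _; apply: le_trans W1 _.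
  by rewrite -[leLHS]mulrA -[leRHS]mulrA; apply: ler_wpM2r.
have {}h : Dl <= 2^-1 * (z `^ (2 * a) + y `^ (2 * a)) * rho +
                 2^-1 * (z `^ (2 * a) - y `^ (2 * a)).
  rewrite DlE (le_trans (ler_wpM2l (ltW ya0) h))// -muE le_eqVlt; apply/orP; left.
  by apply/eqP; ring.
apply: le_trans (ler_wpM2l c0 h) _; rewrite mulrDr.
apply: (@le_trans _ _ (2^-1 * ((1 - g ^+ 2) *
   (k * (2^-1 * (w ^+ 4 + w ^- 4)) + 13 / 12 * g * (2^-1 * (w + w^-1)))) * ((p * q)^-1 * N))).
  move: W1 W2; set A := S * _; set b := (p * q)^-1; lra.
by rewrite -[leRHS]mulrA ler_wpM2r// ler_piMr.
Qed.

(** The Gevrey weight is harmless here: the exponent $d(y^s-x^s-z^s)$ of the positive term is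
    nonpositive, so this exponential and the subtracted term are both dropped, and the area bound
    suffices. *)
Lemma kernel_second (x y z S a s d : R) :
  1 <= x -> x < y -> y <= z <= x + y ->
  1 <= a -> 2^-1 <= s -> 0 <= d -> 0 <= S ->
  S ^+ 2 = x ^+ 2 * y ^+ 2 - ((z ^+ 2 - x ^+ 2 - y ^+ 2) / 2) ^+ 2 ->
  S * ((y^-1 - z^-1) *
    (y `^ (2 * a) * expR (2 * d * y `^ s) - x `^ (2 * a) * expR (2 * d * x `^ s))) *
    expR (- (d * (x `^ s + y `^ s + z `^ s))) <=
  2^-1 / Num.sqrt (x * y) * ((x * y * z) `^ a * (y * z) `^ s).
Proof.
move=> x1 xy yzx a1 s2 d0 S0 SE; have /andP[yz zxy] := yzx.
have x0 : 0 < x by lra.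
have y0 : 0 < y by lra.
have z0 : 0 < z by lra.
have T : (z - y) * S <= 2^-1 * x ^+ 2 * Num.sqrt (y * z).
  rewrite -(@ler_pXn2r _ 2) ?nnegrE ?mulr_ge0 ?subr_ge0 ?exprn_ge0 ?(ltW x0) ?sqrtr_ge0//.
  have := triangle_area_le x0 y0 yzx SE.
  have -> : x ^+ 4 * (y * z) = 4 * (2^-1 * x ^+ 2 * Num.sqrt (y * z)) ^+ 2.
    by rewrite [in RHS]exprMn sqr_sqrtr ?mulr_ge0 ?ltW//; field.
  by rewrite ler_pM2l.
have c0 : 0 <= S * (y^-1 - z^-1).
  by rewrite mulr_ge0// subr_ge0 lef_pV2 ?posrE.
have ys : y `^ s <= z `^ s by rewrite ge0_ler_powR ?nnegrE//; lra.
apply: (@le_trans _ _ (S * (y^-1 - z^-1) * y `^ (2 * a))).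
  rewrite (mulrA S) -(mulrA (S * _)); apply: ler_wpM2l => //.
  apply: sub_weight_le; rewrite ?powR_ge0 ?expR_ge0//.
  rewrite -expRD -[leRHS]expR0 ler_expR.
  have -> : 2 * d * y `^ s + - (d * (x `^ s + y `^ s + z `^ s)) =
    d * (y `^ s - x `^ s - z `^ s) by ring.
  rewrite mulr_ge0_le0//; have := powR_ge0 x s; lra.
have -> : S * (y^-1 - z^-1) * y `^ (2 * a) = (z - y) * S * ((y * z)^-1 * y `^ (2 * a)).
  by field; rewrite !gt_eqF.
apply: (@le_trans _ _ (2^-1 * x ^+ 2 * Num.sqrt (y * z) * ((y * z)^-1 * y `^ (2 * a)))).
  by rewrite ler_wpM2r// mulr_ge0 ?powR_ge0// invr_ge0 mulr_ge0// ltW.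
have yz0 : 0 < y * z by exact: mulr_gt0.
have yz1 : 1 <= y * z by rewrite mulr_ege1//; lra.
have xy0 : 0 < x * y by exact: mulr_gt0.
set r := Num.sqrt (y * z); set q := Num.sqrt (x * y).
have r0 : 0 < r by rewrite sqrtr_gt0.
have q0 : 0 < q by rewrite sqrtr_gt0.
have rr : y * z = r ^+ 2 by rewrite sqr_sqrtr// ltW.
have rs : r <= (y * z) `^ s by rewrite /r -powR12_sqrt ?(ltW yz0)//; apply: ler_powR.
have xa : x * y `^ (2 * a) <= (x * y * z) `^ a.
  rewrite !powRM ?mulr_ge0 ?(ltW x0) ?(ltW y0) ?(ltW z0)//.
  have -> : y `^ (2 * a) = y `^ a * y `^ a by rewrite mulr_natl mulr2n powRD// (gt_eqF y0) implybT.
  rewrite mulrA; apply: ler_pM; rewrite ?mulr_ge0 ?powR_ge0 ?(ltW x0)//.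
    by apply: ler_wpM2r; rewrite ?powR_ge0// le1r_powR.
  by rewrite ge0_ler_powR ?nnegrE//; lra.
have qx : x * q <= y * z.
  apply: ler_pM; rewrite ?(ltW x0) ?(ltW q0) ?(ltW xy)//.
  apply: le_trans yz; rewrite /q -[leRHS]ger0_norm ?(ltW y0)// -sqrtr_sqr ler_sqrt ?sqr_ge0//.
  by rewrite expr2 ler_wpM2r ?ltW.
apply: (@le_trans _ _ (2^-1 / q * (x * y `^ (2 * a) * r))); last first.
  apply: ler_wpM2l; first by rewrite divr_ge0// ltW.
  by apply: ler_pM => //; [rewrite mulr_ge0 ?powR_ge0 ?(ltW x0)|exact: ltW].
rewrite rr in qx *.
have -> : 2^-1 * x ^+ 2 * r * ((r ^+ 2)^-1 * y `^ (2 * a)) =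
  2^-1 * x * y `^ (2 * a) / r * x by field; rewrite gt_eqF.
have -> : 2^-1 / q * (x * y `^ (2 * a) * r) = 2^-1 * x * y `^ (2 * a) / r * (r ^+ 2 / q).
  by field; rewrite !gt_eqF.
apply: ler_wpM2l; last by rewrite ler_pdivlMr.
by rewrite divr_ge0 ?(ltW r0)// mulr_ge0 ?powR_ge0// mulr_ge0// ltW.
Qed.

(** The configuration $x=1$, $y=\sqrt2$, $z=\sqrt5$, where $xy<2$. The number $2/5$ separates
    $1-1/\sqrt2$ from $\frac12 2^{-1/4}$; the powers are compared by
    $5^a\le10^{3a/4}\le10^{(a+s)/2}$, from $5^4\le10^3$ and $a\le2s$. *)
Lemma kernel_small (y z S a s d : R) :
  y ^+ 2 = 2 -> z ^+ 2 = 5 -> 0 < y -> 0 < z -> z <= 1 + y ->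
  1 <= a -> a <= 2 * s -> s <= 1 -> 0 <= d -> 0 <= S -> S <= 1 ->
  S * ((1 - y^-1) *
    (z `^ (2 * a) * expR (2 * d * z `^ s) - y `^ (2 * a) * expR (2 * d * y `^ s))) *
    expR (- (d * (1 + y `^ s + z `^ s))) <=
  2^-1 / Num.sqrt y * ((y * z) `^ a * (y * z) `^ s).
Proof.
move=> y2 z5 y0 z0 zy a1 as_ s1 d0 S0 S1.
have s2 : 2^-1 <= s by lra.
have y1 : 1 <= y by rewrite -(@ler_pXn2r _ 2) ?nnegrE ?y2 ?expr1n//; lra.
have yu : y <= 25 / 16 by rewrite -(@ler_pXn2r _ 2) ?nnegrE ?y2//; lra.
have yi : 0 <= 1 - y^-1 <= 2 / 5.
  rewrite subr_ge0 invf_le1// y1/= lerBlDr -lerBlDl.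
  have : 5 / 3 * y^-1 >= 1 by rewrite -ler_pdivrMr ?invr_gt0// mul1r invrK; lra.
  lra.
have /andP[yi0 yi1] := yi.
have ss : z `^ s <= 1 + y `^ s.
  apply: (@le_trans _ _ ((1 + y) `^ s)); first by rewrite ge0_ler_powR ?nnegrE//; lra.
  have := @powR_subadditive 1 y s ler01 (ltW y0); rewrite powR1; apply; lra.
apply: (@le_trans _ _ (1 * (2 / 5 * z `^ (2 * a)))).
  set e := expR (- _).
  have h1 : (z `^ (2 * a) * expR (2 * d * z `^ s) -
             y `^ (2 * a) * expR (2 * d * y `^ s)) * e <= z `^ (2 * a).
    apply: sub_weight_le; rewrite ?powR_ge0 ?expR_ge0//.
    rewrite -expRD -[leRHS]expR0 ler_expR.
    have -> : 2 * d * z `^ s + - (d * (1 + y `^ s + z `^ s)) =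
      d * (z `^ s - 1 - y `^ s) by ring.
    rewrite mulr_ge0_le0//; lra.
  rewrite (mulrA S) -(mulrA (S * _)); apply: le_trans (ler_wpM2l (mulr_ge0 S0 yi0) h1) _.
  rewrite -mulrA; apply: ler_pM => //; first by rewrite mulr_ge0 ?powR_ge0.
  by rewrite ler_wpM2r ?powR_ge0.
have sy : 2 / 5 <= 2^-1 / Num.sqrt y.
  have h : Num.sqrt y <= 5 / 4.
    rewrite -[leRHS]ger0_norm ?divr_ge0// -sqrtr_sqr ler_sqrt ?sqr_ge0//; lra.
  by rewrite ler_pdivlMr ?sqrtr_gt0//; lra.
rewrite mul1r; apply: ler_pM => //; first by rewrite powR_ge0.
have -> : (y * z) `^ a * (y * z) `^ s = (y * z) `^ (a + s).
  by rewrite powRD// (gt_eqF (mulr_gt0 y0 z0)) implybT.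
have E1 : y * z = 10 `^ 2^-1.
  by rewrite powR12_sqrt// -[LHS]ger0_norm ?mulr_ge0 ?ltW// -sqrtr_sqr exprMn y2 z5;
     congr Num.sqrt; lra.
have -> : z `^ (2 * a) = (5 `^ 4) `^ (a / 4).
  by rewrite -powRrM powRrM powR_mulrn ?ltW// z5; congr (_ `^ _); lra.
apply: (@le_trans _ _ ((10 `^ 3) `^ (a / 4))).
  rewrite ge0_ler_powR ?nnegrE ?powR_ge0//; first lra.
  by rewrite !powR_mulrn//; lra.
rewrite E1 -!powRrM; apply: ler_powR; lra.
Qed.

End kernel.

Section complex_facts.
Context {R : realType}.
Implicit Types (z w : R[i]).

Lemma normc_sqr z : cn z ^+ 2 = complex.Re z ^+ 2 + complex.Im z ^+ 2.
Proof. by case: z => x y /=; rewrite sqr_sqrtr// addr_ge0 ?sqr_ge0. Qed.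

Lemma normc_ge0 z : 0 <= cn z.
Proof. by case: z => x y /=; exact: sqrtr_ge0. Qed.

Lemma Re_le_normc z : `|complex.Re z| <= cn z.
Proof.
rewrite -(@ler_pXn2r _ 2) ?nnegrE ?normc_ge0// normc_sqr real_normK ?num_real//.
by rewrite lerDl sqr_ge0.
Qed.

Lemma Im_le_normc z : `|complex.Im z| <= cn z.
Proof.
rewrite -(@ler_pXn2r _ 2) ?nnegrE ?normc_ge0// normc_sqr real_normK ?num_real//.
by rewrite lerDr sqr_ge0.
Qed.

Lemma normc_conj z : cn (conjc z) = cn z.
Proof. by case: z => x y /=; rewrite sqrrN. Qed.

Lemma normc_real (x : R) : cn (x%:C) = `|x|.
Proof. by rewrite /= expr0n addr0 sqrtr_sqr. Qed.

Lemma Re_mulc z w : complex.Re (z * w) =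
  complex.Re z * complex.Re w - complex.Im z * complex.Im w.
Proof. by case: z w => [a b] [c d]. Qed.

Lemma Im_mulc z w : complex.Im (z * w) =
  complex.Re z * complex.Im w + complex.Im z * complex.Re w.
Proof. by case: z w => [a b] [c d]. Qed.

Lemma Re_realM (c : R) z : complex.Re (c%:C * z) = c * complex.Re z.
Proof. by case: z => x y /=; rewrite mul0r subr0. Qed.

Lemma Im_realM (c : R) z : complex.Im (c%:C * z) = c * complex.Im z.
Proof. by case: z => x y /=; rewrite mul0r addr0. Qed.

(** A difference of two nonnegative numbers is at most the larger one in absolute value, so the two
    parts of the kernel are never added and the constant is not doubled. *)
Lemma abs_sub_bound (S p q e B : R) : 0 <= S -> 0 <= e -> 0 <= p -> 0 <= q ->
  S * p * e <= B -> S * q * e <= B -> S * `|p - q| * e <= B.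
Proof.
move=> S0 e0 p0 q0 B1 B2.
have [pq|pq] := leP q p.
  apply: le_trans B1; rewrite ger0_norm ?subr_ge0// ler_wpM2r// ler_wpM2l//; lra.
apply: le_trans B2; rewrite ltr0_norm ?subr_lt0// ler_wpM2r// ler_wpM2l//; lra.
Qed.

Lemma Re_addc z w : complex.Re (z + w) = complex.Re z + complex.Re w.
Proof. by case: z w => [a b] [c d]. Qed.

Lemma Im_addc z w : complex.Im (z + w) = complex.Im z + complex.Im w.
Proof. by case: z w => [a b] [c d]. Qed.

Lemma Re_sum (I : Type) (r : seq I) (F : I -> R[i]) :
  complex.Re (\sum_(i <- r) F i) = \sum_(i <- r) complex.Re (F i).
Proof. by elim: r => [|i r IH]; rewrite ?big_nil// !big_cons Re_addc IH. Qed.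

Lemma Im_sum (I : Type) (r : seq I) (F : I -> R[i]) :
  complex.Im (\sum_(i <- r) F i) = \sum_(i <- r) complex.Im (F i).
Proof. by elim: r => [|i r IH]; rewrite ?big_nil// !big_cons Im_addc IH. Qed.

End complex_facts.

(** * Symmetrisation of sums over the triples with zero sum *)

Section triples.
Context {R : realType}.
Implicit Types (B : seq freq) (f g : freq -> freq -> freq -> R).

Definition triple_sum B f : R :=
  \sum_(j <- B) \sum_(l <- B) \sum_(m <- B) if j + l + m == 0 then f j l m else 0.

Lemma triple_sum_swap B f : triple_sum B f = triple_sum B (fun j l m => f l j m).
Proof.
rewrite /triple_sum exchange_big; apply: eq_bigr => j _; apply: eq_bigr => l _.
by apply: eq_bigr => m _; rewrite (addrC l).
Qed.

Lemma triple_sum_rot B f : triple_sum B f = triple_sum B (fun j l m => f l m j).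
Proof.
rewrite /triple_sum [RHS]exchange_big; apply: eq_bigr => j _.
rewrite [RHS]exchange_big; apply: eq_bigr => l _; apply: eq_bigr => m _.
by rewrite [j + l + m]addrC addrA.
Qed.

Lemma triple_sumD B f g :
  triple_sum B (fun j l m => f j l m + g j l m) = triple_sum B f + triple_sum B g.
Proof.
rewrite /triple_sum -big_split; apply: eq_bigr => j _.
rewrite -big_split; apply: eq_bigr => l _; rewrite -big_split; apply: eq_bigr => m _ /=.
by case: ifP; rewrite ?addr0.
Qed.

Lemma ler_triple_sum B f g :
  (forall j l m, j \in B -> l \in B -> m \in B -> j + l + m = 0 -> f j l m <= g j l m) ->
  triple_sum B f <= triple_sum B g.
Proof.
move=> fg; rewrite /triple_sum.
rewrite big_seq [leRHS]big_seq; apply: ler_sum => j jB.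
rewrite big_seq [leRHS]big_seq; apply: ler_sum => l lB.
rewrite big_seq [leRHS]big_seq; apply: ler_sum => m mB.
by case: eqP => // e; exact: fg.
Qed.

Lemma triple_sumN B f : triple_sum B (fun j l m => - f j l m) = - triple_sum B f.
Proof.
rewrite /triple_sum -sumrN; apply: eq_bigr => j _; rewrite -sumrN; apply: eq_bigr => l _.
by rewrite -sumrN; apply: eq_bigr => m _; case: ifP; rewrite ?oppr0.
Qed.

Lemma ler_norm_triple_sum B f g :
  (forall j l m, j \in B -> l \in B -> m \in B -> j + l + m = 0 -> `|f j l m| <= g j l m) ->
  `|triple_sum B f| <= triple_sum B g.
Proof.
move=> fg; rewrite ler_norml -triple_sumN; apply/andP; split; apply: ler_triple_sum => j l m jB lB mB e.
  by rewrite lerNl (le_trans _ (fg _ _ _ jB lB mB e))// -normrN ler_norm.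
by rewrite (le_trans _ (fg _ _ _ jB lB mB e))// ler_norm.
Qed.

Definition symmetrise f j l m : R :=
  f j l m + f l j m + (f l m j + f m l j) + (f m j l + f j m l).

Lemma triple_sum_symmetrise B f : triple_sum B (symmetrise f) = 6 * triple_sum B f.
Proof.
rewrite /symmetrise !triple_sumD.
have e1 : triple_sum B (fun j l m => f l j m) = triple_sum B f by rewrite -triple_sum_swap.
have e2 : triple_sum B (fun j l m => f l m j) = triple_sum B f by rewrite -triple_sum_rot.
have e3 : triple_sum B (fun j l m => f m j l) = triple_sum B f.
  by rewrite [RHS]triple_sum_rot [RHS]triple_sum_rot.
have e4 : triple_sum B (fun j l m => f m l j) = triple_sum B f.
  by rewrite [RHS]triple_sum_swap [RHS]triple_sum_rot.
have e5 : triple_sum B (fun j l m => f j m l) = triple_sum B f.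
  by rewrite [RHS]triple_sum_swap [RHS]triple_sum_rot [RHS]triple_sum_rot.
rewrite e1 e2 e3 e4 e5; ring.
Qed.

(* Every triple is a permutation of a sorted one. *)
Lemma triple_sum_sorted B (q : freq -> R) f :
  (forall j l m, 0 <= f j l m) ->
  (forall j l m, j + l + m = 0 -> f j l m = f l j m) ->
  (forall j l m, j + l + m = 0 -> f j l m = f l m j) ->
  triple_sum B f <=
  6 * triple_sum B (fun j l m => if q j <= q l <= q m then f j l m else 0).
Proof.
move=> f0 fs fr; rewrite -triple_sum_symmetrise; apply: ler_triple_sum => j l m _ _ _ e.
have e1 : l + j + m = 0 by rewrite (addrC l).
have e2 : l + m + j = 0 by rewrite addrC addrA.
have e3 : m + j + l = 0 by rewrite -addrA addrC.
have e4 : m + l + j = 0 by rewrite (addrC m).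
have e5 : j + m + l = 0 by rewrite (addrC j).
rewrite /symmetrise.
have -> : f l j m = f j l m by rewrite -fs.
have -> : f l m j = f j l m by rewrite -fr.
have -> : f m j l = f j l m by rewrite fr.
have -> : f m l j = f j l m by rewrite fs// -fr.
have -> : f j m l = f j l m by rewrite fs// fr.
have := f0 j l m; set z := f j l m => z0.
case: (leP (q j) (q l)) => ?; case: (leP (q l) (q j)) => ?;
case: (leP (q l) (q m)) => ?; case: (leP (q m) (q l)) => ?;
case: (leP (q j) (q m)) => ?; case: (leP (q m) (q j)) => ? /=; lra.
Qed.

Lemma triple_sum_le_pair B f (g : freq -> freq -> R) : uniq B -> (forall j m, 0 <= g j m) ->
  (forall j l m, f j l m <= g j m) ->
  triple_sum B f <= \sum_(j <- B) \sum_(m <- B) g j m.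
Proof.
move=> uB g0 fg; apply: ler_sum => j _; rewrite exchange_big; apply: ler_sum => m _.
apply: (@le_trans _ _ (\sum_(l <- B) if l == - (j + m) then g j m else 0)).
  by apply: ler_sum => l _; rewrite -addr_eq0 addrA (addrC l j); case: ifP.
have [lB|lB] := boolP (- (j + m) \in B).
  rewrite (big_rem _ lB) /= eqxx big_seq big1 ?addr0// => l.
  by rewrite (mem_rem_uniq _ uB) !inE => /andP[/negPf->].
rewrite big_seq big1 ?g0// => l lB'; case: eqP => // e.
by move: lB; rewrite -e lB'.
Qed.

End triples.

Lemma sum_box_opp (V : nmodType) (f : freq -> V) n :
  \sum_(k <- box n) f (- k) = \sum_(k <- box n) f k.
Proof.
rewrite -(big_map -%R xpredT f); apply: perm_big; apply: uniq_perm.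
- by rewrite map_inj_uniq ?uniq_box//; exact: oppr_inj.
- exact: uniq_box.
- move=> k; apply/mapP/idP => [[l lB ->]|kB]; first by rewrite box_opp.
  by exists (- k); rewrite ?box_opp ?opprK.
Qed.

Lemma sum_pick (T : eqType) (V : nmodType) (B : seq T) (c : T) (g : T -> V) : uniq B ->
  \sum_(l <- B) (if l == c then g l else 0) = if c \in B then g c else 0.
Proof.
move=> uB; have [cB|cB] := boolP (c \in B).
  rewrite (big_rem _ cB) /= eqxx big_seq big1 ?addr0// => l.
  by rewrite (mem_rem_uniq _ uB) !inE => /andP[/negPf->].
rewrite big_seq big1// => l lB; case: eqP => // e.
by move: cB; rewrite -e lB.
Qed.

Section trilinear.
Context {R : realType}.
Variables (a s d : R).
Hypotheses (a12 : 1 <= a <= 2) (as_ : a <= 2 * s) (s1 : s <= 1) (d0 : 0 <= d).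
Implicit Types (j l m k : freq).
Local Notation "`[ k ]" := (@fnorm R k).

(* Symbol of the nonlinearity: in Fourier variables the [k]-th coefficient of
   [R^\perp f . \nabla f] is the sum over [j + l = k] of
   [(j x l) / |j| * f j * f l]. *)
Definition sqg_symbol j l : R := (crossp j l)%:~R / `[j].

Definition gevrey_weight j l k : R :=
  expR (- (d * (`[j] `^ s + `[l] `^ s - `[k] `^ s))).

Lemma sqr_powR (x p : R) : (x `^ p) ^+ 2 = x `^ (2 * p).
Proof. by rewrite -powR_mulrn ?powR_ge0// -powRrM mulrC. Qed.

(** Since [gevrey_weight j l m] is [ew j l m] times $e^{2d|m|^s}$ and [ew] is symmetric, this
    collects all of the dependence on which frequency carries the energy weight. *)
Definition hw (r : R) : R := r `^ (2 * a) * expR (2 * d * r `^ s).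

Definition ew j l m : R := expR (- (d * (`[j] `^ s + `[l] `^ s + `[m] `^ s))).

(* When [j + l + m = 0], summing
   [|m|^(2a) * sqg_symbol j l * gevrey_weight j l m] over the permutations of
   [(j, l, m)] gives [crossp j l * det_symbol j l m * ew j l m]. *)
Definition det_symbol j l m : R :=
  (`[j]^-1 - `[l]^-1) * hw `[m] + (`[l]^-1 - `[m]^-1) * hw `[j] +
  (`[m]^-1 - `[j]^-1) * hw `[l].

Lemma crosspC j l : crossp l j = - crossp j l.
Proof. by rewrite /crossp; ring. Qed.

Lemma crossp_rot j l m : j + l + m = 0 -> crossp l m = crossp j l.
Proof.
move=> jlm; have -> : m = - (j + l) by apply/eqP; rewrite -addr_eq0 addrC jlm.
by rewrite /crossp; case: j {jlm} => ? ?; case: l => ? ? /=; ring.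
Qed.

Lemma ew_swap j l m : ew l j m = ew j l m.
Proof. by rewrite /ew (addrC (`[l] `^ s)). Qed.

Lemma ew_rot j l m : ew l m j = ew j l m.
Proof. by rewrite /ew (addrC _ (`[j] `^ s)) addrA. Qed.

Lemma det_symbol_swap j l m : det_symbol l j m = - det_symbol j l m.
Proof.
rewrite /det_symbol; move: (hw `[j]) (hw `[l]) (hw `[m]) => A B C.
by move: (`[j]^-1) (`[l]^-1) (`[m]^-1) => p q r; ring.
Qed.

Lemma det_symbol_rot j l m : det_symbol l m j = det_symbol j l m.
Proof.
rewrite /det_symbol; move: (hw `[j]) (hw `[l]) (hw `[m]) => A B C.
by move: (`[j]^-1) (`[l]^-1) (`[m]^-1) => p q r; ring.
Qed.

Lemma s_gt0 : 0 < s.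
Proof. by have /andP[a1 _] := a12; move: as_; lra. Qed.

Lemma hw_mono u v : 0 < u -> u <= v -> hw u <= hw v.
Proof.
move=> u0 uv; have v0 : 0 < v by exact: lt_le_trans uv.
have us : u `^ s <= v `^ s.
  by rewrite ge0_ler_powR ?nnegrE ?(ltW s_gt0) ?(ltW u0) ?(ltW v0).
apply: ler_pM; rewrite ?powR_ge0 ?expR_ge0//.
  have a0 : 0 <= 2 * a by have /andP[/(le_trans ler01) ? _] := a12; rewrite mulr_ge0.
  by rewrite ge0_ler_powR ?nnegrE ?(ltW u0) ?(ltW v0).
by rewrite ler_expR -!mulrA ler_pM2l// ler_wpM2l.
Qed.

Lemma kernel_lattice j l m : j != 0 -> l != 0 -> m != 0 -> j + l + m = 0 ->
  `[j] < `[l] -> `[l] <= `[m] ->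
  `|(crossp j l)%:~R| * `|det_symbol j l m| * ew j l m <=
  2^-1 / Num.sqrt (`[j] * `[l]) *
    ((`[j] * `[l] * `[m]) `^ a * (`[l] * `[m]) `^ s).
Proof.
move=> j0 l0 m0 jlm jl lm.
have mE : m = - (j + l) by apply/eqP; rewrite -addr_eq0 addrC jlm.
have mN : `[m] = `[j + l] by rewrite mE fnormN.
set x := `[j] in jl *; set y := `[l] in jl lm *; set z := `[m] in lm mN *.
have x1 : 1 <= x by exact: fnorm_ge1.
have y1 : 1 < y by exact: le_lt_trans jl.
have zxy : z <= x + y by rewrite mN ler_fnormD.
pose D : R := (dotp j l)%:~R.
have zz : z ^+ 2 = x ^+ 2 + y ^+ 2 + 2 * D by rewrite mN fnormD_sqr.
pose S : R := `|(crossp j l)%:~R|.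
have S0 : 0 <= S by exact: normr_ge0.
have SE : S ^+ 2 = x ^+ 2 * y ^+ 2 - ((z ^+ 2 - x ^+ 2 - y ^+ 2) / 2) ^+ 2.
  rewrite /S real_normK ?num_real// crossp_sqr -/x -/y zz -/D; congr (_ - _ ^+ 2).
  by field.
(* Both products are nonnegative, [hw] being increasing. They are estimated separately by
   [kernel_main] or [kernel_small], and by [kernel_second]. *)
have GE : det_symbol j l m = (x^-1 - y^-1) * (hw z - hw y) - (y^-1 - z^-1) * (hw y - hw x).
  rewrite /det_symbol -/x -/y -/z.
  by move: (hw x) (hw y) (hw z) x^-1 y^-1 z^-1 => A B C p q r; ring.
have lt0x : 0 < x by exact: lt_le_trans x1.
have lt0y : 0 < y by exact: lt_trans jl.
have lt0z : 0 < z by exact: lt_le_trans lm.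
(* Lattice vectors shorter than 2 have coordinates in $\{-1,0,1\}$. With $x<y$ this forces $x^2=1$
   and $y^2=2$, and $z\ge y$ excludes the inner product $-1$. *)
have small : y < 2 -> x ^+ 2 = 1 /\ y ^+ 2 = 2 /\ D = 1 /\ S = 1.
  move=> y2.
  have x2E : x ^+ 2 = (j.1 ^+ 2 + j.2 ^+ 2)%:~R by exact: fnorm_sqr.
  have y2E : y ^+ 2 = (l.1 ^+ 2 + l.2 ^+ 2)%:~R by exact: fnorm_sqr.
  have y4 : y ^+ 2 < 4.
    have -> : 4 = 2 ^+ 2 :> R by ring.
    by rewrite ltr_pXn2r ?nnegrE// ltW.
  have xy2 : x ^+ 2 < y ^+ 2 by rewrite ltr_pXn2r ?nnegrE// ltW.
  have x21 : 1 <= x ^+ 2 by rewrite expr_ge1// ltW.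
  have z2y : y ^+ 2 <= z ^+ 2 by rewrite ler_pXn2r ?nnegrE// ltW.
  rewrite zz x2E y2E /D in x21 xy2 y4 z2y; rewrite x2E y2E /D /S -intr_norm.
  rewrite -[2 : R]/(2%:~R) -[4 : R]/(4%:~R) -[1 : R]/(1%:~R) in x21 xy2 y4 z2y.
  rewrite -rmorphM -!rmorphD in z2y.
  rewrite !ler_int !ltr_int /dotp in x21 xy2 y4 z2y.
  suff : [/\ j.1 ^+ 2 + j.2 ^+ 2 = 1, l.1 ^+ 2 + l.2 ^+ 2 = 2, dotp j l = 1 &
             `|crossp j l| = 1] by case=> -> -> -> ->.
  rewrite /dotp /crossp; move: x21 xy2 y4 z2y; clear.
  case: j => j1 j2; case: l => l1 l2 /= i1 i2 i3 i4.
  have unit (i i' : int) : i ^+ 2 + i' ^+ 2 < 4 -> i = -1 \/ i = 0 \/ i = 1.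
    clear => h; have : i ^+ 2 < 2 ^+ 2 by apply: le_lt_trans h; rewrite lerDl sqr_ge0.
    rewrite -[i ^+ 2](real_normK (num_real i)) ltr_pXn2r ?nnegrE//; lia.
  have jb1 := unit _ _ (lt_trans i2 i3); have lb1 := unit _ _ i3.
  have jb2 : j2 = -1 \/ j2 = 0 \/ j2 = 1.
    by apply: (unit _ j1); rewrite addrC; exact: lt_trans i2 i3.
  have lb2 : l2 = -1 \/ l2 = 0 \/ l2 = 1 by apply: (unit _ l1); rewrite addrC.
  move: i1 i2 i3 i4.
  by case: jb1 => [->|[->|->]]; case: jb2 => [->|[->|->]]; case: lb1 => [->|[->|->]];
    case: lb2 => [->|[->|->]].
have eE : ew j l m = expR (- (d * (x `^ s + y `^ s + z `^ s))) by [].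
rewrite -/S; clearbody x y z D S.
have G1 : 0 <= (x^-1 - y^-1) * (hw z - hw y).
  apply: mulr_ge0; rewrite subr_ge0; last exact: hw_mono.
  by rewrite lef_pV2 ?posrE ?(ltW jl).
have G2 : 0 <= (y^-1 - z^-1) * (hw y - hw x).
  apply: mulr_ge0; rewrite subr_ge0; last exact: hw_mono lt0x (ltW jl).
  by rewrite lef_pV2 ?posrE.
have e0 : 0 <= ew j l m by exact: expR_ge0.
have s2 : 2^-1 <= s by have /andP[a1 _] := a12; rewrite -[2^-1]mul1r ler_pdivrMr// mulrC (le_trans a1).
have /andP[a1 a2] := a12.
rewrite GE; apply: (abs_sub_bound S0 e0 G1 G2); last first.
  by rewrite eE; apply: kernel_second => //; rewrite lm.
have [y2|y2] := leP 2 y.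
  by rewrite eE; apply: kernel_main => //; rewrite lm.
have [x2 [yy [Dd SS]]] := small y2.
have xx : x = 1 by rewrite -[x]ger0_norm ?(ltW lt0x)// -sqrtr_sqr x2 sqrtr1.
have z5 : z ^+ 2 = 5 by rewrite zz x2 yy Dd; ring.
have := @kernel_small R y z S a s d yy z5 lt0y lt0z _ a1 as_ s1 d0 S0 _.
rewrite eE xx invr1 powR1 !mul1r; apply; last by rewrite SS.
by move: zxy; rewrite xx.
Qed.

Lemma trilinear_le (n : nat) (v : freq -> R[i]) (E : R) : 0 < E ->
  (forall k, v (- k) = conjc (v k)) ->
  \sum_(k <- box n) `[k] `^ (2 * a) * cn (v k) ^+ 2 <= E ^+ 2 ->
  `| \sum_(k <- box n) `[k] `^ (2 * a) * complex.Re (conjc (v k) *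
     \sum_(j <- box n) if k - j \in box n then
        (sqg_symbol j (k - j) * gevrey_weight j (k - j) k)%:C * (v j * v (k - j))
        else 0) |
  <= E * \sum_(k <- box n) `[k] `^ (2 * a + 2 * s) * cn (v k) ^+ 2.
Proof.
move=> E0 vN vE.
pose f j l m := `[m] `^ (2 * a) * (sqg_symbol j l * gevrey_weight j l m) *
  complex.Re (v j * v l * v m).
pose B := box n.
have in_box k : k \in B -> k != 0 by rewrite mem_box => /andP[].
have -> : \sum_(k <- B) `[k] `^ (2 * a) * complex.Re (conjc (v k) *
     \sum_(j <- B) if k - j \in B then
        (sqg_symbol j (k - j) * gevrey_weight j (k - j) k)%:C * (v j * v (k - j))
        else 0) = triple_sum B f.
  (* Since $\overline{v_k}=v_{-k}$, changing $k$ to $-k$ turns the energy pairing into a sum over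
     $j+l+m=0$. *)
  rewrite triple_sum_rot /triple_sum -[LHS]sum_box_opp; apply: eq_bigr => k _.
  rewrite fnormN vN.
  rewrite mulr_sumr Re_sum mulr_sumr; apply: eq_bigr => j _.
  transitivity (\sum_(l <- B) if l == - k - j then f j l k else 0).
    rewrite (sum_pick _ (fun l => f j l k)) ?uniq_box//; case: ifP => _; last by rewrite mulr0 mulr0.
    rewrite /f conjcK /gevrey_weight fnormN mulrCA.
    set c := sqg_symbol _ _ * _; rewrite -mulrA; congr (_ * _).
    by rewrite Re_realM; congr (_ * complex.Re _); ring.
  by apply: eq_bigr => l _; rewrite -opprD -addr_eq0 (addrC l).
pose Q j l m := `|(crossp j l)%:~R| * `|det_symbol j l m| * ew j l m * (cn (v j) * cn (v l) * cn (v m)).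
have sym j l m : j \in B -> l \in B -> m \in B -> j + l + m = 0 ->
    `|symmetrise f j l m| <= Q j l m.
  move=> _ _ _ jlm.
  have fE p q r : f p q r = (crossp p q)%:~R / `[p] * (hw `[r] * ew p q r) *
      complex.Re (v p * v q * v r).
    rewrite /f /sqg_symbol /gevrey_weight /hw /ew -(mulrA (_ `^ _) (expR _)) -expRD.
    rewrite mulrCA; congr (_ * (_ * expR _) * _).
    by move: (`[p] `^ s) (`[q] `^ s) (`[r] `^ s) => *; ring.
  have c1 : crossp l m = crossp j l := crossp_rot jlm.
  have c2 : crossp m j = crossp j l.
    by rewrite -c1; apply: crossp_rot; rewrite addrC addrA.
  have -> : symmetrise f j l m = (crossp j l)%:~R * det_symbol j l m * ew j l m *
      complex.Re (v j * v l * v m).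
    rewrite /symmetrise !fE (crosspC j l) (crosspC l m) (crosspC m j) c1 c2.
    have -> : v l * v j * v m = v j * v l * v m by ring.
    have -> : v l * v m * v j = v j * v l * v m by ring.
    have -> : v m * v l * v j = v j * v l * v m by ring.
    have -> : v m * v j * v l = v j * v l * v m by ring.
    have -> : v j * v m * v l = v j * v l * v m by ring.
    rewrite (ew_swap j l m) (ew_rot j l m) (ew_swap l m j) (ew_rot j l m).
    rewrite (ew_swap m j l) (ew_rot l m j) (ew_rot j l m).
    rewrite !mulrNz /det_symbol.
    move: (complex.Re (v j * v l * v m)) (ew j l m) (hw `[j]) (hw `[l]) (hw `[m])
      (`[j]^-1) (`[l]^-1) (`[m]^-1) ((crossp j l)%:~R : R) => X Y A1 A2 A3 b1 b2 b3 D.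
    by ring.
  rewrite /Q !normrM (ger0_norm (expR_ge0 _)) ler_wpM2l ?mulr_ge0 ?expR_ge0//.
  by apply: le_trans (Re_le_normc _) _; rewrite !ComplexField.Normc.normcM.
pose Qs j l m := if `[j] <= `[l] <= `[m] then Q j l m else 0.
have T1 : `|triple_sum B f| <= triple_sum B Qs.
  rewrite -(@ler_pM2l _ 6)// -[leLHS](_ : `|6 * triple_sum B f| = _); last first.
    by rewrite normrM ger0_norm.
  rewrite -triple_sum_symmetrise.
  apply: le_trans (ler_norm_triple_sum sym) _.

  apply: (@triple_sum_sorted R B (fun k => `[k]) Q) => j l m.
  - by rewrite /Q !mulr_ge0 ?expR_ge0 ?normc_ge0.
  - move=> _; rewrite /Q (crosspC j l) mulrNz normrN (det_symbol_swap j l m) normrN.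
    by rewrite (ew_swap j l m) (mulrC (cn (v l))).
  - move=> jlm; rewrite /Q (crossp_rot jlm) (det_symbol_rot j l m) (ew_rot j l m).
    by rewrite -(mulrA (cn (v j))) (mulrC (cn (v j))).
apply: (le_trans T1).
pose w k := `[k] `^ a * cn (v k).
pose W k := `[k] `^ s * w k.
have w2 k : w k ^+ 2 = `[k] `^ (2 * a) * cn (v k) ^+ 2.
  by rewrite /w exprMn sqr_powR.
have W2 k : W k ^+ 2 = `[k] `^ (2 * a + 2 * s) * cn (v k) ^+ 2.
  rewrite /W exprMn w2 mulrA sqr_powR addrC; congr (_ * _).
  rewrite powRD//; apply/implyP => /eqP; have /andP[a1 _] := a12; move: s_gt0; lra.
(* The two halves of $\frac12AC\le E^{-1}A^2+\frac E{16}C^2$, with $A=w_jW_m$ and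
   $C=W_l/\sqrt{|j||l|}$. The weights are chosen so that each half sums to $\frac E2$ times the
   dissipation. *)
pose P1 j m := if `[j + m] <= `[m] then E^-1 * (w j ^+ 2 * W m ^+ 2) else 0.
pose P2 j l := if `[j] < `[l] then E / 16 * (W l ^+ 2 / (`[j] * `[l])) else 0.
have T2 : triple_sum B Qs <= triple_sum B (fun j l m => P1 j m + P2 j l).
  apply: ler_triple_sum => j l m jB lB mB jlm.
  have p0 : 0 <= P1 j m + P2 j l.
    apply: addr_ge0; rewrite /P1 /P2; case: ifP => // _.
      by rewrite mulr_ge0 ?invr_ge0 ?(ltW E0)// mulr_ge0 ?sqr_ge0.
    rewrite mulr_ge0 ?divr_ge0 ?(ltW E0) ?sqr_ge0//.
    by rewrite mulr_ge0 ?fnorm_ge0.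
  rewrite /Qs; case: ifPn => // /andP[jl lm].
  move: (jl); rewrite le_eqVlt => /predU1P[jlE|jl'].
    have D0 : det_symbol j l m = 0.
      rewrite /det_symbol jlE; move: (hw `[l]) (hw `[m]) (`[l]^-1) (`[m]^-1) => A C p q.
      ring.
    by rewrite /Q D0 normr0 mulr0 !mul0r; exact: p0.
  have lE : `[j + m] = `[l].
    by rewrite -fnormN; congr fnorm; apply/esym/eqP; rewrite -addr_eq0 addrCA addrA jlm.
  rewrite /P1 /P2 lE lm jl'.
  have K := kernel_lattice (in_box _ jB) (in_box _ lB) (in_box _ mB) jlm jl' lm.
  rewrite /Q; apply: le_trans (ler_wpM2r _ K) _; first by rewrite !mulr_ge0 ?normc_ge0.
  have j0 := @fnorm_gt0 R _ (in_box _ jB).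
  have l0 := @fnorm_gt0 R _ (in_box _ lB).
  set rt := Num.sqrt _.
  have r0 : 0 < rt by rewrite sqrtr_gt0 mulr_gt0.
  have r2 : `[j] * `[l] = rt ^+ 2 by rewrite sqr_sqrtr// mulr_ge0 ?fnorm_ge0.
  rewrite !powRM ?mulr_ge0 ?fnorm_ge0//.
  have -> : 2^-1 / rt * (`[j] `^ a * `[l] `^ a * `[m] `^ a * (`[l] `^ s * `[m] `^ s)) *
     (cn (v j) * cn (v l) * cn (v m)) = 2^-1 * ((w j * W m) * (W l / rt)).
    rewrite /W /w; move: (`[j] `^ a) (`[l] `^ a) (`[m] `^ a) (`[l] `^ s) (`[m] `^ s).
    by move: (cn (v j)) (cn (v l)) (cn (v m)) rt^-1 => *; ring.
  rewrite r2; set A := w j * W m; set C := W l / rt.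
  rewrite -(exprMn _ (w j) (W m)) -/A.
  rewrite -(expr_div_n (W l)) -/C.
  rewrite -subr_ge0; clearbody A C.
  have -> : E^-1 * A ^+ 2 + E / 16 * C ^+ 2 - 2^-1 * (A * C) = E^-1 * (A - E / 4 * C) ^+ 2.
    by field; rewrite gt_eqF.
  by rewrite mulr_ge0 ?sqr_ge0// invr_ge0 ltW.
apply: (le_trans T2).
have P10 j m : 0 <= P1 j m.
  by rewrite /P1; case: ifP => // _; rewrite mulr_ge0 ?invr_ge0 ?(ltW E0)// mulr_ge0 ?sqr_ge0.
have P20 j l : 0 <= P2 j l.
  rewrite /P2; case: ifP => // _; rewrite mulr_ge0 ?divr_ge0 ?(ltW E0) ?sqr_ge0//.
  by rewrite mulr_ge0 ?fnorm_ge0.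
have T3 : triple_sum B (fun j l m => P1 j m) <= \sum_(m <- B) \sum_(j <- B) P1 j m.
  by rewrite exchange_big; apply: triple_sum_le_pair; rewrite ?uniq_box.
have T4 : triple_sum B (fun j l m => P2 j l) <= \sum_(l <- B) \sum_(j <- B) P2 j l.
  rewrite triple_sum_swap triple_sum_rot triple_sum_swap.
  by apply: (@triple_sum_le_pair _ _ _ (fun l j => P2 j l)); rewrite ?uniq_box.
set M := \sum_(k <- B) _.
have ME : M = \sum_(k <- B) W k ^+ 2 by apply: eq_bigr => k _; rewrite W2.
(* If $|j+m|\le|m|$ and $|-j+m|\le|m|$ both held, adding the squares would give $|j|^2\le0$. So
   pairing $j$ with $-j$ keeps at most half of the energy. *)
have half m : \sum_(j <- B) (if `[j + m] <= `[m] then w j ^+ 2 else 0) <= E ^+ 2 / 2.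
  rewrite ler_pdivlMr// mulr_natr mulr2n -{1}sum_box_opp -big_split/=.
  apply: le_trans vE; rewrite big_seq [leRHS]big_seq; apply: ler_sum => j jB.
  have wN : w (- j) = w j by rewrite /w fnormN vN normc_conj.
  rewrite -w2 wN.
  have := sqr_ge0 (w j).
  case: (leP `[- j + m] `[m]) => h1; case: (leP `[j + m] `[m]) => h2; rewrite ?addr0 ?add0r// => _.
  have j0 := @fnorm_gt0 R _ (in_box _ jB).
  have := @fnormD_sqr R j m; have := @fnormD_sqr R (- j) m.
  rewrite fnormN.
  have -> : dotp (- j) m = - dotp j m by rewrite /dotp /=; ring.
  have : `[- j + m] ^+ 2 <= `[m] ^+ 2 by rewrite ler_pXn2r ?nnegrE ?fnorm_ge0.
  have : `[j + m] ^+ 2 <= `[m] ^+ 2 by rewrite ler_pXn2r ?nnegrE ?fnorm_ge0.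
  have : 0 < `[j] ^+ 2 by rewrite exprn_gt0.
  rewrite rmorphN /=; move: (`[j] ^+ 2) (`[m] ^+ 2) (`[j + m] ^+ 2) (`[- j + m] ^+ 2).
  move: ((dotp j m)%:~R : R) (w j ^+ 2) => D X p q u u' h3 h4 h5 h6 h7.
  by exfalso; clear -h3 h4 h5 h6 h7; lra.
have S1 : \sum_(m <- B) \sum_(j <- B) P1 j m <= E / 2 * M.
  rewrite ME mulr_sumr; apply: ler_sum => m _.
  have -> : \sum_(j <- B) P1 j m =
     E^-1 * W m ^+ 2 * \sum_(j <- B) (if `[j + m] <= `[m] then w j ^+ 2 else 0).
    rewrite mulr_sumr; apply: eq_bigr => j _; rewrite /P1; case: ifP => _; rewrite ?mulr0//.
    by ring.
  have -> : E / 2 * W m ^+ 2 = E^-1 * W m ^+ 2 * (E ^+ 2 / 2) by field; rewrite gt_eqF.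
  by rewrite ler_wpM2l// mulr_ge0 ?sqr_ge0// invr_ge0 ltW.
have S2 : \sum_(l <- B) \sum_(j <- B) P2 j l <= E / 2 * M.
  rewrite ME mulr_sumr big_seq [leRHS]big_seq; apply: ler_sum => l lB.
  have l0 := @fnorm_gt0 R _ (in_box _ lB).
  have -> : \sum_(j <- B) P2 j l = E / 16 * W l ^+ 2 / `[l] *
     \sum_(j <- B) (if (j != 0) && (`[j] < `[l]) then `[j]^-1 else 0).
    rewrite mulr_sumr big_seq [RHS]big_seq; apply: eq_bigr => j jB; rewrite /P2 (in_box _ jB)/=.
    by case: ifP => _; rewrite ?mulr0// invfM; ring.
  apply: (@le_trans _ _ (E / 16 * W l ^+ 2 / `[l] * (8 * `[l]))).
    rewrite ler_wpM2l ?inv_norm_sum ?uniq_box ?fnorm_ge0//.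
    by rewrite divr_ge0 ?fnorm_ge0// mulr_ge0 ?sqr_ge0// divr_ge0// ltW.
  rewrite le_eqVlt; apply/orP; left; apply/eqP; field; exact: lt0r_neq0.
rewrite triple_sumD; lra.
Qed.

End trilinear.

(** * Galerkin approximations *)

Section primitive.
Context {R : realType}.
Implicit Types (f g : R -> R) (t : R).
Local Notation mu := (@lebesgue_measure R).

(** Used with $g=\max(\cdot,0)$, to extend Wiener paths from $[0,\infty)$ to continuous functions on
    the line. *)
Lemma within_comp (A : set R) (f : R -> R) (g : R -> R) :
  {within A, continuous f} -> continuous g -> (forall x, A (g x)) ->
  continuous (f \o g).
Proof.
move=> fA gc Ag t; have h := fA (g t).
have {}h : f x @[x --> within A (nbhs (g t))] --> f (g t).
  by move: h; rewrite /continuous_at nbhs_subspace_in.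
move=> B /h hB.
have H : \forall x \near t, A (g x) -> B (f (g x)) := gc t _ hB.
suff: \forall x \near t, B (f (g x)) by [].
by apply: filterS H => x; apply; exact: Ag.
Qed.

Definition prim f t : R := \int[mu]_(x in `[0, t]) f x.

Lemma integrable_continuous f t : continuous f -> mu.-integrable `[0, t] (EFin \o f).
Proof.
move=> fc; apply: continuous_compact_integrable; first exact: segment_compact.
exact: continuous_subspaceT.
Qed.

Lemma prim_lt0 f t : t < 0 -> prim f t = 0.
Proof. by move=> t0; rewrite /prim set_itv_ge ?Rintegral_set0// bnd_simp -ltNge. Qed.

Lemma prim0 f : prim f 0 = 0.
Proof. by rewrite /prim set_itv1 Rintegral_set1. Qed.

(** [prim f] vanishes on the negative half-line and can have a kink at 0, which is why differential
    equations are stated for positive times only. *)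
Lemma is_derive_prim f t : continuous f -> 0 < t -> is_derive t 1 (prim f) (f t).
Proof.
move=> fc t0; have t1 : t < t + 1 by rewrite ltrDl.
have [d e] := continuous_FTC1_closed t1 (@integrable_continuous f _ fc) t0 (fc t).
by rewrite derive1E in e; exact: (DeriveDef d e).
Qed.

Lemma continuous_prim f : continuous f -> continuous (prim f).
Proof.
move=> fc t; have [t0|t0|->] := ltgtP t 0.
- rewrite /continuous_at prim_lt0//; apply/cvgrPdist_lt => e e0; near=> x.
  by rewrite prim_lt0 ?subrr ?normr0//; near: x; exact: lt_nbhsl.
- apply: differentiable_continuous; apply/derivable1_diffP.
  by have [] := is_derive_prim fc t0.
- rewrite /continuous_at prim0.
  exact: (@parameterized_integral_cvg_left _ 0 1 f ltr01 (@integrable_continuous f _ fc)).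
Unshelve. all: by end_near. Qed.

Lemma continuous_is_derive (f df : R -> R) : 
  (forall t : R, is_derive t 1 f (df t)) -> continuous f.
Proof.
move=> h t; apply: differentiable_continuous; apply/derivable1_diffP.
by have [] := h t.
Qed.

Lemma primB f g t : continuous f -> continuous g ->
  prim f t - prim g t = prim (fun x => f x - g x) t.
Proof. by move=> fc gc; rewrite /prim RintegralB//; exact: integrable_continuous. Qed.

Lemma primZ f t (c : R) : continuous f ->
  prim (fun x => c * f x) t = c * prim f t.
Proof. by move=> fc; rewrite /prim RintegralZl//; exact: integrable_continuous. Qed.

Lemma le_prim f (h dh : R -> R) t : continuous f -> 0 <= t -> 
  (forall x : R, 0 < x -> is_derive x 1 h (dh x)) -> continuous h ->
  (forall x, 0 < x < t -> f x <= dh x) ->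
  prim f t <= h t - h 0.
Proof.
move=> fc t0 hd hc fh.
suff : prim f t - h t <= prim f 0 - h 0 by rewrite prim0; lra.
apply: (@le_of_derive _ (fun x => prim f x - h x) (fun x => f x - dh x)) => //.
- move=> x /andP[x0 _]; apply: is_deriveB; [exact: is_derive_prim|exact: hd].
- by move=> x xt; rewrite subr_le0; exact: fh.
- apply: continuous_subspaceT => x; apply: cvgB; [exact: continuous_prim|exact: hc].
Qed.

Lemma prim_exp_bound f t (C M : R) : continuous f -> 0 <= t -> 0 < M -> 0 <= C ->
  (forall x, 0 < x < t -> `|f x| <= C * expR (M * x)) ->
  `|prim f t| <= C / M * expR (M * t).
Proof.
move=> fc t0 M0 C0 fb.
pose h x : R := C / M * expR (M * x).
have hd (x : R) : is_derive x 1 h (C * expR (M * x)).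
  by rewrite /h; apply: trigger_derive; rewrite /GRing.scale /=; field; rewrite gt_eqF.
have hc : continuous h := continuous_is_derive hd.
have h0 : 0 <= h 0 by rewrite /h mulr_ge0 ?expR_ge0// divr_ge0// ltW.
have cN : continuous (fun x => - f x) by move=> x; apply: cvgN; exact: fc.
have p1 : prim f t <= h t - h 0.
  by apply: (le_prim fc t0 (fun x _ => hd x) hc) => x /fb; apply: le_trans; exact: ler_norm.
have p2 : prim (fun x => - f x) t <= h t - h 0.
  apply: (le_prim cN t0 (fun x _ => hd x) hc) => x /fb; apply: le_trans.
  by rewrite -normrN; exact: ler_norm.
have pN : prim (fun x => - f x) t = - prim f t.
  rewrite -mulN1r -primZ//; congr (prim _ t); apply/funext => x; exact/esym/mulN1r.
rewrite pN in p2; rewrite ler_norml -/(h t); lra.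
Qed.

(** The limit is the supremum of the lower bounds $u_n-2C/2^n$. *)
Lemma geometric_limit (u : nat -> R) (C : R) : 
  (forall n, `|u n.+1 - u n| <= C / 2 ^+ n) ->
  exists l, forall n, `|l - u n| <= 2 * C / 2 ^+ n.
Proof.
move=> hu.
have C0 : 0 <= C by have := hu 0%N; rewrite expr0 divr1; apply: le_trans.
have hm n m : `|u (n + m)%N - u n| <= 2 * C / 2 ^+ n - 2 * C / 2 ^+ (n + m).
  elim: m => [|m IH]; first by rewrite addn0 !subrr normr0.
  rewrite addnS.
  have := hu (n + m)%N; set a := u _; set b := u _; set c := u n in IH *.
  have -> : C / 2 ^+ (n + m) = 2 * C / 2 ^+ (n + m) - 2 * C / 2 ^+ (n + m).+1.
    by rewrite exprS; field; rewrite expf_neq0.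
  move=> h; have -> : a - c = (a - b) + (b - c) by ring.
  by apply: le_trans (ler_normD _ _) _; move: h IH; rewrite -/b; lra.
have hm' n m : (n <= m)%N -> `|u m - u n| <= 2 * C / 2 ^+ n.
  move=> nm; rewrite -(subnKC nm); apply: le_trans (hm _ _) _.
  by rewrite lerBlDr lerDl divr_ge0 ?exprn_ge0 ?mulr_ge0.
pose S := [set x : R | exists n, x = u n - 2 * C / 2 ^+ n].
have c0 n : 0 <= 2 * C / 2 ^+ n by rewrite divr_ge0 ?exprn_ge0 ?mulr_ge0.
have ub n : ubound S (u n + 2 * C / 2 ^+ n).
  move=> _ [m ->]; have [nm|/ltnW mn] := leqP n m.
    have := hm' _ _ nm; rewrite ler_norml => /andP[_]; have := c0 m; lra.
  have := hm' _ _ mn; rewrite ler_norml => /andP[+ _]; have := c0 n; lra.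
have S0 : S !=set0 by exists (u 0%N - 2 * C / 2 ^+ 0), 0%N.
exists (sup S) => n; rewrite ler_norml; apply/andP; split.
  have : u n - 2 * C / 2 ^+ n <= sup S.
    by apply: ub_le_sup; [exists (u 0%N + 2 * C / 2 ^+ 0); exact: ub|exists n].
  lra.
have : sup S <= u n + 2 * C / 2 ^+ n by exact: ge_sup.
lra.
Qed.

End primitive.

(** * Barrier argument and global Picard iteration *)

Section ode.
Context {R : realType}.

(** At the last time with $g\le A$, continuity keeps $g$ below $A'$ a little longer; there $g$ is
    nonincreasing, so that time was not the last. The gap between $A$ and $A'$ lets the sign
    condition be assumed only where it can be proved. *)
Lemma barrier (g dg : R -> R) (A A' : R) :
  (forall t : R, 0 < t -> is_derive t 1 g (dg t)) -> continuous g ->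
  g 0 <= A -> A < A' -> (forall t, 0 < t -> g t <= A' -> dg t <= 0) ->
  forall t, 0 <= t -> g t <= A.
Proof.
move=> gd gc g0 AA gA t1 t10; rewrite leNgt; apply/negP => g1.
pose S := [set t : R | 0 <= t <= t1 /\ g t <= A].
have S0 : S 0 by split => //; rewrite lexx t10.
have ubS : ubound S t1 by move=> t [/andP[]].
have hS : has_sup S by split; [exists 0|exists t1].
set t0 := sup S.
have t00 : 0 <= t0 by apply: ub_le_sup => //; exists t1.
have t01 : t0 <= t1 by apply: ge_sup => //; exists 0.
have gt0 : g t0 <= A.
  rewrite leNgt; apply/negP => h.
  have := gc t0; move=> /cvgrPdist_lt /(_ (g t0 - A)); rewrite subr_gt0 => /(_ h).
  case/nbhs_ballP => e /= e0 he.
  have [t [/andP[t_0 t_1] tA] te] := sup_adherent e0 hS.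
  have tt0 : t <= t0 by apply: ub_le_sup => //; [exists t1|split => //; rewrite t_0].
  have : ball t0 e t.
    rewrite /ball /= ger0_norm ?subr_ge0//; move: te; rewrite -/t0; lra.
  move=> /he /=; rewrite ltr_norml => /andP[_]; lra.
have t0lt : t0 < t1 by rewrite lt_neqAle t01 andbT; apply/negP => /eqP e; move: gt0; rewrite e leNgt g1.
have := gc t0; move=> /cvgrPdist_lt /(_ (A' - A)); rewrite subr_gt0 => /(_ AA).
case/nbhs_ballP => e /= e0 he.
pose t2 := Num.min (t0 + e / 2) t1.
have t02 : t0 < t2 by rewrite lt_min t0lt andbT ltrDl divr_gt0.
have t2e : t2 <= t0 + e / 2 by rewrite ge_min lexx.
have t21 : t2 <= t1 by rewrite ge_min lexx orbT.
have g2 : g t2 <= g t0.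
  apply: (@le_of_derive _ g dg) => //.
  - exact: ltW.
  - by move=> x /andP[x0 _]; apply: gd; exact: le_lt_trans x0.
  - move=> x /andP[x0 x2]; apply: gA; first exact: le_lt_trans x0.
    have : ball t0 e x.
      rewrite /ball /= distrC ger0_norm ?subr_ge0 ?(ltW x0)//.
      by move: e0 x2 t2e; clear; lra.
    move=> /he /=; rewrite ltr_norml => /andP[+ _]; move: gt0; clear; lra.
  - exact: continuous_subspaceT.
have : t2 <= t0.
  apply: ub_le_sup; first by exists t1.
  split; last exact: le_trans gt0.
  by rewrite t21 andbT; apply: le_trans (ltW t02).
by rewrite leNgt t02.
Qed.

Section picard.
Variables (I : Type) (F : R -> (I -> R) -> I -> R) (M K : R) (x0 : I -> R).
Hypotheses (K0 : 0 < K) (Fb : forall t x k, `|F t x k| <= M)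
  (Fl : forall t x y D, (forall j, `|x j - y j| <= D) ->
     forall k, `|F t x k - F t y k| <= K * D)
  (Fc : forall X : R -> I -> R, (forall j, continuous (X ^~ j)) ->
     forall k, continuous (fun t => F t (X t) k)).

Fixpoint picard_iter n : R -> I -> R :=
  if n is n'.+1 then fun t k => x0 k + prim (fun r => F r (picard_iter n' r) k) t
  else fun _ k => x0 k.

Lemma continuous_picard_iter n k : continuous (fun t => picard_iter n t k).
Proof.
elim: n k => [|n IH] k /=; first by move=> t; exact: cvg_cst.
move=> t; apply: cvgD; first exact: cvg_cst.
by apply: continuous_prim; exact: Fc.
Qed.

Let Fpc n k : continuous (fun t => F t (picard_iter n t) k).
Proof. by apply: Fc => j; exact: continuous_picard_iter. Qed.

(* The weight [expR (2 * K * t)] makes the integral operator a contraction of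
   ratio [1 / 2], uniformly in time. *)
Lemma picard_iter_dist n t k : 0 <= t ->
  `|picard_iter n.+1 t k - picard_iter n t k| <=
  (`|M| / (2 * K) * expR (2 * K * t)) / 2 ^+ n.
Proof.
have K2 : 0 < 2 * K by rewrite mulr_gt0.
elim: n t k => [|n IH] t k t0.
  rewrite /= addrC addKr expr0 divr1.
  apply: prim_exp_bound => //; first by apply: (Fc (fun j => _)) => j z; exact: cvg_cst.
  move=> x /andP[x0' _]; apply: le_trans (Fb _ _ _) _; apply: le_trans (ler_norm _) _.
  apply: ler_peMr; first exact: normr_ge0.
  by rewrite -[leLHS]expR0 ler_expR mulr_ge0 ?(ltW K2) ?(ltW x0').
have -> : picard_iter n.+2 t k - picard_iter n.+1 t k =
    prim (fun r => F r (picard_iter n.+1 r) k - F r (picard_iter n r) k) t.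
  rewrite -primB; [|exact: Fpc|exact: Fpc].
  by rewrite [picard_iter n.+2]/= [picard_iter n.+1]/= opprD addrACA subrr add0r.
have -> : `|M| / (2 * K) * expR (2 * K * t) / 2 ^+ n.+1 =
    (K * (`|M| / (2 * K) / 2 ^+ n)) / (2 * K) * expR (2 * K * t).
  rewrite exprS; move: (expR _) (2 ^+ n) (expf_neq0 n (lt0r_neq0 (ltr0Sn R 1))) => X Y Y0.
  by field; rewrite Y0 (gt_eqF K0).
apply: prim_exp_bound => //.
- by move=> x; apply: cvgB; exact: Fpc.
- by rewrite mulr_ge0 ?(ltW K0)// !divr_ge0 ?exprn_ge0 ?(ltW K2).
move=> x /andP[x_0 _]; apply: le_trans (Fl _ (fun j => IH x j (ltW x_0)) _) _.
rewrite le_eqVlt; apply/orP; left; apply/eqP.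
by rewrite -!mulrA; congr (_ * (_ * (_ * _))); rewrite mulrC.
Qed.

Lemma picard_iter_le0 n t k : t <= 0 -> picard_iter n t k = x0 k.
Proof.
case: n => [//|n]; rewrite le_eqVlt => /predU1P[->|t0] /=; rewrite ?prim0 ?addr0//.
by rewrite prim_lt0// addr0.
Qed.

Lemma picard_lindelof (sg : I -> I) (ep : I -> R) :
  (forall k, x0 (sg k) = ep k * x0 k) ->
  (forall t x, (forall k, x (sg k) = ep k * x k) ->
     forall k, F t x (sg k) = ep k * F t x k) ->
  exists X : R -> I -> R, [/\ forall k, continuous (X ^~ k),
    forall t k, t <= 0 -> X t k = x0 k,
    forall t k, 0 < t -> is_derive (t : R) 1 (X ^~ k) (F t (X t) k) &
    forall t k, X t (sg k) = ep k * X t k].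
Proof.
move=> sx0 sF.
pose C t := `|M| / (2 * K) * expR (2 * K * Num.max t 0).
have hC n t k : `|picard_iter n.+1 t k - picard_iter n t k| <= C t / 2 ^+ n.
  have [t0|/ltW t0] := leP 0 t.
    by rewrite /C (max_idPl t0); exact: picard_iter_dist.
  rewrite !picard_iter_le0// subrr normr0 divr_ge0 ?exprn_ge0// mulr_ge0 ?expR_ge0//.
  by rewrite divr_ge0// mulr_ge0// ltW.
have C_ge0 t : 0 <= C t by rewrite mulr_ge0 ?expR_ge0// divr_ge0// mulr_ge0// ltW.
pose X t k := projT1 (cid (geometric_limit (fun n => hC n t k))).
have hX n t k : `|X t k - picard_iter n t k| <= 2 * C t / 2 ^+ n.
  by rewrite /X; case: cid => l /=.
have small (D e : R) : 0 < e -> exists n, D / 2 ^+ n <= e.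
  move=> e0.
  have /cvgrPdist_le /(_ _ e0) [n _ /(_ n (leqnn n))] :
      (fun n => D / 2 ^+ n) @ \oo --> (0 : R).
    have -> : (fun n => D / 2 ^+ n) = geometric D 2^-1.
      by apply/funext => n; rewrite /geometric /= exprVn.
    by apply: cvg_geometric; rewrite ger0_norm// invf_lt1// ltr1n.
  by rewrite /= sub0r normrN => h; exists n; exact: le_trans (ler_norm _) h.
have eqlim (a b D : R) : (forall n, `|a - b| <= D / 2 ^+ n) -> a = b.
  move=> h; apply/eqP; rewrite -subr_eq0 -normr_le0; apply/ler_addgt0Pl => e e0.
  by have [n hn] := small D e e0; rewrite addr0; exact: le_trans (h n) hn.
have Xc k : continuous (X ^~ k).
  move=> t; apply/cvgrPdist_le => /= e e0.
  have Cmono r : r <= t + 1 -> C r <= C (`|t| + 1).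
    move=> rt; rewrite ler_wpM2l ?divr_ge0 ?mulr_ge0 ?(ltW K0)// ler_expR ler_wpM2l ?mulr_ge0 ?(ltW K0)//.
    have tt : 0 <= `|t| + 1 by rewrite addr_ge0.
    rewrite (max_idPl tt) ge_max tt andbT (le_trans rt)// lerD2r; exact: ler_norm.
  have [n hn] := small (2 * C (`|t| + 1)) (e / 3) (divr_gt0 e0 (ltr0n _ 3)).
  have /cvgrPdist_le := @continuous_picard_iter n k t; move=>  /(_ _ (divr_gt0 e0 (ltr0n _ 3))) hc.
  have ht : \forall r \near t, r < t + 1 by apply: lt_nbhsl; rewrite ltrDl.
  near=> r.
  have rt : r <= t + 1 by apply: ltW; near: r; exact: ht.
  have h1 : `|X t k - picard_iter n t k| <= e / 3.
    apply: le_trans (hX n t k) (le_trans _ hn).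
    by rewrite ler_pM2r ?invr_gt0 ?exprn_gt0// ler_pM2l// Cmono// lerDl.
  have h2 : `|X r k - picard_iter n r k| <= e / 3.
    apply: le_trans (hX n r k) (le_trans _ hn).
    by rewrite ler_pM2r ?invr_gt0 ?exprn_gt0// ler_pM2l// Cmono.
  have h3 : `|picard_iter n t k - picard_iter n r k| <= e / 3 by near: r; exact: hc.
  move: h1 h2 h3; rewrite !ler_norml => /andP[? ?] /andP[? ?] /andP[? ?].
  by apply/andP; split; lra.
have Fxc k : continuous (fun t => F t (X t) k) by exact: Fc.
have XE t k : X t k = x0 k + prim (fun r => F r (X r) k) t.
  have [t0|/ltW t0] := leP t 0.
    have -> : prim (fun r => F r (X r) k) t = 0.
      by move: t0; rewrite le_eqVlt => /predU1P[->|t0]; rewrite ?prim0 ?prim_lt0.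
    apply: (eqlim _ _ (2 * C t)) => n.
    by rewrite addr0 -(picard_iter_le0 n k t0); exact: hX.
  apply: (eqlim _ _ (C t + (K * (2 * (`|M| / (2 * K)))) / (2 * K) * expR (2 * K * t))) => n.
  have := hX n.+1 t k.
  have : `|prim (fun r => F r (picard_iter n r) k) t - prim (fun r => F r (X r) k) t| <=
     (K * (2 * (`|M| / (2 * K))) / 2 ^+ n) / (2 * K) * expR (2 * K * t).
    rewrite primB; [|exact: Fpc|exact: Fxc].
    apply: prim_exp_bound => //.
    - by move=> x; apply: cvgB; [exact: Fpc|exact: Fxc].
    - by rewrite mulr_gt0.
    - by rewrite divr_ge0 ?exprn_ge0// mulr_ge0 ?(ltW K0)// mulr_ge0// divr_ge0// mulr_ge0 ?(ltW K0).
    move=> x /andP[x_0 _].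
    have H j : `|picard_iter n x j - X x j| <= 2 * C x / 2 ^+ n by rewrite distrC; exact: hX.
    apply: le_trans (Fl _ H _) _.
    rewrite /C (max_idPl (ltW x_0)) le_eqVlt; apply/orP; left; apply/eqP.
    move: (expR _) (2 ^+ n)^-1 (`|M| / (2 * K)) => X1 X2 X3; ring.
  rewrite {2}/picard_iter -/picard_iter.
  have -> : 2 * C t / 2 ^+ n.+1 = C t / 2 ^+ n.
    rewrite exprS; move: (2 ^+ n) (expf_neq0 n (lt0r_neq0 (ltr0Sn R 1))) => Y Y0; field; exact: Y0.
  move=> h1 h2.
  have -> : X t k - (x0 k + prim (fun r => F r (X r) k) t) =
    (X t k - (x0 k + prim (fun r => F r (picard_iter n r) k) t)) +
    (prim (fun r => F r (picard_iter n r) k) t - prim (fun r => F r (X r) k) t) by ring.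
  apply: le_trans (ler_normD _ _) _; rewrite mulrDl lerD//.
  apply: le_trans h1 _; rewrite le_eqVlt; apply/orP; left; apply/eqP.
  by move: (expR _) (2 ^+ n)^-1 (`|M| / (2 * K)) (2 * K)^-1 => X1 X2 X3 X4; ring.
have sym n t k : picard_iter n t (sg k) = ep k * picard_iter n t k.
  elim: n t k => [|n IH] t k /=; first exact: sx0.
  rewrite mulrDr sx0 -primZ; last exact: Fpc.
  by congr (_ + prim _ t); apply/funext => r; apply: sF => j; exact: IH.
exists X; split => //.
- move=> t k t0; rewrite XE; move: t0; rewrite le_eqVlt => /predU1P[->|t0].
    by rewrite prim0 addr0.
  by rewrite prim_lt0// addr0.
- move=> t k t0; have -> : X ^~ k = cst (x0 k) + prim (fun r => F r (X r) k).
    by apply/funext => r; rewrite XE.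
  rewrite -[F t _ _]add0r; apply: is_deriveD; exact: is_derive_prim.
- move=> t k; apply: (eqlim _ _ (2 * C t + `|ep k| * (2 * C t))) => n.
  have -> : X t (sg k) - ep k * X t k =
    (X t (sg k) - picard_iter n t (sg k)) - ep k * (X t k - picard_iter n t k).
    by rewrite sym; ring.
  apply: le_trans (ler_normB _ _) _; rewrite normrM mulrDl lerD//.
  by rewrite -mulrA ler_wpM2l.
Unshelve. all: by end_near. Qed.

End picard.
End ode.

Section bounded_lipschitz.
Context {R : realType} {I : eqType}.
Implicit Types (f g : R -> (I -> R) -> R).

(* Time-dependent functions of the state that are bounded, Lipschitz in the
   state for the uniform distance, and continuous along continuous states. *)
Definition bounded_lipschitz f := exists M K, [/\ 0 <= M, 0 <= K,
  forall t x, `|f t x| <= M,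
  forall t x y D, (forall j, `|x j - y j| <= D) -> `|f t x - f t y| <= K * D &
  forall X : R -> I -> R, (forall j, continuous (X ^~ j)) ->
    continuous (fun t => f t (X t))].

Lemma bounded_lipschitz_time (g : R -> R) (M : R) : continuous g ->
  (forall t, `|g t| <= M) -> bounded_lipschitz (fun t _ => g t).
Proof.
move=> gc gM; exists M, 0; split => //; first exact: le_trans (gM 0).
by move=> *; rewrite subrr normr0 mul0r.
Qed.

Lemma bounded_lipschitz_cst (c : R) : bounded_lipschitz (fun _ _ => c).
Proof. by apply: (@bounded_lipschitz_time (fun=> c) `|c|) => // t; exact: cvg_cst. Qed.

Lemma bounded_lipschitzD f g : bounded_lipschitz f -> bounded_lipschitz g ->
  bounded_lipschitz (fun t x => f t x + g t x).
Proof.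
move=> [M [K [M0 K0 fM fK fc]]] [M' [K' [M0' K0' gM gK gc]]].
exists (M + M'), (K + K'); split; rewrite ?addr_ge0//.
- by move=> t x; apply: le_trans (ler_normD _ _) _; rewrite lerD.
- move=> t x y D xy.
  have -> : f t x + g t x - (f t y + g t y) = (f t x - f t y) + (g t x - g t y) by ring.
  by apply: le_trans (ler_normD _ _) _; rewrite mulrDl lerD ?fK ?gK.
- by move=> X Xc t; apply: cvgD; [exact: fc|exact: gc].
Qed.

Lemma bounded_lipschitzM f g : bounded_lipschitz f -> bounded_lipschitz g ->
  bounded_lipschitz (fun t x => f t x * g t x).
Proof.
move=> [M [K [M0 K0 fM fK fc]]] [M' [K' [M0' K0' gM gK gc]]].
exists (M * M'), (M * K' + M' * K); split; rewrite ?addr_ge0 ?mulr_ge0//.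
- by move=> t x; rewrite normrM ler_pM.
- move=> t x y D xy.
  have -> : f t x * g t x - f t y * g t y =
    f t x * (g t x - g t y) + g t y * (f t x - f t y) by ring.
  apply: le_trans (ler_normD _ _) _; rewrite mulrDl !normrM -!mulrA.
  by rewrite lerD// ler_pM ?fK ?gK.
- by move=> X Xc t; apply: cvgM; [exact: fc|exact: gc].
Qed.

Lemma bounded_lipschitzN f : bounded_lipschitz f ->
  bounded_lipschitz (fun t x => - f t x).
Proof.
move=> /(bounded_lipschitzM (bounded_lipschitz_cst (-1))).
by congr bounded_lipschitz; apply/funext => t; apply/funext => x; rewrite mulN1r.
Qed.

Lemma bounded_lipschitz_sum (J : Type) (s : seq J) (f : J -> R -> (I -> R) -> R) :
  (forall j, bounded_lipschitz (f j)) ->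
  bounded_lipschitz (fun t x => \sum_(j <- s) f j t x).
Proof.
move=> fl; elim: s => [|j s IH].
  by under [X in bounded_lipschitz X]eq_fun do under eq_fun do rewrite big_nil;
    exact: bounded_lipschitz_cst.
under [X in bounded_lipschitz X]eq_fun do under eq_fun do rewrite big_cons.
exact: bounded_lipschitzD.
Qed.

(** Evaluating a quadratic field at clamped coordinates makes it bounded and globally Lipschitz, so
    that Picard iteration gives a solution for all times. *)
Definition clamp (c x : R) := Num.max (- c) (Num.min c x).

Lemma clamp_id c x : `|x| <= c -> clamp c x = x.
Proof.
rewrite ler_norml => /andP[x1 x2]; rewrite /clamp.
by rewrite (min_idPr x2) (max_idPr x1).
Qed.

Lemma normr_clamp c x : 0 <= c -> `|clamp c x| <= c.
Proof.
move=> c0; rewrite /clamp ler_norml le_max lexx/= ge_max ge_min lexx andbT.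
by rewrite ge0_cp.
Qed.

Lemma clampP c x : 0 <= c -> [\/ (x <= - c) /\ clamp c x = - c,
  (c <= x) /\ clamp c x = c | (- c <= x <= c) /\ clamp c x = x].
Proof.
move=> c0; have c0' : - c <= c by rewrite ge0_cp.
rewrite /clamp; have [cx|/ltW xc] := leP c x; first by apply: Or32; rewrite (max_idPr c0').
have [cx|/ltW xc'] := leP (- c) x; first by apply: Or33.
by apply: Or31.
Qed.

Lemma clampN c x : 0 <= c -> clamp c (- x) = - clamp c x.
Proof.
move=> c0; case: (clampP x c0) => -[h1 ->]; case: (clampP (- x) c0) => -[h2 ->]; lra.
Qed.

Lemma clamp_lipschitz c x y : 0 <= c -> `|clamp c x - clamp c y| <= `|x - y|.
Proof.
move=> c0; case: (clampP x c0) => -[h1 ->]; case: (clampP y c0) => -[h2 ->];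
  rewrite ler_norml; case: (leP 0 (x - y)) => h5;
  rewrite ?(ger0_norm h5) ?(ltr0_norm h5); apply/andP; split; lra.
Qed.

Lemma bounded_lipschitz_clamp c (j : I) : 0 <= c ->
  bounded_lipschitz (fun _ x => clamp c (x j)).
Proof.
move=> c0; exists c, 1; split => //.
- by move=> _ x; exact: normr_clamp.
- by move=> _ x y D xy; rewrite mul1r; apply: le_trans (clamp_lipschitz _ _ c0) _.
- move=> X Xc t; apply/cvgrPdist_le => e e0.
  have /cvgrPdist_le/(_ e e0) := Xc j t.
  by apply: filterS => r; apply: le_trans; exact: clamp_lipschitz.
Qed.

Lemma bounded_lipschitz_family (s : seq I) (F : R -> (I -> R) -> I -> R) :
  (forall k, k \in s -> bounded_lipschitz (fun t x => F t x k)) ->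
  (forall t x k, k \notin s -> F t x k = 0) ->
  exists M K, [/\ 0 < K, forall t x k, `|F t x k| <= M &
   forall t x y D, (forall j, `|x j - y j| <= D) ->
     forall k, `|F t x k - F t y k| <= K * D].
Proof.
move=> Fs F0.
have [M [K [M0 K0 H]]] : exists M K, [/\ 0 <= M, 0 < K & forall k, k \in s ->
   (forall t x, `|F t x k| <= M) /\
   (forall t x y D, (forall j, `|x j - y j| <= D) -> `|F t x k - F t y k| <= K * D)].
  elim: s Fs {F0} => [_|i s IH Fs]; first by exists 0, 1.
  have [k ks|M [K [M0 K0 H]]] := IH; first by apply: Fs; rewrite inE ks orbT.
  have [|M' [K' [M0' K0' fM fK _]]] := Fs i; first exact: mem_head.
  exists (M + M'), (K + K'); split; [exact: addr_ge0|exact: ltr_wpDr|].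
  move=> k; rewrite inE => /predU1P[->|/H[kM kK]]; split.
  - by move=> t x; apply: le_trans (fM t x) _; rewrite lerDr.
  - move=> t x y D xy; apply: le_trans (fK t x y D xy) _.
    by rewrite ler_wpM2r ?lerDr ?(ltW K0)//; exact: le_trans (xy i).
  - by move=> t x; apply: le_trans (kM t x) _; rewrite lerDl.
  - move=> t x y D xy; apply: le_trans (kK t x y D xy) _.
    by rewrite ler_wpM2r ?lerDl//; exact: le_trans (xy i).
exists M, K; split => //.
- move=> t x k; have [/H[]//|/F0 ->] := boolP (k \in s).
  by rewrite normr0.
- move=> t x y D xy k; have [/H[_ kK]|/F0 Fk] := boolP (k \in s); first exact: kK.
  rewrite !Fk subrr normr0 mulr_ge0 ?(ltW K0)//; exact: le_trans (xy k).
Qed.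

Definition cbounded_lipschitz (z : R -> (I -> R) -> R[i]) :=
  bounded_lipschitz (fun t x => complex.Re (z t x)) /\
  bounded_lipschitz (fun t x => complex.Im (z t x)).

Lemma cbounded_lipschitzM z z' : cbounded_lipschitz z -> cbounded_lipschitz z' ->
  cbounded_lipschitz (fun t x => z t x * z' t x).
Proof.
move=> [zr zi] [zr' zi']; split.
  under [X in bounded_lipschitz X]eq_fun do under eq_fun do rewrite Re_mulc.
  by apply: bounded_lipschitzD; [|apply: bounded_lipschitzN]; exact: bounded_lipschitzM.
under [X in bounded_lipschitz X]eq_fun do under eq_fun do rewrite Im_mulc.
by apply: bounded_lipschitzD; exact: bounded_lipschitzM.
Qed.

Lemma cbounded_lipschitzZ (c : R -> R) M z : continuous c -> (forall t, `|c t| <= M) ->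
  cbounded_lipschitz z -> cbounded_lipschitz (fun t x => (c t)%:C * z t x).
Proof.
move=> cc cM; apply: cbounded_lipschitzM; split => /=; last exact: bounded_lipschitz_cst.
exact: bounded_lipschitz_time cM.
Qed.

Lemma cbounded_lipschitz0 : cbounded_lipschitz (fun _ _ => 0).
Proof. by split; exact: bounded_lipschitz_cst. Qed.

Lemma cbounded_lipschitzB z z' : cbounded_lipschitz z -> cbounded_lipschitz z' ->
  cbounded_lipschitz (fun t x => z t x - z' t x).
Proof.
move=> [zr zi] [zr' zi']; split.
  under [X in bounded_lipschitz X]eq_fun do under eq_fun do rewrite raddfB/=.
  by apply: bounded_lipschitzD; [|apply: bounded_lipschitzN].
under [X in bounded_lipschitz X]eq_fun do under eq_fun do rewrite raddfB/=.
by apply: bounded_lipschitzD; [|apply: bounded_lipschitzN].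
Qed.

Lemma cbounded_lipschitz_sum (J : Type) (s : seq J) z :
  (forall j, cbounded_lipschitz (z j)) ->
  cbounded_lipschitz (fun t x => \sum_(j <- s) z j t x).
Proof.
move=> fl; split.
  under [X in bounded_lipschitz X]eq_fun do under eq_fun do rewrite Re_sum.
  by apply: bounded_lipschitz_sum => j; have [] := fl j.
under [X in bounded_lipschitz X]eq_fun do under eq_fun do rewrite Im_sum.
by apply: bounded_lipschitz_sum => j; have [] := fl j.
Qed.

End bounded_lipschitz.

(** * The truncated system and its energy bound *)

Section galerkin.
Context {R : realType}.
Variables (a s : R).
Hypotheses (a12 : 1 <= a <= 2) (as_ : a <= 2 * s) (s1 : s <= 1).
Local Notation "`[ k ]" := (@fnorm R k).

Lemma is_derive_big (J : eqType) (r : seq J) (f : J -> R -> R) (df : J -> R) (t : R) :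
  (forall j, j \in r -> is_derive t 1 (f j) (df j)) ->
  is_derive t 1 (fun x => \sum_(j <- r) f j x) (\sum_(j <- r) df j).
Proof.
elim: r => [|j r IH] h.
  rewrite big_nil (_ : (fun _ => _) = cst 0); first exact: is_derive_cst.
  by apply/funext => x; rewrite big_nil.
rewrite big_cons (_ : (fun _ => _) = f j + (fun x => \sum_(j <- r) f j x)); last first.
  by apply/funext => x; rewrite big_cons.
apply: is_deriveD; first by apply: h; exact: mem_head.
by apply: IH => i ir; apply: h; rewrite inE ir orbT.
Qed.

Lemma is_derive_normc_sqr (w : R) (z : R -> R[i]) (dz : R[i]) (t : R) :
  is_derive t 1 (fun r => complex.Re (z r)) (complex.Re dz) ->
  is_derive t 1 (fun r => complex.Im (z r)) (complex.Im dz) ->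
  is_derive t 1 (fun r => w * cn (z r) ^+ 2) (w * (2 * complex.Re (conjc (z t) * dz))).
Proof.
move=> dr di.
have h := is_deriveZ w (is_deriveD (is_deriveM dr dr) (is_deriveM di di)).
rewrite (_ : (fun r => _) = w \*: ((fun r => complex.Re (z r)) * (fun r => complex.Re (z r)) +
   (fun r => complex.Im (z r)) * (fun r => complex.Im (z r)))); last first.
  by apply/funext => r; rewrite normc_sqr !expr2.
apply: (is_derive_eq h); rewrite /GRing.scale /= Re_mulc.
by case: (z t) => p q /=; ring.
Qed.

Lemma Re_subc (z w : R[i]) : complex.Re (z - w) = complex.Re z - complex.Re w.
Proof. by case: z w => [p q] [p' q']. Qed.

Lemma Re_conj_realM (x : R) (z : R[i]) :
  complex.Re (conjc z * (- x%:C * z)) = - (x * cn z ^+ 2).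
Proof. by rewrite normc_sqr; case: z => p q /=; ring. Qed.

Lemma complex_ReIm (z : R[i]) : complex.Re z +i* complex.Im z = z.
Proof. by case: z. Qed.

Lemma continuous_sum_seq (J : Type) (r : seq J) (f : J -> R -> R) :
  (forall j, continuous (f j)) -> continuous (fun x => \sum_(j <- r) f j x).
Proof.
move=> fc; elim: r => [|j r IH].
  by under eq_fun do rewrite big_nil; move=> x; exact: cvg_cst.
by under eq_fun do rewrite big_cons; move=> x; apply: cvgD; [exact: fc|exact: IH].
Qed.

Lemma powR_fnorm_subadditive j k : 0 < s -> `[k] `^ s <= `[j] `^ s + `[k - j] `^ s.
Proof.
move=> s0; apply: le_trans (_ : (`[j] + `[k - j]) `^ s <= _); last first.
  by apply: powR_subadditive; rewrite ?fnorm_ge0 ?s0.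
rewrite ge0_ler_powR ?nnegrE ?addr_ge0 ?fnorm_ge0 ?(ltW s0)//.
by rewrite -[in leLHS](subrKC j k) ler_fnormD.
Qed.

Lemma gevrey_weight_le1 d j k : 0 < s -> 0 <= d ->
  gevrey_weight s d j (k - j) k <= 1.
Proof.
move=> s0 d0; rewrite /gevrey_weight -[leRHS]expR0 ler_expR oppr_le0 mulr_ge0// subr_ge0.
exact: powR_fnorm_subadditive.
Qed.

Lemma conjcM (z w : R[i]) : conjc (z * w) = conjc z * conjc w.
Proof. exact: rmorphM. Qed.

Lemma conjcRM (x : R) (w : R[i]) : conjc (x%:C * w) = x%:C * conjc w.
Proof. by rewrite conjcM conjc_real. Qed.

Definition galerkin_nl n d (v : freq -> R[i]) k : R[i] :=
  \sum_(j <- box n) if k - j \in box n then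
    (sqg_symbol j (k - j) * gevrey_weight s d j (k - j) k)%:C * (v j * v (k - j))
    else 0.

Lemma crosspNN j l : crossp (- j) (- l) = crossp j l.
Proof. by rewrite /crossp /=; ring. Qed.

Lemma galerkin_nlN n d v k : (forall k, v (- k) = conjc (v k)) ->
  galerkin_nl n d v (- k) = conjc (galerkin_nl n d v k).
Proof.
move=> vN; rewrite /galerkin_nl (raddf_sum (@conjc R)) -[LHS]sum_box_opp.
apply: eq_bigr => j _.
suff H l : (if - l \in box n then
    (sqg_symbol (- j) (- l) * gevrey_weight s d (- j) (- l) (- k))%:C *
    (v (- j) * v (- l)) else 0) = conjc (if l \in box n then
    (sqg_symbol j l * gevrey_weight s d j l k)%:C * (v j * v l) else 0).
  by rewrite -opprD; exact: H.
rewrite box_opp; case: (l \in box n); last by rewrite conjc0.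
by rewrite !vN /sqg_symbol /gevrey_weight !fnormN crosspNN -!conjcM -conjcRM.
Qed.

(** The clamped system is solved globally, with real and imaginary parts as coordinates. While the
    energy is at most $c^2$ the clamp is inactive and the energy decreases, so [barrier] between
    $E^2$ and $c^2$ keeps it below $E^2$ and the clamp never acts. *)
Lemma galerkin (n : nat) (dl : R -> R) (dd : freq -> R) (E c : R) (v0 : freq -> R[i]) :
  0 < E < c -> continuous dl -> (forall t, 0 <= dl t) ->
  (forall k, dd (- k) = dd k) -> (forall k, c * `[k] `^ (2 * s) <= dd k) ->
  (forall k, v0 (- k) = conjc (v0 k)) ->
  \sum_(k <- box n) `[k] `^ (2 * a) * cn (v0 k) ^+ 2 <= E ^+ 2 ->
  exists v : R -> freq -> R[i], [/\
    forall k, continuous (fun t => complex.Re (v t k)) /\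
              continuous (fun t => complex.Im (v t k)),
    forall t k, v t (- k) = conjc (v t k) /\ (k \notin box n -> v t k = 0),
    forall t k, t <= 0 -> k \in box n -> v t k = v0 k,
    forall t, 0 <= t -> \sum_(k <- box n) `[k] `^ (2 * a) * cn (v t k) ^+ 2 <= E ^+ 2 &
    forall (t : R) k, 0 < t -> k \in box n ->
      is_derive t 1 (fun t => complex.Re (v t k))
        (complex.Re (- (dd k)%:C * v t k - galerkin_nl n (dl t) (v t) k)) /\
      is_derive t 1 (fun t => complex.Im (v t k))
        (complex.Im (- (dd k)%:C * v t k - galerkin_nl n (dl t) (v t) k))].
Proof.
move=> /andP[E0 Ec] dlc dl0 ddN ddc v0N v0E.
have s0 : 0 < s by exact: s_gt0 a12 as_.
have c0 : 0 < c by exact: lt_trans Ec.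
pose I := (freq * bool)%type.
pose V (x : I -> R) k : R[i] := if k \in box n then
  clamp c (x (k, false)) +i* clamp c (x (k, true)) else 0.
pose rhs t v k : R[i] := - (dd k)%:C * v k - galerkin_nl n (dl t) v k.
pose F t x (i : I) : R := if i.1 \in box n then
  (if i.2 then complex.Im (rhs t (V x) i.1) else complex.Re (rhs t (V x) i.1)) else 0.
have FE t x k b : F t x (k, b) = if k \in box n then
  (if b then complex.Im (rhs t (V x) k) else complex.Re (rhs t (V x) k)) else 0 by [].
have Vl k : cbounded_lipschitz (fun _ x => V x k).
  rewrite /V; case: (k \in box n); last exact: cbounded_lipschitz0.
  by split => /=; apply: bounded_lipschitz_clamp; exact: ltW.
have rl k : cbounded_lipschitz (fun t x => rhs t (V x) k).
  apply: cbounded_lipschitzB.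
    under [X in cbounded_lipschitz X]eq_fun do under eq_fun do rewrite -rmorphN.
    by apply: (cbounded_lipschitzZ (c := fun=> - dd k) (M := `|- dd k|)) => // t; exact: cvg_cst.
  apply: cbounded_lipschitz_sum => j.
  case: (k - j \in box n); last exact: cbounded_lipschitz0.
  apply: (cbounded_lipschitzZ (M := `|sqg_symbol j (k - j)|)); last exact: cbounded_lipschitzM.
    move=> t; apply: cvgM; first exact: cvg_cst.
    apply: continuous_comp; last exact: continuous_expR.
    by apply: cvgN; apply: cvgM; [exact: dlc|exact: cvg_cst].
  move=> t; rewrite normrM ler_piMr// ger0_norm ?expR_ge0//.
  exact: gevrey_weight_le1.
pose L := [seq (k, b) | k <- box n, b <- [:: true; false]].
have mL (i : I) : (i \in L) = (i.1 \in box n).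
  case: i => k b; apply/allpairsP/idP => [[[k' b'] /= [kb _ [-> _]]]//|kb].
  by exists (k, b) => /=; split => //; case: (b).
have Fl (i : I) : i \in L -> bounded_lipschitz (fun t x => F t x i).
  rewrite mL /F => ->; have [] := rl i.1; case: i.2 => //.
have F0 t x (i : I) : i \notin L -> F t x i = 0 by rewrite mL /F => /negbTE ->.
have [M [K [K0 FM FK]]] := bounded_lipschitz_family Fl F0.
have Fc (X : R -> I -> R) : (forall j, continuous (X ^~ j)) ->
    forall i, continuous (fun t => F t (X t) i).
  move=> Xc i; have [/Fl[? [? [_ _ _ _]]]|iL] := boolP (i \in L); first exact.
  by under eq_fun do rewrite (F0 _ _ _ iL); move=> t; exact: cvg_cst.
pose x0 (i : I) : R := if i.1 \in box n then
  (if i.2 then complex.Im (v0 i.1) else complex.Re (v0 i.1)) else 0.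
pose sg (i : I) : I := (- i.1, i.2).
pose ep (i : I) : R := if i.2 then -1 else 1.
have VN x : (forall i, x (sg i) = ep i * x i) -> forall k, V x (- k) = conjc (V x k).
  move=> xs k; rewrite /V box_opp; case: ifP => _; last by rewrite raddf0.
  have := xs (k, false); have := xs (k, true); rewrite /sg /ep /= mul1r mulN1r => -> ->.
  by rewrite clampN ?(ltW c0).
have x0s i : x0 (sg i) = ep i * x0 i.
  rewrite /x0 /sg /ep /= box_opp v0N; case: ifP => _; last by rewrite mulr0.
  by case: i => k []; case: (v0 _) => p q /=; rewrite ?mul1r ?mulN1r.
have Fs t x : (forall i, x (sg i) = ep i * x i) -> forall i, F t x (sg i) = ep i * F t x i.
  move=> xs [k b]; rewrite -[sg (k, b)]/(- k, b) !FE box_opp.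
  case: (k \in box n); last by rewrite mulr0.
  have -> : rhs t (V x) (- k) = conjc (rhs t (V x) k).
    by rewrite /rhs galerkin_nlN ?VN// ?ddN ?rmorphB ?rmorphM ?rmorphN /= ?oppr0//; exact: VN.
  by rewrite /ep; case: b; case: (rhs _ _ _) => p q; rewrite ?mul1r ?mulN1r.
have [X [Xc X0 Xd Xs]] := picard_lindelof K0 FM FK Fc x0s Fs.
pose v t k : R[i] := if k \in box n then X t (k, false) +i* X t (k, true) else 0.
have vc k : continuous (fun t => complex.Re (v t k)) /\ continuous (fun t => complex.Im (v t k)).
  by rewrite /v; case: (k \in box n) => /=; split => //; move=> t; exact: cvg_cst.
have vN t k : v t (- k) = conjc (v t k).
  rewrite /v box_opp; case: ifP => _; last by rewrite raddf0.
  by have := Xs t (k, false); have := Xs t (k, true); rewrite /sg /ep /= mul1r mulN1r => -> ->.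
have vV t : \sum_(k <- box n) `[k] `^ (2 * a) * cn (v t k) ^+ 2 <= c ^+ 2 -> V (X t) = v t.
  move=> h; apply/funext => k; rewrite /V /v; case: ifPn => // kb.
  have k1 : 1 <= `[k] by apply: fnorm_ge1; move: kb; rewrite mem_box => /andP[].
  (* As $|k|\ge1$, the weighted energy controls each mode separately. *)
  have vkc : cn (v t k) <= c.
    rewrite -(@ler_pXn2r _ 2) ?nnegrE ?normc_ge0 ?(ltW c0)//; apply: le_trans h.
    have /(_ [:: k] (box n)) := @ler_sum_sub R _ (fun k => `[k] `^ (2 * a) * cn (v t k) ^+ 2).
    rewrite big_seq1 => H; apply: le_trans (H _ isT (uniq_box n) _).
    - rewrite ler_peMl ?sqr_ge0// powR_ge1// mulr_ge0//; by have /andP[/(le_trans ler01)] := a12.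
    - by move=> j; rewrite mulr_ge0 ?powR_ge0 ?sqr_ge0.
    - by move=> j; rewrite inE => /eqP ->.
  have h1 : `|X t (k, false)| <= c.
    by apply: le_trans vkc; have := Re_le_normc (v t k); rewrite {1}/v kb.
  have h2 : `|X t (k, true)| <= c.
    by apply: le_trans vkc; have := Im_le_normc (v t k); rewrite {1}/v kb.
  by rewrite !clamp_id.
pose g t := \sum_(k <- box n) `[k] `^ (2 * a) * cn (v t k) ^+ 2.
pose dv t k : R[i] := (F t (X t) (k, false)) +i* (F t (X t) (k, true)).
pose dg t := \sum_(k <- box n) `[k] `^ (2 * a) * (2 * complex.Re (conjc (v t k) * dv t k)).
have vd (t : R) k : 0 < t -> k \in box n ->
    is_derive t 1 (fun t => complex.Re (v t k)) (complex.Re (dv t k)) /\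
    is_derive t 1 (fun t => complex.Im (v t k)) (complex.Im (dv t k)).
  by move=> t0 kb; rewrite /v kb /=; split; exact: Xd.
have gd (t : R) : 0 < t -> is_derive t 1 g (dg t).
  move=> t0; apply: is_derive_big => k kb; have [dr di] := vd t k t0 kb.
  exact: is_derive_normc_sqr.
have gc : continuous g.
  apply: continuous_sum_seq => k; have [cr ci] := vc k.
  move=> t; apply: cvgM; first exact: cvg_cst.
  under eq_fun do rewrite normc_sqr.
  rewrite normc_sqr; apply: cvgD; apply: cvgM; [exact: cr|exact: cr|exact: ci|exact: ci].
have dvE t k : g t <= c ^+ 2 -> k \in box n -> dv t k = rhs t (v t) k.
  move=> /vV Vt kb; rewrite /dv !FE kb Vt; exact: complex_ReIm.
have v00 t k : t <= 0 -> k \in box n -> v t k = v0 k.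
  by move=> t0 kb; rewrite /v kb !X0// /x0 /= kb; case: (v0 k).
have g0 : g 0 <= E ^+ 2.
  apply: le_trans v0E; rewrite /g big_seq [leRHS]big_seq.
  by apply: ler_sum => k kb; rewrite v00.
have E2c : E ^+ 2 < c ^+ 2 by rewrite ltr_pXn2r ?nnegrE ?(ltW E0) ?(ltW c0).
have dg0 t : 0 < t -> g t <= c ^+ 2 -> dg t <= 0.
  move=> t0 gt.
  pose N := \sum_(k <- box n) `[k] `^ (2 * a) * complex.Re (conjc (v t k) * galerkin_nl n (dl t) (v t) k).
  pose D := \sum_(k <- box n) `[k] `^ (2 * a + 2 * s) * cn (v t k) ^+ 2.
  (* The trilinear bound is used at the barrier level $c$ rather than at $E$; it is then exactly
     absorbed by the dissipation $cD$. *)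
  have NE : `|N| <= c * D by exact: (trilinear_le a12 as_ s1 (dl0 t) c0 (vN t) gt).
  have : dg t <= 2 * (- (c * D) - N).
    rewrite mulrBr mulrN [2 * (c * D)]mulrA !mulr_sumr -sumrN -sumrB /dg.
    rewrite big_seq [leRHS]big_seq; apply: ler_sum => k kb.
    have k0 : 0 < `[k] by apply: fnorm_gt0; move: kb; rewrite mem_box => /andP[].
    rewrite dvE// /rhs mulrBr Re_subc Re_conj_realM.
    rewrite powRD ?(gt_eqF k0) ?implybT//.
    have := ddc k; move: (`[k] `^ (2 * a)) (powR_ge0 `[k] (2 * a)) (sqr_ge0 (cn (v t k))).
    move: (cn _ ^+ 2) (`[k] `^ _) (complex.Re _) (dd k) => X2 Y Z W A A0 X20 h.
    have : 0 <= A * X2 * (W - c * Y) by rewrite !mulr_ge0// subr_ge0.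
    by clear; lra.
  move: NE; rewrite ler_norml => /andP[NE _] h; apply: le_trans h _; move: NE; clear; lra.
exists v; split => //.
- move=> t k; split; first exact: vN.
  by rewrite /v => /negbTE ->.
- exact: barrier gd gc g0 E2c dg0.
- move=> t k t0 kb.
  have gt : g t <= c ^+ 2.
    by apply: le_trans (ltW E2c); apply: (barrier gd gc g0 E2c dg0); exact: ltW.
  have [dr di] := vd t k t0 kb.
  by move: dr di; rewrite dvE.
Qed.

End galerkin.

(** * The bilinear estimate *)

Section cauchy_schwarz.
Context {R : realType} {T : choiceType}.

(** The quadratic $\sum B_j(A_j-x)^2$ in $x$ is nonnegative; it is evaluated at its minimum
    $x=P/S$. *)
Lemma cauchy_schwarz_weighted (s : seq T) (A B : T -> R) : (forall j, 0 <= B j) ->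
  (\sum_(j <- s) A j * B j) ^+ 2 <=
  (\sum_(j <- s) B j) * \sum_(j <- s) A j ^+ 2 * B j.
Proof.
move=> B0; set S := \sum_(j <- s) B j; set Q := \sum_(j <- s) _ ^+ 2 * _.
set P := \sum_(j <- s) A j * B j.
have S0 : 0 <= S by exact: sumr_ge0.
have H (x : R) : 0 <= Q - 2 * x * P + x ^+ 2 * S.
  have -> : Q - 2 * x * P + x ^+ 2 * S = \sum_(j <- s) B j * (A j - x) ^+ 2.
    rewrite /Q /P /S !mulr_sumr -sumrB -big_split /=; apply: eq_bigr => j _; ring.
  by apply: sumr_ge0 => j _; rewrite mulr_ge0 ?sqr_ge0.
move: S0; rewrite le_eqVlt => /predU1P[S0|S0].
  (* If $S=0$ the quadratic is affine; this point would give it the value $-1$ unless $P=0$. *)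
  have := H ((Q + 1) / (2 * P)); rewrite -S0 mulr0 mul0r addr0.
  have [->|P0] := eqVneq P 0; first by rewrite expr0n.
  have -> : Q - 2 * ((Q + 1) / (2 * P)) * P = - 1 by field.
  by lra.
have := H (P / S); have -> : Q - 2 * (P / S) * P + (P / S) ^+ 2 * S = (S * Q - P ^+ 2) / S.
  by field; rewrite gt_eqF.
by rewrite pmulr_lge0 ?invr_gt0// subr_ge0.
Qed.

Lemma cauchy_schwarz_sumle (w x : T -> R) (C X : R) :
  (forall j, 0 <= x j) -> (forall j, 0 < w j \/ x j = 0) ->
  sumle (fun j => if x j != 0 then (w j)^-1 else 0) C -> sumle (fun j => w j * x j ^+ 2) X ->
  sumle x (Num.sqrt (C * X)).
Proof.
move=> x0 w0 HC HX s us.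
have C0 := sumle_ge0 HC; have X0 := sumle_ge0 HX.
rewrite -(@ler_pXn2r _ 2) ?nnegrE ?sqrtr_ge0 ?sumr_ge0// sqr_sqrtr ?mulr_ge0//.
pose B j := if x j != 0 then (w j)^-1 else 0.
have B0 j : 0 <= B j.
  rewrite /B; case: (w0 j) => [h|->]; last by rewrite eqxx.
  by case: ifP => // _; rewrite invr_ge0 ltW.
have := cauchy_schwarz_weighted s (fun j => w j * x j) B0.
have -> : \sum_(j <- s) w j * x j * B j = \sum_(j <- s) x j.
  apply: eq_bigr => j _; rewrite /B; case: eqP => [->|xj]; first by rewrite !mulr0.
  by case: (w0 j) => // h; rewrite mulrAC divff ?mul1r// gt_eqF.
have -> : \sum_(j <- s) (w j * x j) ^+ 2 * B j = \sum_(j <- s) w j * x j ^+ 2.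
  apply: eq_bigr => j _; rewrite /B; case: eqP => [->|xj]; first by rewrite /= !mulr0 expr0n mulr0.
  by case: (w0 j) => // h; rewrite /=; field; rewrite gt_eqF.
move=> h; apply: le_trans h _; rewrite ler_pM ?HC ?HX ?sumr_ge0// => j _.
by case: (w0 j) => [h|->]; rewrite ?expr0n ?mulr0// mulr_ge0 ?sqr_ge0 ?(ltW h).
Qed.

Lemma has_sum_ge (F : T -> R) S s : (forall k, 0 <= F k) -> has_sum F S -> uniq s ->
  \sum_(k <- s) F k <= S.
Proof.
move=> F0 FS us; apply/ler_addgt0Pr => e e0; have [s0 [us0 H]] := FS e e0.
have /H : uniq (undup (s0 ++ s)) by exact: undup_uniq.
have ss0 : {subset s0 <= undup (s0 ++ s)} by move=> k ks; rewrite mem_undup mem_cat ks.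
have ss : {subset s <= undup (s0 ++ s)} by move=> k ks; rewrite mem_undup mem_cat ks orbT.
move=> /(_ ss0); rewrite ler_norml => /andP[h _].
have := ler_sum_sub F0 us (undup_uniq _) ss; move: h; lra.
Qed.

Lemma has_sum_big (J : Type) (s : seq J) (F : J -> T -> R) (S : J -> R) :
  (forall k, has_sum (F k) (S k)) ->
  has_sum (fun j => \sum_(k <- s) F k j) (\sum_(k <- s) S k).
Proof.
move=> FS; elim: s => [|k s IH].
  by under [X in has_sum X]eq_fun do rewrite big_nil; rewrite big_nil; exact: has_sum0.
by under [X in has_sum X]eq_fun do rewrite big_cons; rewrite big_cons; exact: has_sumD.
Qed.

End cauchy_schwarz.

Section young.
Context {R : realType}.
Variables (A B : freq -> R) (X Y : R).
Hypotheses (A0 : forall j, 0 <= A j) (B0 : forall j, 0 <= B j)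
  (AX : sumle (fun j => A j ^+ 2) X) (BY : sumle B Y).

(** The convolution of $A^2$ with $B$, summable with sum at most $XY$. Cauchy-Schwarz with weight
    $B$ bounds the square of the convolution of $A$ and $B$ by $Y$ times it: Young's inequality
    $\ell^2*\ell^1\subset\ell^2$, kept pointwise in $k$. *)
Definition young_density k := rsum (fun j => A j ^+ 2 * B (k - j)).

Let term_ge0 k j : 0 <= A j ^+ 2 * B (k - j).
Proof. by rewrite mulr_ge0 ?sqr_ge0. Qed.

Let X0 : 0 <= X := sumle_ge0 AX.
Let Y0 : 0 <= Y := sumle_ge0 BY.

Lemma young_density_summable k : sumle (fun j => A j ^+ 2 * B (k - j)) (X * Y).
Proof.
move=> s us; apply: (@le_trans _ _ (\sum_(j <- s) A j ^+ 2 * Y)).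
  by apply: ler_sum => j _; rewrite ler_wpM2l ?sqr_ge0//; exact: sumle_le BY.
by rewrite -mulr_suml ler_wpM2r// AX.
Qed.

Lemma young_density_has_sum k :
  has_sum (fun j => A j ^+ 2 * B (k - j)) (young_density k).
Proof.
apply: (@has_sum_rsum _ _ (X * Y)); apply: sumleW (young_density_summable k) => j.
by rewrite ger0_norm ?term_ge0.
Qed.

Lemma young_density_ge0 k : 0 <= young_density k.
Proof.
by have := has_sum_ge (term_ge0 k) (young_density_has_sum k) (isT : uniq [::]); rewrite big_nil.
Qed.

Lemma young_density_le : sumle young_density (X * Y).
Proof.
move=> t ut; have := has_sum_bound (has_sum_big t young_density_has_sum).
rewrite ger0_norm ?sumr_ge0//; last by move=> k _; exact: young_density_ge0.
apply => s us; apply: (@le_trans _ _ (\sum_(j <- s) A j ^+ 2 * Y)); last first.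
  by rewrite -mulr_suml ler_wpM2r// AX.
apply: ler_sum => j _; rewrite ger0_norm ?sumr_ge0// -mulr_sumr ler_wpM2l ?sqr_ge0//.
have -> : \sum_(k <- t) B (k - j) = \sum_(l <- map (fun k => k - j) t) B l by rewrite big_map.
by apply: BY; rewrite map_inj_uniq//; exact: addIr.
Qed.

Lemma young_convolution k :
  sumle (fun j => A j * B (k - j)) (Num.sqrt (Y * young_density k)).
Proof.
move=> s us; rewrite -(@ler_pXn2r _ 2) ?nnegrE ?sqrtr_ge0//; last first.
  by apply: sumr_ge0 => j _; exact: mulr_ge0.
rewrite sqr_sqrtr ?mulr_ge0 ?young_density_ge0//.
apply: le_trans (cauchy_schwarz_weighted s A (fun j => B0 (k - j))) _.
apply: ler_pM; rewrite ?sumr_ge0//.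
  have -> : \sum_(j <- s) B (k - j) = \sum_(l <- map (fun j => k - j) s) B l by rewrite big_map.
  by apply: BY; rewrite map_inj_uniq// => x y /addrI/oppr_inj.
exact: has_sum_ge (term_ge0 k) (young_density_has_sum k) us.
Qed.

End young.

(** * The nonlinearity maps $\dot H^a$ into $\dot H^{a-1}$ *)

Section bilinear.
Context {R : realType}.
Variables (a s : R).
Hypotheses (a1 : 1 < a) (a2 : a <= 2) (s0 : 0 < s) (s1 : s <= 1).
Local Notation "`[ k ]" := (@fnorm R k).
Implicit Types (f g : coeffs R) (j k : freq).

(* The squared [\dot H^p] norm of [f] is at most [X]; see [Hle_hnorm] and
   [hnorm_Hle] for the comparison with [hnorm]. *)
Definition Hle (p X : R) f := sumle (fun k => `[k] `^ (2 * p) * cn (f k) ^+ 2) X.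

Definition nl_term d f g k j : R[i] :=
  (sqg_symbol j (k - j) * gevrey_weight s d j (k - j) k)%:C * (f j * g (k - j)).

Definition nl d f g : coeffs R := fun k => csum (nl_term d f g k).

(** Since $j\times(k-j)=j\times k$, the derivative falls on the output frequency and the factor
    $|j|$ cancels. *)
Lemma sqg_symbol_le j k : `|sqg_symbol j (k - j) : R| <= `[k].
Proof.
rewrite /sqg_symbol; have [->|j0] := eqVneq j 0.
  by rewrite fnorm0 invr0 mulr0 normr0 fnorm_ge0.
have jp := @fnorm_gt0 R _ j0.
have -> : crossp j (k - j) = crossp j k by rewrite /crossp /=; ring.
rewrite normrM normfV (ger0_norm (fnorm_ge0 j)) ler_pdivrMr// mulrC; exact: crossp_le.
Qed.

Lemma normc_nl_term d f g k j : 0 <= d ->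
  cn (nl_term d f g k j) <= `[k] * (cn (f j) * cn (g (k - j))).
Proof.
move=> d0; rewrite /nl_term !ComplexField.Normc.normcM normc_real normrM.
rewrite ler_wpM2r ?mulr_ge0 ?normc_ge0// -[leRHS]mulr1 ler_pM//; first exact: sqg_symbol_le.
by rewrite ger0_norm ?expR_ge0//; exact: gevrey_weight_le1.
Qed.

Lemma powR_fnorm_split j k : `[k] `^ a <= 4 * (`[j] `^ a + `[k - j] `^ a).
Proof.
have a0 : 0 < a by exact: lt_trans a1.
have -> : 4 = 2 `^ 2 :> R by rewrite (powR_mulrn 2 (ler0n R 2)); ring.
apply: (@le_trans _ _ ((2 * Num.max `[j] `[k - j]) `^ a)).
  rewrite ge0_ler_powR ?nnegrE ?fnorm_ge0 ?mulr_ge0 ?(ltW a0) ?le_max ?fnorm_ge0//.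
  apply: le_trans (_ : `[j] + `[k - j] <= _); first by rewrite -[in leLHS](subrKC j k) ler_fnormD.
  by rewrite mulrDl mul1r lerD// le_max lexx ?orbT.
rewrite powRM ?le_max ?fnorm_ge0// ler_pM ?powR_ge0//.
  by rewrite ler_powR// ler1n.
by case: (leP `[j] `[k - j]) => _; rewrite ?lerDl ?lerDr powR_ge0.
Qed.

Lemma l1_bound : exists C : R, 0 < C /\ forall f X, f 0 = 0 -> Hle a X f ->
  sumle (fun k => cn (f k)) (Num.sqrt (C * X)).
Proof.
have [C [C0 HC]] := inv_pow_sum a1; exists C; split => // f X f0 fX.
have n0 : cn (0 : R[i]) = 0 by rewrite /= expr0n /= addr0 sqrtr0.
apply: (@cauchy_schwarz_sumle _ _ (fun k => `[k] `^ (2 * a))) => //.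
- by move=> j; exact: normc_ge0.
- move=> j; have [->|j0] := eqVneq j 0; first by right; rewrite f0.
  by left; apply: powR_gt0; exact: fnorm_gt0.
- apply: sumleW HC => k; have [->|k0] := eqVneq k 0; first by rewrite f0 n0 eqxx.
  by case: ifP => _; rewrite powRN// invr_ge0 powR_ge0.
Qed.

(** The loss is written $|k|=|k|^a/|k|^{a-1}$ and $|k|^a$ is shared between $j$ and $k-j$; one
    factor is then in $\ell^2$ and the other in $\ell^1$ because $a>1$. A majorant [q] is produced
    instead of a norm bound because it also gives absolute convergence at each $k$. *)
Lemma nl_estimate : exists C : R, 0 < C /\ forall d f g X Y, 0 <= d ->
  f 0 = 0 -> g 0 = 0 -> Hle a X f -> Hle a Y g ->
  exists q : freq -> R, [/\ forall k, 0 <= q k, sumle q (C * (X * Y)) &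
    forall k, sumle (fun j => cn (nl_term d f g k j)) (Num.sqrt (q k) / `[k] `^ (a - 1))].
Proof.
have [K [K0 HK]] := l1_bound.
exists (64 * K); split; first by rewrite mulr_gt0.
move=> d f g X Y d0 f0 g0 fX gY.
have X0 := sumle_ge0 fX; have Y0 := sumle_ge0 gY.
pose wf k := `[k] `^ a * cn (f k); pose wg k := `[k] `^ a * cn (g k).
have wf2 : sumle (fun k => wf k ^+ 2) X.
  by apply: sumleW fX => k; rewrite exprMn sqr_powR.
have wg2 : sumle (fun k => wg k ^+ 2) Y.
  by apply: sumleW gY => k; rewrite exprMn sqr_powR.
have f1 := HK f X f0 fX; have g1 := HK g Y g0 gY.
have wf0 k : 0 <= wf k by rewrite mulr_ge0 ?powR_ge0 ?normc_ge0.
have wg0 k : 0 <= wg k by rewrite mulr_ge0 ?powR_ge0 ?normc_ge0.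
have nf0 k : 0 <= cn (f k) by exact: normc_ge0.
have ng0 k : 0 <= cn (g k) by exact: normc_ge0.
pose Q1 := young_density wf (fun k => cn (g k)).
pose Q2 := young_density wg (fun k => cn (f k)).
have Q10 k : 0 <= Q1 k by exact: young_density_ge0 wf2 g1 k.
have Q20 k : 0 <= Q2 k by exact: young_density_ge0 wg2 f1 k.
have c1 k := young_convolution wf0 ng0 wf2 g1 k.
have c2 k := young_convolution wg0 nf0 wg2 f1 k.
pose S1 := Num.sqrt (K * Y); pose S2 := Num.sqrt (K * X).
have S10 : 0 <= S1 by exact: sqrtr_ge0.
have S20 : 0 <= S2 by exact: sqrtr_ge0.
exists (fun k => 32 * (S1 * Q1 k + S2 * Q2 k)); split.
- by move=> k; rewrite mulr_ge0// addr_ge0// mulr_ge0.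
- have -> : 64 * K * (X * Y) = 32 * (S1 * (X * S1) + S2 * (Y * S2)).
    have e1 : S1 ^+ 2 = K * Y by rewrite sqr_sqrtr// mulr_ge0 ?(ltW K0).
    have e2 : S2 ^+ 2 = K * X by rewrite sqr_sqrtr// mulr_ge0 ?(ltW K0).
    have -> : S1 * (X * S1) = X * S1 ^+ 2 by ring.
    have -> : S2 * (Y * S2) = Y * S2 ^+ 2 by ring.
    by rewrite e1 e2; ring.
  apply: sumleZ => //; apply: sumleD; apply: sumleZ => //.
    exact: young_density_le ng0 wf2 g1.
  exact: young_density_le nf0 wg2 f1.
move=> k; have [k0|k0] := eqVneq k 0.
  move=> t ut; rewrite big1 ?divr_ge0 ?sqrtr_ge0 ?powR_ge0// => j _.
  apply/eqP; rewrite eq_le normc_ge0 andbT; apply: le_trans (normc_nl_term _ _ _ _ d0) _.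
  by rewrite k0 fnorm0 mul0r.
have kp := @fnorm_gt0 R _ k0.
have kp' : 0 < `[k] `^ (a - 1) by rewrite powR_gt0.
have c2' : sumle (fun j => cn (f j) * wg (k - j)) (Num.sqrt (S2 * Q2 k)).
  have := sumle_inj (f := fun j => k - j) _ (c2 k).
  have kinj : injective (fun j => k - j) by move=> x y /addrI/oppr_inj.
  by move=> /(_ kinj); apply: sumleW => j; rewrite /= subKr mulrC.
have c12 := sumleD (c1 k) c2'.
have : sumle (fun j => cn (nl_term d f g k j))
    (4 / `[k] `^ (a - 1) * (Num.sqrt (S1 * Q1 k) + Num.sqrt (S2 * Q2 k))).
  have c40 : 0 <= 4 / `[k] `^ (a - 1) by rewrite divr_ge0 ?powR_ge0.
  apply: sumleW (sumleZ c40 c12) => j.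
  apply: le_trans (normc_nl_term _ _ _ _ d0) _.
  have kE : `[k] = `[k] `^ a / `[k] `^ (a - 1).
    rewrite -powRB ?(gt_eqF kp) ?implybT//.
    have -> : a - (a - 1) = 1 by ring.
    by rewrite powRr1 ?fnorm_ge0.
  rewrite [X in X * _ <= _]kE.
  have -> : 4 / `[k] `^ (a - 1) * (wf j * cn (g (k - j)) + cn (f j) * wg (k - j)) =
     4 * (`[j] `^ a + `[k - j] `^ a) / `[k] `^ (a - 1) * (cn (f j) * cn (g (k - j))).
    rewrite /wf /wg; move: (cn (f j)) (cn (g _)) (`[j] `^ _) (`[k - j] `^ _) => p q r u.
    by move: (_ `^ _)^-1 => v; ring.
  rewrite ler_wpM2r ?mulr_ge0// ler_pM2r ?invr_gt0//; exact: powR_fnorm_split.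
apply: sumle_wk; rewrite mulrAC ler_pM2r ?invr_gt0//.
rewrite -(@ler_pXn2r _ 2) ?nnegrE ?sqrtr_ge0 ?mulr_ge0 ?addr_ge0 ?sqrtr_ge0//.
rewrite sqr_sqrtr; last by rewrite mulr_ge0// addr_ge0// mulr_ge0.
rewrite -[S1 * Q1 k]sqr_sqrtr ?mulr_ge0// -[S2 * Q2 k]sqr_sqrtr ?mulr_ge0//.
rewrite !sqrtr_sqr !ger0_norm ?sqrtr_ge0//.
set p := Num.sqrt (S1 * _); set q := Num.sqrt (S2 * _).
rewrite -subr_ge0; have -> : 32 * (p ^+ 2 + q ^+ 2) - (4 * (p + q)) ^+ 2 = 16 * (p - q) ^+ 2 by ring.
by rewrite mulr_ge0 ?sqr_ge0.
Qed.

End bilinear.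

Section complex_sums.
Context {R : realType}.
Implicit Types (z w : freq -> R[i]) (B : R).

Lemma Im_subc (z w : R[i]) : complex.Im (z - w) = complex.Im z - complex.Im w.
Proof. by case: z w => [p q] [p' q']. Qed.

Lemma normc_le_ReIm (z : R[i]) : cn z <= `|complex.Re z| + `|complex.Im z|.
Proof.
rewrite -(@ler_pXn2r _ 2) ?nnegrE ?normc_ge0 ?addr_ge0// normc_sqr sqrrD !real_normK ?num_real//.
by rewrite addrAC lerDl mulrn_wge0// mulr_ge0.
Qed.

Lemma normcN (z : R[i]) : cn (- z) = cn z.
Proof. by case: z => p q /=; rewrite !sqrrN. Qed.

Lemma ler_normcD (z w : R[i]) : cn (z + w) <= cn z + cn w.
Proof. exact: le_normcD. Qed.

Lemma sumle_ReIm z B : sumle (fun k => cn (z k)) B ->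
  sumle (fun k => `|complex.Re (z k)|) B /\ sumle (fun k => `|complex.Im (z k)|) B.
Proof. by move=> zB; split; apply: sumleW zB => k; [exact: Re_le_normc|exact: Im_le_normc]. Qed.

Lemma normc_csum_le z B : sumle (fun k => cn (z k)) B -> cn (csum z) <= 2 * B.
Proof.
move=> /sumle_ReIm[zr zi]; apply: le_trans (normc_le_ReIm _) _; rewrite mulrDl mul1r.
by apply: lerD; [exact: has_sum_bound (has_sum_rsum zr) zr|exact: has_sum_bound (has_sum_rsum zi) zi].
Qed.

Lemma csumB z w B B' : sumle (fun k => cn (z k)) B -> sumle (fun k => cn (w k)) B' ->
  csum z - csum w = csum (fun k => z k - w k).
Proof.
move=> zB wB; have [zr zi] := sumle_ReIm zB; have [wr wi] := sumle_ReIm wB.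
have zwB : sumle (fun k => cn (z k - w k)) (B + B').
  apply: sumleW (sumleD zB wB) => k; rewrite -(normcN (w k)).
  exact: ler_normcD.
have [zwr zwi] := sumle_ReIm zwB.
apply/eqP; rewrite eq_complex Re_subc Im_subc /csum /=; apply/andP; split; apply/eqP.
  apply: has_sum_unique (has_sumB (has_sum_rsum zr) (has_sum_rsum wr)) _.
  by under [X in has_sum X]eq_fun do rewrite -Re_subc; exact: has_sum_rsum zwr.
apply: has_sum_unique (has_sumB (has_sum_rsum zi) (has_sum_rsum wi)) _.
by under [X in has_sum X]eq_fun do rewrite -Im_subc; exact: has_sum_rsum zwi.
Qed.

Lemma csum_finite z (s : seq freq) : uniq s -> (forall k, k \notin s -> z k = 0) ->
  csum z = \sum_(k <- s) z k.
Proof.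
move=> us zs.
have zB : sumle (fun k => cn (z k)) (\sum_(k <- s) cn (z k)).
  move=> t ut; rewrite (bigID (mem s))/= [X in _ + X]big1 ?addr0; last first.
    by move=> k /zs ->; rewrite /= expr0n /= addr0 sqrtr0.
  rewrite -[leLHS]big_filter; apply: ler_sum_sub => //; last by move=> k; rewrite mem_filter => /andP[].
    by move=> k; exact: normc_ge0.
  exact: filter_uniq.
have [zr zi] := sumle_ReIm zB.
apply/eqP; rewrite eq_complex Re_sum Im_sum /csum /=; apply/andP; split; apply/eqP.
  by apply: has_sum_unique (has_sum_rsum zr) _; apply: has_sum_finite => // k /zs ->.
by apply: has_sum_unique (has_sum_rsum zi) _; apply: has_sum_finite => // k /zs ->.
Qed.

End complex_sums.

Section nonlinear.
Context {R : realType}.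
Variables (a s : R).
Hypotheses (a1 : 1 < a) (a2 : a <= 2) (s0 : 0 < s) (s1 : s <= 1).
Local Notation "`[ k ]" := (@fnorm R k).
Implicit Types (f g : coeffs R) (j k : freq).

Lemma HleD p f g X Y : Hle p X f -> Hle p Y g -> Hle p (2 * X + 2 * Y) (f \+ g).
Proof.
move=> fX gY; apply: sumleW (sumleD (sumleZ (ler0n _ 2) fX) (sumleZ (ler0n _ 2) gY)) => k.
rewrite !(mulrCA 2) -mulrDr ler_wpM2l ?powR_ge0//=.
have := ler_normcD (f k) (g k) => h.
apply: (@le_trans _ _ ((cn (f k) + cn (g k)) ^+ 2)).
  by rewrite ler_pXn2r ?nnegrE ?addr_ge0 ?normc_ge0.
rewrite -subr_ge0; set x := cn (f k); set y := cn (g k).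
have -> : x * (2 * x) + y * (2 * y) - (x + y) ^+ 2 = (x - y) ^+ 2 by ring.
exact: sqr_ge0.
Qed.

Lemma HleN p f X : Hle p X f -> Hle p X (\- f).
Proof. by apply: sumleW => k /=; rewrite normcN. Qed.

Lemma HleB p f g X Y : Hle p X f -> Hle p Y g -> Hle p (2 * X + 2 * Y) (f \- g).
Proof. by move=> fX /HleN; exact: HleD. Qed.

Lemma Hle_wk p f X Y : X <= Y -> Hle p X f -> Hle p Y f.
Proof. exact: sumle_wk. Qed.

Lemma nl_term0 d f g j : nl_term s d f g 0 j = 0.
Proof.
rewrite /nl_term /sqg_symbol; have -> : crossp j (0 - j) = 0.
  by rewrite /crossp /=; ring.
by rewrite mul0r mul0r mul0r.
Qed.

Lemma nl_at0 d f g : nl s d f g 0 = 0.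
Proof.
rewrite /nl (@csum_finite _ _ [::])// ?big_nil// => k _; exact: nl_term0.
Qed.

(** For data supported in the box the truncated convolution is the full one, so Galerkin solutions
    and their limit share the same [nl]. *)
Lemma galerkin_nlE n d f : (forall k, k \notin box n -> f k = 0) ->
  galerkin_nl s n d f = nl s d f f.
Proof.
move=> fn; apply/funext => k; rewrite /nl (@csum_finite _ _ (box n)) ?uniq_box//; last first.
  by move=> j jn; rewrite /nl_term (fn _ jn) mul0r mulr0.
apply: eq_bigr => j _; case: ifPn => // kj.
by rewrite /nl_term (fn _ kj) !mulr0.
Qed.

(** The extra factor 4 comes from estimating the real and imaginary parts of [csum] separately, a
    loss of 2 before squaring. *)
Lemma nl_bound : exists C : R, 0 < C /\ forall d f g X Y, 0 <= d ->
  f 0 = 0 -> g 0 = 0 -> Hle a X f -> Hle a Y g ->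
  Hle (a - 1) (C * (X * Y)) (nl s d f g).
Proof.
have [C [C0 H]] := nl_estimate a1 a2 s0 s1; exists (4 * C); split; first by rewrite mulr_gt0.
move=> d f g X Y d0 f0 g0 fX gY; have [q [q0 qC qs]] := H d f g X Y d0 f0 g0 fX gY.
rewrite -mulrA; apply: sumleW (sumleZ (ler0n _ 4) qC) => k.
have [->|k0] := eqVneq k 0.
  by rewrite nl_at0 /= expr0n /= addr0 sqrtr0 expr0n mulr0 mulr_ge0.
have kp : 0 < `[k] `^ (a - 1) by apply: powR_gt0; exact: fnorm_gt0.
have h := normc_csum_le (qs k).
apply: (@le_trans _ _ (`[k] `^ (2 * (a - 1)) * (2 * (Num.sqrt (q k) / `[k] `^ (a - 1))) ^+ 2)).
  rewrite ler_wpM2l ?powR_ge0// ler_pXn2r ?nnegrE ?normc_ge0//.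
  by rewrite mulr_ge0// divr_ge0 ?sqrtr_ge0 ?powR_ge0.
rewrite -sqr_powR -exprMn.
have -> : `[k] `^ (a - 1) * (2 * (Num.sqrt (q k) / `[k] `^ (a - 1))) = 2 * Num.sqrt (q k).
  by field; rewrite gt_eqF.
by rewrite exprMn sqr_sqrtr//; have -> : 2 ^+ 2 = 4 :> R by ring.
Qed.

Lemma nl_term_summable d f g k X Y : 0 <= d -> f 0 = 0 -> g 0 = 0 ->
  Hle a X f -> Hle a Y g -> exists B, sumle (fun j => cn (nl_term s d f g k j)) B.
Proof.
have [C [C0 H]] := nl_estimate a1 a2 s0 s1 => d0 f0 g0 fX gY.
by have [q [_ _ /(_ k) qs]] := H d f g X Y d0 f0 g0 fX gY; eexists; exact: qs.
Qed.

Lemma nl_sub d f g X : 0 <= d -> f 0 = 0 -> g 0 = 0 -> Hle a X f -> Hle a X g ->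
  forall k, nl s d f f k - nl s d g g k = nl s d (f \- g) f k - nl s d g (g \- f) k.
Proof.
move=> d0 f0 g0 fX gX k.
have fg0 : (f \- g) 0 = 0 by rewrite /= f0 g0 subr0.
have gf0 : (g \- f) 0 = 0 by rewrite /= f0 g0 subr0.
have fgX := HleB fX gX; have gfX := HleB gX fX.
have [B1 h1] := nl_term_summable k d0 f0 f0 fX fX.
have [B2 h2] := nl_term_summable k d0 g0 g0 gX gX.
have [B3 h3] := nl_term_summable k d0 fg0 f0 fgX fX.
have [B4 h4] := nl_term_summable k d0 g0 gf0 gX gfX.
rewrite /nl (csumB h1 h2) (csumB h3 h4); congr csum; apply/funext => j.
by rewrite /nl_term /= ; ring.
Qed.

Lemma nl_diff_bound : exists C : R, 0 < C /\ forall d f g X Y, 0 <= d ->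
  f 0 = 0 -> g 0 = 0 -> Hle a X f -> Hle a X g -> Hle a Y (f \- g) ->
  Hle (a - 1) (C * (X * Y)) (nl s d f f \- nl s d g g).
Proof.
have [C [C0 H]] := nl_bound; exists (4 * C); split; first by rewrite mulr_gt0.
move=> d f g X Y d0 f0 g0 fX gX fgY.
have gfY : Hle a Y (g \- f).
  by apply: sumleW fgY => k /=; rewrite -opprB normcN.
have fg0 : (f \- g) 0 = 0 by rewrite /= f0 g0 subr0.
have gf0 : (g \- f) 0 = 0 by rewrite /= f0 g0 subr0.
have -> : nl s d f f \- nl s d g g = nl s d (f \- g) f \- nl s d g (g \- f).
  by apply/funext => k; exact: (nl_sub d0 f0 g0 fX gX k).
apply: Hle_wk (HleB (H d _ _ Y X d0 fg0 f0 fgY fX) (H d _ _ X Y d0 g0 gf0 gX gfY)).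
by rewrite le_eqVlt; apply/orP; left; apply/eqP; ring.
Qed.

Lemma Hle_normc p f X k : k != 0 -> 0 <= p -> Hle p X f -> cn (f k) <= Num.sqrt X.
Proof.
move=> k0 p0 fX; have X0 := sumle_ge0 fX.
rewrite -(@ler_pXn2r _ 2) ?nnegrE ?normc_ge0 ?sqrtr_ge0// sqr_sqrtr//.
apply: le_trans (sumle_le k fX); rewrite ler_peMl ?sqr_ge0//.
by rewrite powR_ge1 ?fnorm_ge1// mulr_ge0.
Qed.

(* Continuity of [y] with values in [\dot H^p]. *)
Definition Hcont p (y : R -> coeffs R) :=
  forall (t e : R), 0 < e -> \forall r \near t, Hle p e (y r \- y t).

(** Dominated convergence by hand: finitely many weights converge, and the tail is small uniformly
    because all weights are at most 1. *)
Lemma nl_continuous_delta f X k (dl : R -> R) : f 0 = 0 -> Hle a X f ->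
  continuous dl -> (forall t, 0 <= dl t) ->
  forall (t e : R), 0 < e -> \forall r \near t, cn (nl s (dl r) f f k - nl s (dl t) f f k) <= e.
Proof.
move=> f0 fX dlc dl0 t e e0.
pose w d j := gevrey_weight s d j (k - j) k.
pose F j := cn ((sqg_symbol j (k - j))%:C * (f j * f (k - j))).
have F0 j : 0 <= F j by exact: normc_ge0.
have termE d j : cn (nl_term s d f f k j) = w d j * F j.
  rewrite /nl_term /F rmorphM /= -mulrA mulrCA !ComplexField.Normc.normcM normc_real.
  by rewrite ger0_norm ?expR_ge0.
have [B FB] : exists B, sumle F B.
  have [B b_] := nl_term_summable k (lexx 0) f0 f0 fX fX.
  by exists B; apply: sumleW b_ => j; rewrite termE /w /gevrey_weight mul0r oppr0 expR0 mul1r.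
have e8 : 0 < e / 8 by rewrite divr_gt0.
have FB' : sumle (fun j => `|F j|) B by apply: sumleW FB => j; rewrite ger0_norm.
have [s' [us' tail]] := sumle_tail e8 FB'.
have wc j : \forall r \near t, `|w (dl t) j - w (dl r) j| * (B + 1) <= e / 4.
  have wc : continuous (fun r => w (dl r) j).
    move=> r; apply: continuous_comp; last exact: continuous_expR.
    by apply: cvgN; apply: cvgM; [exact: dlc|exact: cvg_cst].
  have B1 : 0 < B + 1 by rewrite ltr_wpDl// (sumle_ge0 FB).
  have /cvgrPdist_le/(_ (e / 4 / (B + 1))) := wc t.
  rewrite !divr_gt0// => /(_ isT); apply: filterS => r.
  by rewrite ler_pdivlMr.
have near_all : \forall r \near t, forall j, j \in s' ->
    `|w (dl t) j - w (dl r) j| * (B + 1) <= e / 4.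
  elim: s' {us' tail} => [|j l IH]; first by near=> r => j; rewrite in_nil.
  near=> r => i; rewrite inE => /predU1P[->|]; first by near: r; exact: wc.
  by move: i; near: r; exact: IH.
move: near_all; apply: filterS => r Hr.
have [B1 h1] := nl_term_summable k (dl0 r) f0 f0 fX fX.
have [B2 h2] := nl_term_summable k (dl0 t) f0 f0 fX fX.
rewrite /nl (csumB h1 h2).
suff H : sumle (fun j => cn (nl_term s (dl r) f f k j - nl_term s (dl t) f f k j)) (e / 4 + 2 * (e / 8)).
  by apply: le_trans (normc_csum_le H) _; lra.
have B1p : 0 < B + 1 by rewrite ltr_wpDl// (sumle_ge0 FB).
have FB1 : sumle (fun j => e / 4 / (B + 1) * F j) (e / 4).
  apply: sumle_wk (sumleZ _ FB); last by rewrite !divr_ge0// ltW.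
  by rewrite mulrAC ler_pdivrMr// ler_wpM2l ?lerDl// divr_ge0// ltW.
apply: sumleW (sumleD FB1 (sumleZ (ler0n _ 2) tail)) => j.
have -> : nl_term s (dl r) f f k j - nl_term s (dl t) f f k j =
    (w (dl r) j - w (dl t) j)%:C * ((sqg_symbol j (k - j))%:C * (f j * f (k - j))).
  by rewrite /nl_term -/(w _ j) -/(w _ j) !rmorphM rmorphB /=; ring.
rewrite ComplexField.Normc.normcM normc_real -/(F j).
have [jl|jl] := boolP (j \in s').
  rewrite mulr0 addr0 ler_wpM2r// distrC ler_pdivlMr//; exact: Hr.
rewrite (ger0_norm (F0 j)) -[leLHS]add0r lerD//.
  by rewrite mulr_ge0// !divr_ge0// ltW.
rewrite ler_wpM2r//.
have w1 d : 0 <= d -> 0 <= w d j <= 1.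
  by move=> d0; rewrite expR_ge0 gevrey_weight_le1.
have := w1 _ (dl0 r); have := w1 _ (dl0 t).
by move: (w (dl r) j) (w (dl t) j) => p q; rewrite ler_norml; lra.
Unshelve. all: by end_near. Qed.

Lemma nl_continuous (y : R -> coeffs R) (dl : R -> R) X k :
  (forall t, y t 0 = 0) -> (forall t, Hle a X (y t)) -> Hcont a y ->
  continuous dl -> (forall t, 0 <= dl t) ->
  continuous (fun t => complex.Re (nl s (dl t) (y t) (y t) k)) /\
  continuous (fun t => complex.Im (nl s (dl t) (y t) (y t) k)).
Proof.
move=> y0 yX yc dlc dl0.
suff H (t e : R) : 0 < e -> \forall r \near t,
    cn (nl s (dl t) (y t) (y t) k - nl s (dl r) (y r) (y r) k) <= e.
  split=> t; apply/cvgrPdist_le => e /(H t); apply: filterS => r; apply: le_trans.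
    by rewrite -Re_subc; exact: Re_le_normc.
  by rewrite -Im_subc; exact: Im_le_normc.
move=> e0; have [->|k0] := eqVneq k 0.
  near=> r; rewrite !nl_at0 subrr /= expr0n /= addr0 sqrtr0; exact: ltW.
have [C [C0 HC]] := nl_diff_bound.
have X0 : 0 <= X := sumle_ge0 (yX 0).
have e2 : 0 < e / 2 by rewrite divr_gt0.
pose e' := (e / 2) ^+ 2 / (C * (X + 1)).
have CX : 0 < C * (X + 1) by rewrite mulr_gt0// ltr_wpDl.
have e'0 : 0 < e' by rewrite divr_gt0// exprn_gt0.
have h1 := yc t e' e'0.
have h2 := nl_continuous_delta k (y0 t) (yX t) dlc dl0 t e2.
near=> r.
have tri (z1 z2 z3 : R[i]) : cn (z1 - z2) <= cn (z3 - z1) + cn (z2 - z3).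
  have -> : z1 - z2 = - (z3 - z1) + - (z2 - z3) by ring.
  by apply: le_trans (ler_normcD _ _) _; rewrite !normcN.
apply: le_trans (tri _ _ (nl s (dl r) (y t) (y t) k)) _.
rewrite [leRHS]splitr lerD//; first by near: r; exact: h2.
have hr : Hle a e' (y r \- y t) by near: r; exact: h1.
have := Hle_normc k0 _ (HC (dl r) (y r) (y t) X e' (dl0 r) (y0 r) (y0 t) (yX r) (yX t) hr).
rewrite subr_ge0 (ltW a1) => /(_ isT) /= h; apply: le_trans h _.
rewrite -(@ler_pXn2r _ 2) ?nnegrE ?sqrtr_ge0 ?(ltW e2)// sqr_sqrtr; last first.
  by rewrite mulr_ge0 ?(ltW C0)// mulr_ge0// (ltW e'0).
rewrite /e' mulrA mulrA ler_pdivrMr// [leRHS]mulrC.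
by rewrite ler_wpM2r ?sqr_ge0// ler_pM2l// lerDl.
Unshelve. all: by end_near. Qed.

End nonlinear.

(** * Stability, uniqueness and existence *)

Section duhamel.
Context {R : realType}.
Variables (a s : R).
Hypotheses (s12 : 2^-1 < s) (s1 : s <= 1).
Local Notation "`[ k ]" := (@fnorm R k).

(** The order of the time singularity left when smoothing of order $2s$ pays for one derivative. It
    is integrable since $2s>1$. *)
Definition qexp : R := (2 * s)^-1.

Lemma qexp_gt0 : 0 < qexp.
Proof. rewrite invr_gt0 mulr_gt0//; move: s12; lra. Qed.

Lemma qexp_lt1 : qexp < 1.
Proof.
rewrite /qexp invf_lt1; last by rewrite mulr_gt0//; move: s12; lra.
move: s12; lra.
Qed.

Lemma expRN_le_powR (z : R) : 0 < z -> expR (- z) <= z `^ (- qexp).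
Proof.
move=> z0; rewrite expRN powRN lef_pV2 ?posrE ?expR_gt0 ?powR_gt0//.
have [z1|/ltW z1] := leP z 1.
  apply: le_trans (_ : 1 <= _); last by apply: le_trans (expR_ge1Dx z); rewrite lerDl ltW.
  have -> : 1 = 1 `^ qexp :> R by rewrite powR1.
  by rewrite ge0_ler_powR ?nnegrE ?(ltW z0) ?(ltW qexp_gt0).
apply: le_trans (_ : z <= _).
  by rewrite -[leRHS]powRr1 ?(ltW z0)// ler_powR// ltW// qexp_lt1.
by apply: le_trans (expR_ge1Dx z); rewrite lerDr.
Qed.

(** With $z=c\,x^{2s}$ and $e^{-zr}\le(zr)^{-q}$, $q=1/(2s)$, the factor $z^{-q}$ supplies $x^{-1}$.
    The surplus decay $x^{-(2s-1)}$ makes high frequencies small. *)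
Lemma heat_kernel_le (x c d r : R) : 1 <= x -> 0 < c -> 0 < r -> c * x `^ (2 * s) <= d ->
  x ^+ 2 / d * expR (- (d * r)) <= c `^ (- (1 + qexp)) * x `^ (- (2 * s - 1)) * r `^ (- qexp).
Proof.
move=> x1 c0 r0 cd; have x0 : 0 < x by exact: lt_le_trans x1.
set z := c * x `^ (2 * s) in cd; have z0 : 0 < z by rewrite mulr_gt0// powR_gt0.
have d0 : 0 < d by exact: lt_le_trans cd.
apply: (@le_trans _ _ (x ^+ 2 / z * (z * r) `^ (- qexp))).
  apply: ler_pM; rewrite ?expR_ge0// ?divr_ge0 ?sqr_ge0 ?(ltW d0)//.
    by rewrite ler_wpM2l ?sqr_ge0// lef_pV2.
  apply: le_trans (expRN_le_powR (mulr_gt0 z0 r0)).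
  by rewrite ler_expR lerN2 ler_wpM2r// ltW.
rewrite powRM ?(ltW z0) ?(ltW r0)// mulrA ler_wpM2r ?powR_ge0// le_eqVlt; apply/orP; left; apply/eqP.
rewrite /z powRM ?(ltW c0) ?powR_ge0// -powRrM mulrN.
have -> : 2 * s * qexp = 1 by rewrite /qexp; field; move: s12; lra.
rewrite -[x ^+ 2]powR_mulrn ?(ltW x0)// invfM -!powRN -[c^-1]powR_inv1 ?(ltW c0)//.
have -> : c `^ (- (1 + qexp)) = c `^ (- 1) * c `^ (- qexp).
  by rewrite -powRD ?(gt_eqF c0) ?implybT// opprD.
have -> : x `^ (- (2 * s - 1)) = x `^ 2 * x `^ (- (2 * s)) * x `^ (-1).
  rewrite -!powRD ?(gt_eqF x0) ?implybT//; congr (_ `^ _); ring.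
by move: (x `^ 2) (c `^ (-1)) => X C; ring.
Qed.

(* A bounded primitive of a kernel that behaves like [r ^ (- qexp)] at 0, the
   singularity in Duhamel's formula; differentiating a quantity that contains it
   avoids singular integrals. *)
Definition time_kernel (L r : R) := (r / (1 + L * r)) `^ (1 - qexp) / (1 - qexp).

Let p0 : 0 < 1 - qexp.
Proof. by rewrite subr_gt0 qexp_lt1. Qed.

Lemma time_kernel_le (L r : R) : 0 < L -> 0 <= r ->
  0 <= time_kernel L r <= L `^ (- (1 - qexp)) / (1 - qexp).
Proof.
move=> L0 r0; have d0 : 0 < 1 + L * r by rewrite ltr_pwDl// mulr_ge0// ltW.
rewrite /time_kernel divr_ge0 ?powR_ge0 ?(ltW p0)//= ler_pM2r ?invr_gt0//.
have -> : L `^ (- (1 - qexp)) = L^-1 `^ (1 - qexp).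
  by rewrite -[L^-1]powR_inv1 ?(ltW L0)// -powRrM mulN1r.
rewrite ge0_ler_powR ?nnegrE ?invr_ge0 ?divr_ge0 ?(ltW d0) ?(ltW L0) ?(ltW p0)//.
by rewrite ler_pdivrMr// -(ler_pM2l L0) mulrA divff ?gt_eqF// mul1r lerDr.
Qed.

Lemma is_derive_time_kernel (L t x : R) : 0 < L -> x < t ->
  exists2 dG : R, is_derive x 1 (fun y => - time_kernel L (t - y)) dG &
    (t - x) `^ (- qexp) * expR (- (2 * L * (t - x))) <= dG.
Proof.
move=> L0 xt; set r := t - x; have r0 : 0 < r by rewrite subr_gt0.
have d0 : 0 < 1 + L * r by rewrite ltr_pwDl// mulr_ge0// ltW.
pose h y : R := (t - y) / (1 + L * (t - y)).
have hx : 0 < h x by rewrite divr_gt0.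
(* By the chain rule the derivative sought is $r^{-q}(1+Lr)^{q-2}$, with $q$ standing for [qexp];
   the lower bound follows from $1\le1+Lr\le e^{Lr}$. *)
have dh : is_derive x 1 h (- (1 + L * r) ^- 2).
  have dd : is_derive x 1 (fun y => 1 + L * (t - y) : R) (- L).
    by apply: trigger_derive; rewrite /GRing.scale /=; ring.
  have dn : is_derive x 1 (fun y => t - y : R) (-1).
    by apply: trigger_derive; rewrite /GRing.scale /=; ring.
  have hE : h = (fun y => t - y) * (fun y => (1 + L * (t - y))^-1) by apply/funext.
  rewrite hE; apply: is_derive_eq.
    apply: is_deriveM.
    by apply: is_deriveV; rewrite gt_eqF.
  rewrite /GRing.scale /= -/r; field; rewrite gt_eqF//.
exists (- ((1 - qexp)^-1 * ((1 - qexp) * h x `^ (1 - qexp - 1) * (- (1 + L * r) ^- 2)))).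
  have -> : (fun y => - time_kernel L (t - y)) =
     - ((1 - qexp)^-1 \*: ((fun z => z `^ (1 - qexp)) \o h)).
    by apply/funext => y; rewrite /time_kernel mulrC.
  apply: is_deriveN; apply: is_deriveZ.
  exact: (is_derive1_comp (is_derive1_powR (1 - qexp) hx) dh).
have -> : 1 - qexp - 1 = - qexp by ring.
have pE (p X W : R) : 0 < p -> - (p^-1 * (p * X * - W)) = X * W.
  by move=> p0'; field; rewrite gt_eqF.
rewrite pE//.
rewrite /h -/r powRM ?(ltW r0) ?invr_ge0 ?(ltW d0)// -[leRHS]mulrA ler_wpM2l ?powR_ge0//.
apply: le_trans (_ : (1 + L * r) ^- 2 <= _).
  rewrite expRN lef_pV2 ?posrE ?expR_gt0 ?exprn_gt0//.
  have -> : expR (2 * L * r) = expR (L * r) ^+ 2 by rewrite -expRM_natl; congr expR; rewrite -mulrA.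
  by rewrite ler_pXn2r ?nnegrE ?expR_ge0 ?(ltW d0)// expR_ge1Dx.
rewrite ler_peMl ?invr_ge0 ?exprn_ge0 ?(ltW d0)//.
rewrite -[(1 + L * r)^-1]powR_inv1 ?(ltW d0)// -powRrM mulN1r opprK.
by rewrite powR_ge1 ?(ltW qexp_gt0)// lerDl mulr_ge0// ltW.
Qed.

Lemma Re_young (z g : R[i]) (d : R) : 0 < d ->
  2 * complex.Re (conjc z * g) <= d * cn z ^+ 2 + cn g ^+ 2 / d.
Proof.
move=> d0; have h : complex.Re (conjc z * g) <= cn z * cn g.
  apply: le_trans (ler_norm _) _; apply: le_trans (Re_le_normc _) _.
  by rewrite ComplexField.Normc.normcM normc_conj.
apply: (@le_trans _ _ (2 * (cn z * cn g))); first by rewrite ler_pM2l.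
rewrite -subr_ge0; move: (cn z) (cn g) => p q.
have -> : d * p ^+ 2 + q ^+ 2 / d - 2 * (p * q) = (d * p - q) ^+ 2 / d by field; rewrite gt_eqF.
by rewrite divr_ge0 ?sqr_ge0// ltW.
Qed.

(** It decays like $L^{-(1-q)}$, where $q$ is [qexp]; this is what makes a large exponential weight
    in time contract. *)
Definition duhamel_const (c L : R) : R :=
  c `^ (- (1 + qexp)) * (L `^ (- (1 - qexp)) / (1 - qexp)).

Lemma duhamel_const_ge0 c L : 0 <= duhamel_const c L.
Proof. by rewrite mulr_ge0 ?powR_ge0// divr_ge0 ?powR_ge0 ?(ltW p0). Qed.

(** The energy at time $x$ is weighted by $e^{-d_k(t-x)}$. Differentiating, the weight gives back
    one of the two copies of $d_k|y_k|^2$ and the Young inequality uses the other, leaving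
    $|g_k|^2/d_k$ against the heat factor; this is at most a multiple of the derivative of
    [time_kernel]. *)
Lemma duhamel_bound (S : seq freq) (y g : R -> freq -> R[i]) (d : freq -> R)
    (c kap B L t : R) : 0 < c -> 0 < L -> 0 <= t -> 0 <= kap -> 0 <= B ->
  (forall k, k \in S -> k != 0 /\ `[k] `^ (- (2 * s - 1)) <= kap) ->
  (forall k, c * `[k] `^ (2 * s) <= d k) ->
  (forall k, continuous (fun t => complex.Re (y t k)) /\
             continuous (fun t => complex.Im (y t k))) ->
  (forall (x : R) k, 0 < x -> k \in S ->
      is_derive x 1 (fun t => complex.Re (y t k)) (complex.Re (- (d k)%:C * y x k + g x k)) /\
      is_derive x 1 (fun t => complex.Im (y t k)) (complex.Im (- (d k)%:C * y x k + g x k))) ->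
  (forall x, 0 < x < t -> \sum_(k <- S) `[k] `^ (2 * (a - 1)) * cn (g x k) ^+ 2 <=
     B * expR (2 * L * x)) ->
  \sum_(k <- S) `[k] `^ (2 * a) * cn (y t k) ^+ 2 <=
  \sum_(k <- S) `[k] `^ (2 * a) * cn (y 0 k) ^+ 2 +
    kap * B * duhamel_const c L * expR (2 * L * t).
Proof.
move=> c0 L0; rewrite le_eqVlt => /predU1P[<-|t0] kap0 B0 Sk cd yc yd gB.
  rewrite lerDl !mulr_ge0 ?expR_ge0 ?powR_ge0// invr_ge0 ltW//; exact: p0.
pose E k x := expR (- (d k * (t - x))).
pose Y x := \sum_(k <- S) `[k] `^ (2 * a) * cn (y x k) ^+ 2 * E k x.
pose K := kap * B * c `^ (- (1 + qexp)) * expR (2 * L * t).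
have K0 : 0 <= K by rewrite !mulr_ge0 ?powR_ge0 ?expR_ge0.
have Ed k (x : R) : is_derive x 1 (E k) (d k * E k x).
  by rewrite /E; apply: trigger_derive; rewrite /GRing.scale /=; ring.
have Ec k : continuous (E k) := continuous_is_derive (Ed k).
have dk0 k : k \in S -> 0 < d k.
  move=> /Sk[k0 _]; apply: lt_le_trans (cd k); rewrite mulr_gt0// powR_gt0//.
  exact: fnorm_gt0.
pose dY x := \sum_(k <- S) (`[k] `^ (2 * a) * cn (y x k) ^+ 2 * (d k * E k x) +
   E k x * (`[k] `^ (2 * a) * (2 * complex.Re (conjc (y x k) * (- (d k)%:C * y x k + g x k))))).
have Yd (x : R) : 0 < x -> is_derive x 1 Y (dY x).
  move=> x0; apply: is_derive_big => k kS; have [dr di] := yd x k x0 kS.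
  exact: is_deriveM (is_derive_normc_sqr (`[k] `^ (2 * a)) dr di) (Ed k x).
have Yc : continuous Y.
  apply: continuous_sum_seq => k.
  have [cr ci] := yc k.
  have wc : continuous (fun x => `[k] `^ (2 * a) * cn (y x k) ^+ 2).
    move=> x; apply: cvgM; first exact: cvg_cst.
    under eq_fun do rewrite normc_sqr.
    rewrite normc_sqr; apply: cvgD; apply: cvgM; [exact: cr|exact: cr|exact: ci|exact: ci].
  by move=> x; exact: (cvgM (wc x) (Ec k x)).
have dYle x : 0 < x < t -> dY x <= K * ((t - x) `^ (- qexp) * expR (- (2 * L * (t - x)))).
  move=> /andP[x0 xt]; have r0 : 0 < t - x by rewrite subr_gt0.
  apply: (@le_trans _ _ (\sum_(k <- S) kap * c `^ (- (1 + qexp)) * (t - x) `^ (- qexp) *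
       (`[k] `^ (2 * (a - 1)) * cn (g x k) ^+ 2))).
    rewrite /dY big_seq [leRHS]big_seq; apply: ler_sum => k kS.
    have [k0 kk] := Sk k kS; have k1 : 1 <= `[k] by exact: fnorm_ge1.
    have kp : 0 < `[k] by exact: lt_le_trans k1.
    rewrite mulrDr Re_addc Re_conj_realM.
    have h1 := Re_young (y x k) (g x k) (dk0 k kS).
    have h2 := heat_kernel_le k1 c0 r0 (cd k).
    have kE : `[k] `^ (2 * a) = `[k] `^ (2 * (a - 1)) * `[k] ^+ 2.
      rewrite -powR_mulrn ?(ltW kp)// -powRD ?(gt_eqF kp) ?implybT//; congr (_ `^ _); ring.
    apply: (@le_trans _ _ (`[k] `^ (2 * a) * E k x * (cn (g x k) ^+ 2 / d k))).
      have P0 : 0 <= `[k] `^ (2 * a) * E k x by rewrite mulr_ge0 ?powR_ge0 ?expR_ge0.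
      have := ler_wpM2l P0 h1.
      move: (`[k] `^ (2 * a)) (E k x) (cn (y x k) ^+ 2) (complex.Re _) (cn (g x k) ^+ 2 / d k) (d k).
      by clear; move=> A E X Y G D; lra.
    rewrite kE.
    have -> : `[k] `^ (2 * (a - 1)) * `[k] ^+ 2 * E k x * (cn (g x k) ^+ 2 / d k) =
       `[k] ^+ 2 / d k * E k x * (`[k] `^ (2 * (a - 1)) * cn (g x k) ^+ 2) by ring.
    apply: ler_wpM2r; first by rewrite mulr_ge0 ?powR_ge0 ?sqr_ge0.
    apply: (le_trans h2); apply: ler_wpM2r; first exact: powR_ge0.
    by rewrite mulrC ler_wpM2r ?powR_ge0.
  rewrite -mulr_sumr.
  apply: (@le_trans _ _ (kap * c `^ (- (1 + qexp)) * (t - x) `^ (- qexp) * (B * expR (2 * L * x)))).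
    by rewrite ler_wpM2l ?mulr_ge0 ?powR_ge0// gB// x0.
  have -> : expR (2 * L * x) = expR (2 * L * t) * expR (- (2 * L * (t - x))).
    by rewrite -expRD; congr expR; ring.
  by rewrite le_eqVlt /K; apply/orP; left; apply/eqP; ring.
have tk_c x : x < t -> {for x, continuous (fun y => time_kernel L (t - y))}.
  move=> xt; have [dG [dd _] _] := is_derive_time_kernel L0 xt.
  have := differentiable_continuous (f := fun y => - time_kernel L (t - y)) (x := x).
  move=> /(_ ltac:(exact/derivable1_diffP)) /(@cvgN _ _ _ _ _ _ _).
  move=> h.
  rewrite (_ : (fun y => time_kernel L (t - y)) = - (fun y => - time_kernel L (t - y))); last first.
    by apply/funext => z; exact/esym/opprK.
  exact: h.
(* The derivative bound is singular at $x=t$, so the comparison stops before $t$ and the endpoint is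
   reached by continuity of [Y]. *)
have Yle x : 0 <= x < t -> Y x <= Y 0 + K * (L `^ (- (1 - qexp)) / (1 - qexp)).
  move=> /andP[x0 xt].
  have dGk z : exists dG : R, z < t -> is_derive z 1 (fun y => - time_kernel L (t - y)) dG /\
    (t - z) `^ (- qexp) * expR (- (2 * L * (t - z))) <= dG.
    have [zt|tz] := ltP z t; last by exists 0.
    by have [dG h1 h2] := is_derive_time_kernel L0 zt; exists dG.
  pose dG z := projT1 (cid (dGk z)).
  have dGP z : z < t -> is_derive z 1 (fun y => - time_kernel L (t - y)) (dG z) /\
    (t - z) `^ (- qexp) * expR (- (2 * L * (t - z))) <= dG z.
    by rewrite /dG; case: cid.
  have := @le_of_derive R (fun z => Y z + - (K * - time_kernel L (t - z)))
    (fun z => dY z + - (K * dG z)) 0 x x0.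
  have H1 z : 0 < z < x -> is_derive z 1 (fun z => Y z + - (K * - time_kernel L (t - z))) (dY z + - (K * dG z)).
    move=> /andP[z0 zx]; have [h1 _] := dGP z (lt_trans zx xt).
    exact: is_deriveD (Yd z z0) (is_deriveN (is_deriveZ K h1)).
  have H2 z : 0 < z < x -> dY z + - (K * dG z) <= 0.
    move=> /andP[z0 zx]; have zt := lt_trans zx xt; have [_ h2] := dGP z zt.
    by rewrite subr_le0; apply: le_trans (dYle z _) _; [rewrite z0|rewrite ler_wpM2l].
  have H3 : {within `[0, x], continuous (fun z => Y z + - (K * - time_kernel L (t - z)))}.
    apply: continuous_in_subspaceT => z; rewrite inE /= in_itv /= => /andP[_ zx].
    apply: cvgD; first exact: Yc.
    apply: cvgN; apply: cvgM; first exact: cvg_cst.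
    by apply: cvgN; apply: tk_c; exact: le_lt_trans zx xt.
  move=> /(_ H1 H2 H3); rewrite !mulrN !opprK.
  have /andP[_ h0] := time_kernel_le L0 (ltW t0).
  have /andP[hx _] := time_kernel_le L0 (ltW (ltac:(by rewrite subr_gt0) : 0 < t - x)).
  rewrite subr0 => h; move: (ler_wpM2l K0 h0) (mulr_ge0 K0 hx) h; lra.
have YtE : Y t = \sum_(k <- S) `[k] `^ (2 * a) * cn (y t k) ^+ 2.
  by apply: eq_bigr => k _; rewrite /E subrr mulr0 oppr0 expR0 mulr1.
have Y0le : Y 0 <= \sum_(k <- S) `[k] `^ (2 * a) * cn (y 0 k) ^+ 2.
  rewrite /Y big_seq [leRHS]big_seq; apply: ler_sum => k kS.
  apply: ler_piMr; first by rewrite mulr_ge0 ?powR_ge0 ?sqr_ge0.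
  rewrite /E -[leRHS]expR0 ler_expR oppr_le0 subr0.
  by rewrite mulr_ge0 ?(ltW t0) ?(ltW (dk0 _ kS)).
rewrite -YtE; apply/ler_addgt0Pr => e e0.
have /cvgrPdist_le/(_ e e0) := Yc t.
case/nbhs_ballP => rad /= rad0 hrad.
pose x := Num.max 0 (t - rad / 2).
have xt : x < t by rewrite gt_max t0 /= ltrBlDr ltrDl divr_gt0.
have x0 : 0 <= x by rewrite le_max lexx.
have : ball t rad x.
  rewrite /ball /= ger0_norm ?subr_ge0 ?(ltW xt)//.
  have : t - rad / 2 <= x by rewrite le_max lexx orbT.
  move: rad0; lra.
move=> /hrad /=; rewrite ler_norml => /andP[_ h].
have hx : Y x <= Y 0 + K * (L `^ (- (1 - qexp)) / (1 - qexp)) by apply: Yle; rewrite x0.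
have -> : kap * B * duhamel_const c L * expR (2 * L * t) = K * (L `^ (- (1 - qexp)) / (1 - qexp)).
  by rewrite /K /duhamel_const; ring.
move: h hx Y0le; lra.
Qed.

End duhamel.

Section limits.
Context {R : realType}.

Lemma cauchy_limit (u r : nat -> R) :
  (forall n m, (n <= m)%N -> `|u m - u n| <= r n) ->
  exists l, forall n, `|l - u n| <= r n.
Proof.
move=> hu; have r0 n : 0 <= r n by apply: le_trans (hu n n (leqnn n)).
pose S := [set x : R | exists n, x = u n - r n].
have ub n : ubound S (u n + r n).
  move=> _ [m ->]; have [nm|/ltnW mn] := leqP n m.
    have := hu _ _ nm; rewrite ler_norml => /andP[_]; have := r0 m; lra.
  have := hu _ _ mn; rewrite ler_norml => /andP[+ _]; have := r0 n; lra.
have S0 : S !=set0 by exists (u 0%N - r 0%N), 0%N.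
exists (sup S) => n; rewrite ler_norml; apply/andP; split.
  have : u n - r n <= sup S.
    by apply: ub_le_sup; [exists (u 0%N + r 0%N); exact: ub|exists n].
  lra.
have : sup S <= u n + r n by exact: ge_sup.
lra.
Qed.

Lemma small_geometric (D e : R) : 0 < e -> exists N, forall n, (N <= n)%N -> D / 2 ^+ n <= e.
Proof.
move=> e0.
have /cvgrPdist_le /(_ _ e0) [N _ HN] : (fun n => D / 2 ^+ n) @ \oo --> (0 : R).
  have -> : (fun n => D / 2 ^+ n) = geometric D 2^-1.
    by apply/funext => n; rewrite /geometric /= exprVn.
  by apply: cvg_geometric; rewrite ger0_norm// invf_lt1// ltr1n.
exists N => n /HN /=; rewrite sub0r normrN; apply: le_trans; exact: ler_norm.
Qed.

Lemma eq_geometric (x y D : R) (N : nat) :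
  (forall n, (N <= n)%N -> `|x - y| <= D / 2 ^+ n) -> x = y.
Proof.
move=> h; apply/eqP; rewrite -subr_eq0 -normr_le0; apply/ler_addgt0Pl => e e0.
have [M hM] := small_geometric D e0; rewrite addr0.
by apply: le_trans (h (maxn N M) (leq_maxl _ _)) _; rewrite hM// leq_maxr.
Qed.

Lemma prim_derive (y dy : R -> R) t : continuous y -> continuous dy ->
  (forall x : R, 0 < x -> is_derive x 1 y (dy x)) -> 0 <= t ->
  y t = y 0 + prim dy t.
Proof.
move=> yc dc yd t0.
have h1 : y t - prim dy t <= y 0 - prim dy 0.
  apply: (@le_of_derive _ (fun x => y x - prim dy x) (fun x => dy x - dy x)) => //.
  - move=> x /andP[x0 _]; apply: is_deriveB; [exact: yd|exact: is_derive_prim].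
  - by move=> x _; rewrite subrr.
  - by apply: continuous_subspaceT => x; apply: cvgB; [exact: yc|exact: continuous_prim].
have h2 : prim dy t - y t <= prim dy 0 - y 0.
  apply: (@le_of_derive _ (fun x => prim dy x - y x) (fun x => dy x - dy x)) => //.
  - move=> x /andP[x0 _]; apply: is_deriveB; [exact: is_derive_prim|exact: yd].
  - by move=> x _; rewrite subrr.
  - by apply: continuous_subspaceT => x; apply: cvgB; [exact: continuous_prim|exact: yc].
rewrite prim0 in h1 h2; lra.
Qed.

(** The differential equation passes to the limit in integrated form; the weight $e^{Lt}$ makes the
    convergence uniform on bounded intervals. *)
Lemma limit_derive (x F : nat -> R -> R) (y G : R -> R) (c D L : R) (N : nat) :
  0 < L -> 0 <= D -> (forall i, (N <= i)%N -> [/\ continuous (x i), continuous (F i),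
    forall t : R, 0 < t -> is_derive t 1 (x i) (F i t),
    x i 0 = c & forall t, 0 < t -> `|x i t - y t| <= D / 2 ^+ i * expR (L * t) /\
       `|F i t - G t| <= D / 2 ^+ i * expR (L * t)]) ->
  continuous G -> (forall t, t <= 0 -> y t = c) ->
  forall t : R, 0 < t -> is_derive t 1 y (G t).
Proof.
move=> L0 D0 H Gc y0 t t0.
suff -> : y = cst c + prim G.
  by rewrite -[G t]add0r; apply: is_deriveD; exact: is_derive_prim.
apply/funext => r; have -> : (cst c + prim G) r = c + prim G r by [].
have [r0|r0] := leP r 0.
  rewrite y0//; move: r0; rewrite le_eqVlt => /predU1P[->|r0]; rewrite ?prim0 ?addr0//.
  by rewrite prim_lt0// addr0.
apply: (@eq_geometric _ _ ((D + D / L) * expR (L * r)) N) => n Nn.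
have [xc Fc xd x0 xy] := H n Nn.
have [h1 _] := xy r r0.
have h2 : `|prim (F n) r - prim G r| <= D / 2 ^+ n / L * expR (L * r).
  rewrite primB//; apply: prim_exp_bound => //.
  - by move=> z; apply: cvgB; [exact: Fc|exact: Gc].
  - exact: ltW.
  - by rewrite divr_ge0 ?exprn_ge0.
  - by move=> z /andP[z0 _]; have [_] := xy z z0.
have xE := prim_derive xc Fc xd (ltW r0); rewrite x0 in xE.
have -> : y r - (c + prim G r) = - (x n r - y r) + (prim (F n) r - prim G r) by rewrite xE; ring.
apply: le_trans (ler_normD _ _) _; rewrite normrN.
have -> : (D + D / L) * expR (L * r) / 2 ^+ n =
  D / 2 ^+ n * expR (L * r) + D / 2 ^+ n / L * expR (L * r) by ring.
exact: lerD.
Qed.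

End limits.

Lemma expR_ge1 {R : realType} (x : R) : 0 <= x -> 1 <= expR x.
Proof. by move=> x0; rewrite -[leLHS]expR0 ler_expR. Qed.

(** * Tail bounds and stability for the equation of $v$ *)

Section evolution.
Context {R : realType}.
Variables (a s c : R) (dl : R -> R) (dd : freq -> R).
Hypotheses (a1 : 1 < a) (a2 : a <= 2) (as_ : a <= 2 * s) (s1 : s <= 1) (c0 : 0 < c)
  (dlc : continuous dl) (dl0 : forall t, 0 <= dl t)
  (ddN : forall k, dd (- k) = dd k) (ddc : forall k, c * (@fnorm R k) `^ (2 * s) <= dd k).
Local Notation "`[ k ]" := (@fnorm R k).

Let s12 : 2^-1 < s.
Proof. move: a1 as_; lra. Qed.

Let s0 : 0 < s.
Proof. move: s12; lra. Qed.

Definition evol_rhs (v : R -> coeffs R) t k : R[i] :=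
  - (dd k)%:C * v t k - nl s (dl t) (v t) (v t) k.

(* The equation satisfied by [v t = e^{phi(t) |\nabla|^s} u t]. *)
Definition evolves (D : pred freq) (v : R -> coeffs R) := forall (t : R) k, 0 < t -> D k ->
  is_derive t 1 (fun t => complex.Re (v t k)) (complex.Re (evol_rhs v t k)) /\
  is_derive t 1 (fun t => complex.Im (v t k)) (complex.Im (evol_rhs v t k)).

Definition componentwise_continuous (v : R -> coeffs R) := forall k,
  continuous (fun t => complex.Re (v t k)) /\ continuous (fun t => complex.Im (v t k)).

Definition trajectory (X : R) (v : R -> coeffs R) :=
  [/\ componentwise_continuous v, forall t, v t 0 = 0 & forall t, Hle a X (v t)].

(** The surplus smoothing $|k|^{-(2s-1)}$ bounds high modes by the initial tail plus a small
    multiple of a constant. [M] depends on neither [D] nor [v], so the bound is uniform in the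
    truncation. *)
Lemma evol_tail X : 0 <= X -> exists2 M, 0 <= M & forall D v,
  trajectory X v -> evolves D v -> (forall t k, ~~ D k -> v t k = 0) ->
  forall (kap t : R) (S : seq freq), uniq S -> 0 <= t -> 0 <= kap ->
   (forall k, k \in S -> k != 0 /\ `[k] `^ (- (2 * s - 1)) <= kap) ->
   \sum_(k <- S) `[k] `^ (2 * a) * cn (v t k) ^+ 2 <=
   \sum_(k <- S) `[k] `^ (2 * a) * cn (v 0 k) ^+ 2 + kap * M * expR (2 * t).
Proof.
move=> X0; have [C [C0 HC]] := nl_bound a1 a2 s0 s1.
have B0 : 0 <= C * (X * X) by rewrite mulr_ge0 ?(ltW C0)// mulr_ge0.
exists (C * (X * X) * duhamel_const s c 1); first by rewrite mulr_ge0// duhamel_const_ge0.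
move=> D v [vc v0 vX] vD vsupp kap t S uS t0 kap0 Sk; pose S1 := [seq k <- S | D k].
have -> : \sum_(k <- S) `[k] `^ (2 * a) * cn (v t k) ^+ 2 =
    \sum_(k <- S1) `[k] `^ (2 * a) * cn (v t k) ^+ 2.
  rewrite big_filter (bigID D)/= [X in _ + X]big1 ?addr0// => k /vsupp ->.
  by rewrite /= expr0n /= addr0 sqrtr0 expr0n mulr0.
have h := @duhamel_bound R a s s12 S1 v (fun t k => - nl s (dl t) (v t) (v t) k) dd c kap
  (C * (X * X)) 1 t c0 ltr01 t0 kap0 B0 _ ddc vc.
apply: le_trans (h _ _ _) _.
- by move=> k; rewrite mem_filter => /andP[_ /Sk].
- by move=> x k x0; rewrite mem_filter => /andP[Dk _]; exact: vD.
- move=> x /andP[x0 _].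
  under eq_bigr do rewrite normcN.
  apply: le_trans (HC _ _ _ _ _ (dl0 x) (v0 x) (v0 x) (vX x) (vX x) _ _) _.
    exact: filter_uniq.
  by rewrite ler_peMr// expR_ge1// mulr_ge0// ltW.
rewrite mulr1 !mulrA lerD2r; apply: ler_sum_sub; rewrite ?filter_uniq//.
  by move=> k; rewrite mulr_ge0 ?powR_ge0 ?sqr_ge0.
by move=> k; rewrite mem_filter => /andP[].
Qed.

Lemma exists_contraction_rate (M : R) : 0 <= M ->
  exists2 L, 1 <= L & M * duhamel_const s c L <= 2^-1.
Proof.
move=> M0; have p0 : 0 < 1 - qexp s by rewrite subr_gt0 qexp_lt1.
pose K := M * (c `^ (- (1 + qexp s)) / (1 - qexp s)).
have K0 : 0 <= K by rewrite mulr_ge0// divr_ge0 ?powR_ge0 ?(ltW p0).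
have K1 : 1 <= 1 + 2 * K by rewrite lerDl mulr_ge0.
exists ((1 + 2 * K) `^ (1 - qexp s)^-1); first by rewrite powR_ge1// invr_ge0 ltW.
have -> : M * duhamel_const s c ((1 + 2 * K) `^ (1 - qexp s)^-1) = K / (1 + 2 * K).
  rewrite /duhamel_const -powRrM mulrN mulVf ?(gt_eqF p0)// powR_inv1 ?(le_trans ler01)//.
  by rewrite /K; move: (_ `^ _) (_^-1) (_^-1) => *; ring.
rewrite ler_pdivrMr; last exact: lt_le_trans K1.
by rewrite mulrDr mulr1 mulrA mulVf ?pnatr_eq0// mul1r lerDr invr_ge0.
Qed.

(* Each application of the Duhamel bound halves the distance of [v] and [w] in
   the norm with weight [expR (- L * t)]. *)
Lemma stability X : 0 <= X -> exists2 L, 1 <= L & forall (P : pred freq) e v w,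
  trajectory X v -> trajectory X w -> evolves P v -> evolves P w -> 0 <= e ->
  (forall S, uniq S -> (forall k, k \in S -> P k) ->
     \sum_(k <- S) `[k] `^ (2 * a) * cn (v 0 k - w 0 k) ^+ 2 <= e) ->
  (forall t S, 0 <= t -> uniq S -> (forall k, k \in S -> k != 0 /\ ~~ P k) ->
     \sum_(k <- S) `[k] `^ (2 * a) * cn (v t k - w t k) ^+ 2 <= e * expR (2 * L * t)) ->
  forall t, 0 <= t -> Hle a (4 * e * expR (2 * L * t)) (v t \- w t).
Proof.
move=> X0; have [C [C0 HC]] := nl_diff_bound a1 a2 s0 s1.
have CX0 : 0 <= C * X by rewrite mulr_ge0// ltW.
have [L L1 LE] := exists_contraction_rate CX0.
have Lp : 0 < L by exact: lt_le_trans L1.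
exists L => // P e v w [vc v0 vX] [wc w0 wX] vP wP e0 He Hout.
(* The solution of $B_{i+1}=\frac12B_i+2e$. The errors at time 0 on [P] and outside [P] contribute
   $e$ each; the first term is the trivial bound from the sizes of $v$ and $w$. *)
pose B i := 4 * X / 2 ^+ i + 4 * e.
have eL t : 0 <= t -> 1 <= expR (2 * L * t).
  by move=> t0; apply: expR_ge1; rewrite mulr_ge0// mulr_ge0// ltW.
have B0 i : 0 <= B i by rewrite addr_ge0 ?divr_ge0 ?exprn_ge0 ?mulr_ge0.
have step i t : 0 <= t -> Hle a (B i * expR (2 * L * t)) (v t \- w t).
  elim: i t => [|i IH] t t0.
    apply: Hle_wk (HleB (vX t) (wX t)); rewrite /B expr0 divr1.
    have := ler_wpM2l (B0 0) (eL t t0); rewrite /B expr0 divr1 mulr1 => h.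
    by apply: le_trans h; rewrite -mulrDl -mulrDr; move: e0; lra.
  move=> S uS; pose S0 := [seq k <- S | k != 0]; have uS0 := filter_uniq (fun k : freq => k != 0) uS.
  have -> : \sum_(k <- S) `[k] `^ (2 * a) * cn ((v t \- w t) k) ^+ 2 =
      \sum_(k <- S0) `[k] `^ (2 * a) * cn (v t k - w t k) ^+ 2.
    rewrite big_filter (bigID (fun k : freq => k != 0))/= [X in _ + X]big1 ?addr0// => k /negPn/eqP ->.
    by rewrite v0 w0 subrr /= expr0n /= addr0 sqrtr0 expr0n mulr0.
  rewrite (bigID P)/= -big_filter -[X in _ + X]big_filter.
  set S1 := [seq k <- S0 | P k]; set S2 := [seq k <- S0 | ~~ P k].
  have S1P k : k \in S1 -> k != 0 /\ P k.
    by rewrite mem_filter => /andP[Pk]; rewrite mem_filter => /andP[].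
  have h2 : \sum_(k <- S2) `[k] `^ (2 * a) * cn (v t k - w t k) ^+ 2 <= e * expR (2 * L * t).
    apply: Hout; rewrite ?filter_uniq// => k; rewrite mem_filter => /andP[Pk].
    by rewrite mem_filter => /andP[].
  have yc : componentwise_continuous (fun t => v t \- w t).
    move=> k; have [vr vi] := vc k; have [wr wi] := wc k; split=> /=.
      by under eq_fun do rewrite Re_subc; move=> z; apply: cvgB; [exact: vr|exact: wr].
    by under eq_fun do rewrite Im_subc; move=> z; apply: cvgB; [exact: vi|exact: wi].
  have h1 := @duhamel_bound R a s s12 S1 (fun t => v t \- w t)
    (fun t k => - (nl s (dl t) (v t) (v t) k - nl s (dl t) (w t) (w t) k)) dd c 1
    (C * (X * B i)) L t c0 Lp t0 ler01 (mulr_ge0 (ltW C0) (mulr_ge0 X0 (B0 i))) _ ddc yc.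
  have {}h1 : \sum_(k <- S1) `[k] `^ (2 * a) * cn (v t k - w t k) ^+ 2 <=
     e + (C * (X * B i)) * duhamel_const s c L * expR (2 * L * t).
    apply: le_trans (h1 _ _ _) _.
    - move=> k /S1P[k0 _]; split => //; rewrite powRN invf_le1 ?powR_gt0 ?fnorm_gt0//.
      by rewrite powR_ge1 ?fnorm_ge1//; move: s12; lra.
    - move=> x k x0 /S1P[_ Pk]; have [vr vi] := vP x k x0 Pk; have [wr wi] := wP x k x0 Pk.
      have E : - (dd k)%:C * (v x k - w x k) +
         - (nl s (dl x) (v x) (v x) k - nl s (dl x) (w x) (w x) k) =
         evol_rhs v x k - evol_rhs w x k by rewrite /evol_rhs; ring.
      rewrite [(_ \- _) _]/(v x k - w x k) E Re_subc Im_subc; split.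
        rewrite (_ : (fun _ => _) = (fun t => complex.Re (v t k)) - (fun t => complex.Re (w t k))).
          exact: is_deriveB.
        by apply/funext => z; rewrite /= Re_subc.
      rewrite (_ : (fun _ => _) = (fun t => complex.Im (v t k)) - (fun t => complex.Im (w t k))).
        exact: is_deriveB.
      by apply/funext => z; rewrite /= Im_subc.
    - move=> x /andP[x0 _]; under eq_bigr do rewrite normcN.
      have := HC _ _ _ _ _ (dl0 x) (v0 x) (w0 x) (vX x) (wX x) (IH x (ltW x0)) S1.
      by rewrite !mulrA; apply; rewrite !filter_uniq.
    by rewrite mul1r lerD2r; apply: He; rewrite ?filter_uniq// => k /S1P[].
  apply: le_trans (lerD h1 h2) _.
  have hB : C * (X * B i) * duhamel_const s c L * expR (2 * L * t) <= 2^-1 * B i * expR (2 * L * t).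
    rewrite ler_wpM2r ?expR_ge0//.
    have -> : C * (X * B i) * duhamel_const s c L = C * X * duhamel_const s c L * B i by ring.
    by rewrite ler_wpM2r.
  have he : e <= e * expR (2 * L * t) by rewrite ler_peMr// eL.
  have -> : B i.+1 * expR (2 * L * t) = 2^-1 * B i * expR (2 * L * t) + 2 * e * expR (2 * L * t).
    rewrite /B exprS; move: (2 ^+ i) (expf_neq0 i (lt0r_neq0 (ltr0Sn R 1))) => Y Y0; field.
    exact: Y0.
  move: hB he; lra.
move=> t t0 S uS; apply/ler_addgt0Pr => e' e'0.
have [N HN] := small_geometric (4 * X * expR (2 * L * t)) e'0.
apply: le_trans (step N t t0 S uS) _.
rewrite /B mulrDl addrC lerD2l -mulrAC; exact: HN.
Qed.

End evolution.

Section wellposedness.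
Context {R : realType}.
Variables (a s c : R) (dl : R -> R) (dd : freq -> R).
Hypotheses (a1 : 1 < a) (a2 : a <= 2) (as_ : a <= 2 * s) (s1 : s <= 1) (c0 : 0 < c)
  (dlc : continuous dl) (dl0 : forall t, 0 <= dl t)
  (ddN : forall k, dd (- k) = dd k) (ddc : forall k, c * (@fnorm R k) `^ (2 * s) <= dd k).
Local Notation "`[ k ]" := (@fnorm R k).
Local Notation evolves := (evolves s dl dd).
Local Notation trajectory := (trajectory a).

Let s12 : 2^-1 < s.
Proof. move: a1 as_; lra. Qed.

Let s0 : 0 < s.
Proof. by apply: lt_trans s12; rewrite invr_gt0. Qed.

Lemma evol_unique X v w : trajectory X v -> trajectory X w ->
  evolves predT v -> evolves predT w -> (forall k, v 0 k = w 0 k) ->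
  forall t k, 0 <= t -> v t k = w t k.
Proof.
move=> vX wX vE wE vw t k t0; have [_ v0 vX'] := vX; have [_ w0 _] := wX.
have X0 : 0 <= X := sumle_ge0 (vX' 0).
have [L _ H] := stability a1 a2 as_ s1 c0 dl0 ddc X0.
have [->|k0] := eqVneq k 0; first by rewrite v0 w0.
have {}H := H predT 0 v w vX wX vE wE (lexx 0).
have h : Hle a 0 (v t \- w t).
  have := H _ _ t t0; rewrite mulr0 mul0r; apply.
    by move=> S _ _; rewrite big1// => j _; rewrite vw subrr /= expr0n /= addr0 sqrtr0 expr0n mulr0.
  move=> r S _ _ Sk; rewrite mul0r big_seq big1// => j /Sk[_]; by [].
have := Hle_normc k0 (le_trans ler01 (ltW a1)) h; rewrite sqrtr0 => h0.
apply/eqP; rewrite -subr_eq0; apply/eqP; apply: ComplexField.Normc.eq0_normc.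
by apply/eqP; rewrite eq_le h0 normc_ge0.
Qed.

Lemma normc_sqrD_le (x y : R[i]) : cn (x + y) ^+ 2 <= 2 * cn x ^+ 2 + 2 * cn y ^+ 2.
Proof.
apply: (@le_trans _ _ ((cn x + cn y) ^+ 2)).
  by rewrite ler_pXn2r ?nnegrE ?addr_ge0 ?normc_ge0// ler_normcD.
rewrite -subr_ge0; move: (cn x) (cn y) => p q.
have -> : 2 * p ^+ 2 + 2 * q ^+ 2 - (p + q) ^+ 2 = (p - q) ^+ 2 by ring.
exact: sqr_ge0.
Qed.

Lemma conjcB (x y : R[i]) : conjc (x - y) = conjc x - conjc y.
Proof. exact: rmorphB. Qed.

Lemma ceq_geometric (x y : R[i]) (D : R) (N : nat) :
  (forall n, (N <= n)%N -> cn (x - y) <= D / 2 ^+ n) -> x = y.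
Proof.
move=> h; apply/eqP; rewrite eq_complex; apply/andP; split; apply/eqP;
  apply: (@eq_geometric _ _ _ D N) => n /h; apply: le_trans.
  by rewrite -Re_subc; exact: Re_le_normc.
by rewrite -Im_subc; exact: Im_le_normc.
Qed.

Lemma Hcont_componentwise p (y : R -> coeffs R) : 0 <= p -> (forall t, y t 0 = 0) ->
  Hcont p y -> componentwise_continuous y.
Proof.
move=> p0 y0 yc k.
suff H (t e : R) : 0 < e -> \forall r \near t, cn (y t k - y r k) <= e.
  split=> t; apply/cvgrPdist_le => e /(H t); apply: filterS => r; apply: le_trans.
    by rewrite -Re_subc; exact: Re_le_normc.
  by rewrite -Im_subc; exact: Im_le_normc.
move=> e0; have [->|k0] := eqVneq k 0.
  by near=> r; rewrite !y0 subrr /= expr0n /= addr0 sqrtr0; exact: ltW.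
have := yc t (e ^+ 2) (exprn_gt0 2 e0); apply: filterS => r h.
have := Hle_normc k0 p0 h; rewrite sqrtr_sqr (ger0_norm (ltW e0)).
by rewrite /= -normcN opprB.
Unshelve. all: by end_near. Qed.

Lemma Hle_finite (S : seq freq) (p X : R) f : uniq S -> (forall k, k \notin S -> f k = 0) ->
  \sum_(k <- S) `[k] `^ (2 * p) * cn (f k) ^+ 2 <= X -> Hle p X f.
Proof.
move=> uS fS fX S' uS'; apply: le_trans fX.
rewrite (bigID (mem S))/= [X in _ + X]big1 ?addr0; last first.
  by move=> k /fS ->; rewrite /= expr0n /= addr0 sqrtr0 expr0n mulr0.
rewrite -big_filter; apply: ler_sum_sub; rewrite ?filter_uniq//.
  by move=> k; rewrite mulr_ge0 ?powR_ge0 ?sqr_ge0.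
by move=> k; rewrite mem_filter => /andP[].
Qed.

Lemma Hcont_finite (S : seq freq) p (y : R -> coeffs R) : uniq S ->
  componentwise_continuous y -> (forall t k, k \notin S -> y t k = 0) -> Hcont p y.
Proof.
move=> uS yc yS t e e0.
pose g r := \sum_(k <- S) `[k] `^ (2 * p) * cn (y r k - y t k) ^+ 2.
have gc : continuous g.
  apply: continuous_sum_seq => k; have [cr ci] := yc k.
  move=> x; apply: cvgM; first exact: cvg_cst.
  under eq_fun do rewrite normc_sqr Re_subc Im_subc !expr2.
  rewrite normc_sqr Re_subc Im_subc !expr2.
  by apply: cvgD; apply: cvgM; apply: cvgB; rewrite ?cvg_cst//; [exact: cr|exact: cvg_cst|exact: cr|exact: cvg_cst|exact: ci|exact: cvg_cst|exact: ci|exact: cvg_cst].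
have gt0 : g t = 0.
  by rewrite /g big1// => k _; rewrite subrr /= expr0n /= addr0 sqrtr0 expr0n mulr0.
have /cvgrPdist_le/(_ e e0) := gc t.
apply: filterS => r; rewrite gt0 sub0r normrN => h.
apply: (Hle_finite uS); first by move=> k kS; rewrite /= !yS// subrr.
exact: le_trans (ler_norm _) h.
Qed.

(** The box is large enough for two purposes: to contain the finite set carrying most of $v_0$, and
    to make the surplus decay of the heat kernel small outside. The sum of the sup norms is a crude
    bound for their maximum. *)
Lemma tail_box (v0 : coeffs R) X (e : R) : Hle a X v0 -> 0 < e -> exists n,
  (forall S, uniq S -> (forall k, k \in S -> k \notin box n) ->
    \sum_(k <- S) `[k] `^ (2 * a) * cn (v0 k) ^+ 2 <= e) /\
  (forall k, k != 0 -> k \notin box n -> `[k] `^ (- (2 * s - 1)) <= e).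
Proof.
move=> vX e0.
have F0 k : 0 <= `[k] `^ (2 * a) * cn (v0 k) ^+ 2 by rewrite mulr_ge0 ?powR_ge0 ?sqr_ge0.
have vX' : sumle (fun k => `| `[k] `^ (2 * a) * cn (v0 k) ^+ 2|) X.
  by apply: sumleW vX => k; rewrite ger0_norm.
have [S0 [uS0 tail]] := sumle_tail e0 vX'.
have p0 : 0 < 2 * s - 1 by move: s12; lra.
pose y := e^-1 `^ (2 * s - 1)^-1.
have [n1 Hn1] : exists n1 : nat, y <= n1%:R.
  by exists (Num.bound y); apply/ltW/archi_boundP; exact: powR_ge0.
pose n2 := (\sum_(k <- S0) supnorm k)%N.
exists (maxn n1 n2); split.
  move=> S uS Sn; have [uS' Sk] : uniq [seq k <- S | k != 0] /\ True by split; rewrite ?filter_uniq.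
  rewrite (bigID (fun k : freq => k != 0))/= [X in _ + X]big1 ?addr0; last first.
    move=> k /negPn/eqP ->; rewrite fnorm0 powR0 ?mul0r// mulf_neq0 ?pnatr_eq0//.
    by rewrite gt_eqF// (lt_trans ltr01).
  rewrite -big_filter; apply: le_trans (tail _ uS'); rewrite big_seq [leRHS]big_seq.
  apply: ler_sum => k; rewrite mem_filter => /andP[k0 /Sn].
  rewrite mem_box k0 /= -ltnNge => kn.
  case: ifP => kS0; last by rewrite ger0_norm.
  move: kn; rewrite ltnNge => /negP[]; rewrite (leq_trans _ (leq_maxr _ _))//.
  by rewrite /n2 (big_rem k)//= leq_addr.
move=> k k0; rewrite mem_box k0 /= -ltnNge => kn.
have yk : y <= `[k].
  apply: (le_trans Hn1); apply: le_trans (@supnorm_le R k); rewrite ler_nat.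
  exact: leq_trans (leq_maxl _ _) (ltnW kn).
have -> : e = y `^ (- (2 * s - 1)).
  rewrite /y -powRrM mulrN mulVf ?(gt_eqF p0)// powR_inv1 ?invr_ge0 ?(ltW e0)//.
  by rewrite invrK.
have y0 : 0 < y by apply: powR_gt0; rewrite invr_gt0.
rewrite !powRN lef_pV2 ?posrE; [|by apply: powR_gt0; exact: fnorm_gt0|exact: powR_gt0].
by rewrite ge0_ler_powR ?nnegrE ?fnorm_ge0 ?(ltW y0) ?(ltW p0).
Qed.

Lemma evol_exists (E : R) (v0 : coeffs R) : 0 < E < c ->
  (forall k, v0 (- k) = conjc (v0 k)) -> v0 0 = 0 -> Hle a (E ^+ 2) v0 ->
  exists v X, [/\ trajectory X v, Hcont a v, (forall t k, v t (- k) = conjc (v t k)),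
    (forall t k, t <= 0 -> v t k = v0 k) & evolves predT v].
Proof.
move=> /andP[E0 Ec] v0N v00 v0E.
have a12 : 1 <= a <= 2 by rewrite (ltW a1).
have E20 : 0 <= E ^+ 2 by exact: sqr_ge0.
have [M M0 HM] := evol_tail a1 a2 as_ s1 c0 dl0 ddc E20.
have [L L1 HL] := stability a1 a2 as_ s1 c0 dl0 ddc E20.
have Lp : 0 < L by exact: lt_le_trans L1.
have sol n : exists z : R -> coeffs R, [/\ trajectory (E ^+ 2) z, evolves (fun k => k \in box n) z,
    forall t k, z t (- k) = conjc (z t k),
    forall t k, k \notin box n -> z t k = 0 & forall t k, t <= 0 -> k \in box n -> z t k = v0 k].
  have [|v [vc vN vini vE vd]] := galerkin a12 as_ s1 _ dlc dl0 ddN ddc v0N (v0E _ (uniq_box n)).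
    by rewrite E0.
  have supp t k : k \notin box n -> v t k = 0 by have [_] := vN t k.
  exists v; split => //.
  - split => // [t|t]; first by apply: supp; rewrite mem_box eqxx.
    apply: (Hle_finite (uniq_box n)); first exact: supp.
    have [t0|/ltW t0] := leP 0 t; first exact: vE.
    apply: le_trans (v0E _ (uniq_box n)); rewrite big_seq [leRHS]big_seq.
    by apply: ler_sum => k kn; rewrite vini.
  - move=> t k t0 kn; have := vd t k t0 kn.
    by rewrite /evol_rhs galerkin_nlE//; exact: supp.
  - by move=> t k; have [] := vN t k.
(* Initial tail and surplus smoothing contribute [ee i * (1 + M)]; with the factor 4 of [stability]
   the squared distance is $4^{-i}e^{2Lt}$, hence the distance $2^{-i}e^{Lt}$. *)
pose ee i := ((4 * (1 + M))^-1 / 4 ^+ i).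
have M1 : 0 < 1 + M by rewrite ltr_pwDl.
have ee0 i : 0 < ee i by rewrite divr_gt0 ?exprn_gt0// invr_gt0 mulr_gt0.
pose nn i := projT1 (cid (tail_box v0E (ee0 i))).
have nnP i : (forall S, uniq S -> (forall k, k \in S -> k \notin box (nn i)) ->
    \sum_(k <- S) `[k] `^ (2 * a) * cn (v0 k) ^+ 2 <= ee i) /\
  (forall k, k != 0 -> k \notin box (nn i) -> `[k] `^ (- (2 * s - 1)) <= ee i).
  by rewrite /nn; case: cid.
pose z i := projT1 (cid (sol (nn i))).
have zP i : [/\ trajectory (E ^+ 2) (z i), evolves (fun k => k \in box (nn i)) (z i),
    forall t k, z i t (- k) = conjc (z i t k),
    forall t k, k \notin box (nn i) -> z i t k = 0 &
    forall t k, t <= 0 -> k \in box (nn i) -> z i t k = v0 k].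
  by rewrite /z; case: cid.
have ztraj i : trajectory (E ^+ 2) (z i) by have [] := zP i.
have zevol i : evolves (fun k => k \in box (nn i)) (z i) by have [] := zP i.
have zN i t k : z i t (- k) = conjc (z i t k) by have [] := zP i.
have zsupp i t k : k \notin box (nn i) -> z i t k = 0 by have [_ _ _ h _] := zP i; exact: h.
have zini i t k : t <= 0 -> k \in box (nn i) -> z i t k = v0 k.
  by have [_ _ _ _ h] := zP i; exact: h.
have n0 : cn (0 : R[i]) = 0 by rewrite /= expr0n /= addr0 sqrtr0.
have sub_box m n : (m <= n)%N -> {subset box m <= box n}.
  by move=> mn k; rewrite !mem_box => /andP[-> /leq_trans]; apply.
have pair i j t : (nn i <= nn j)%N -> 0 <= t ->
    Hle a ((4 ^+ i)^-1 * expR (2 * L * t)) (z i t \- z j t).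
  move=> nij t0.
  have ei : (4 ^+ i)^-1 = 4 * (ee i * (1 + M)).
    rewrite /ee; move: (4 ^+ i) (expf_neq0 i (lt0r_neq0 (ltr0Sn R 3))) => Y Y0.
    by field; rewrite Y0 gt_eqF.
  have eM0 : 0 <= ee i * (1 + M) by rewrite mulr_ge0 ?(ltW (ee0 i)) ?(ltW M1).
  rewrite ei; apply: (HL (fun k => k \in box (nn i))) => //.
  - move=> r k r0 ki; apply: zevol => //; exact: sub_box ki.
  - move=> S _ Sk; rewrite big_seq big1 // => k /Sk ki.
    by rewrite !zini ?subrr ?n0 ?expr0n ?mulr0//; exact: sub_box ki.
  - move=> r S r0 uS Sk.
    have -> : \sum_(k <- S) `[k] `^ (2 * a) * cn (z i r k - z j r k) ^+ 2 =
       \sum_(k <- S) `[k] `^ (2 * a) * cn (z j r k) ^+ 2.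
      rewrite big_seq [RHS]big_seq; apply: eq_bigr => k /Sk[_ ki].
      by rewrite (zsupp _ _ _ ki) sub0r normcN.
    have h := HM (fun k => k \in box (nn j)) _ (ztraj j) (zevol j) (zsupp j) (ee i) r S uS r0 (ltW (ee0 i)).
    apply: le_trans (h _) _; first by move=> k /Sk[k0 ki]; split => //; exact: (nnP i).2.
    have h1 : \sum_(k <- S) `[k] `^ (2 * a) * cn (z j 0 k) ^+ 2 <= ee i.
      apply: le_trans ((nnP i).1 S uS _); last by move=> k /Sk[].
      apply: ler_sum => k _; rewrite ler_wpM2l ?powR_ge0//.
      have [kj|kj] := boolP (k \in box (nn j)); first by rewrite zini.
      by rewrite zsupp// n0 expr0n sqr_ge0.
    have h2 : expR (2 * r) <= expR (2 * L * r).
      by rewrite ler_expR -mulrA ler_pM2l// ler_peMl.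
    have h3 : 1 <= expR (2 * L * r) by rewrite expR_ge1// mulr_ge0// mulr_ge0// ltW.
    have -> : ee i * (1 + M) * expR (2 * L * r) =
      ee i * expR (2 * L * r) + ee i * (M * expR (2 * L * r)) by ring.
    apply: lerD; first by apply: (le_trans h1); rewrite ler_peMr// ltW.
    by rewrite -mulrA; apply: ler_wpM2l; [exact: ltW|exact: ler_wpM2l].
pose u t := expR (L * Num.max t 0).
have u0 t : 0 < u t by exact: expR_gt0.
have uE t : expR (2 * L * Num.max t 0) = u t ^+ 2.
  by rewrite /u -expRM_natl; congr expR; rewrite -mulrA.
have e42 i : (4 ^+ i)^-1 = ((2 ^+ i)^-1) ^+ 2 :> R.
  by rewrite exprVn -exprM mulnC exprM; congr (_ ^+ _)^-1; ring.
have zmax i t k : z i t k = z i (Num.max t 0) k.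
  have [//|t0] := leP 0 t.
  have [ki|ki] := boolP (k \in box (nn i)); last by rewrite !zsupp.
  by rewrite !zini// ltW.
have zz i j t : (i <= j)%N -> Hle a (((2 ^+ i)^-1 * u t) ^+ 2) (z i t \- z j t).
  move=> ij; have zzE : z i t \- z j t = z i (Num.max t 0) \- z j (Num.max t 0).
    by apply/funext => k; rewrite /= zmax (zmax j).
  have t0 : 0 <= Num.max t 0 by rewrite le_max lexx orbT.
  (* The box sizes [nn i] need not increase with [i]. If the later box is the smaller one, [pair] is
     used with the roles exchanged and gives an even better rate. *)
  rewrite zzE exprMn -uE -e42; have [nij|/ltnW nji] := leqP (nn i) (nn j); first exact: pair.
  have h : Hle a ((4 ^+ i)^-1 * expR (2 * L * Num.max t 0)) (z j (Num.max t 0) \- z i (Num.max t 0)).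
    apply: Hle_wk (pair j i _ nji t0); rewrite ler_pM2r ?expR_gt0//.
    by rewrite lef_pV2 ?posrE ?exprn_gt0// ler_eXn2l ?ltr1n.
  by apply: sumleW h => k /=; rewrite -normcN opprB.
have a0 : 0 <= a by exact: le_trans ler01 (ltW a1).
have zzk i j t k : (i <= j)%N -> cn (z j t k - z i t k) <= (2 ^+ i)^-1 * u t.
  move=> ij; have [->|k0] := eqVneq k 0.
    have [_ zi0 _] := ztraj i; have [_ zj0 _] := ztraj j.
    by rewrite zi0 zj0 subrr n0 mulr_ge0 ?invr_ge0 ?exprn_ge0 ?(ltW (u0 t)).
  have := Hle_normc k0 a0 (zz i j t ij); rewrite sqrtr_sqr ger0_norm; last first.
    by rewrite mulr_ge0 ?invr_ge0 ?exprn_ge0 ?(ltW (u0 t)).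
  by rewrite /= -normcN opprB.
have re_ex t k : exists l, forall i, `|l - complex.Re (z i t k)| <= (2 ^+ i)^-1 * u t.
  apply: (cauchy_limit (r := fun i => (2 ^+ i)^-1 * u t)) => i j ij.
  by rewrite -Re_subc; apply: le_trans (Re_le_normc _) (zzk i j t k ij).
have im_ex t k : exists l, forall i, `|l - complex.Im (z i t k)| <= (2 ^+ i)^-1 * u t.
  apply: (cauchy_limit (r := fun i => (2 ^+ i)^-1 * u t)) => i j ij.
  by rewrite -Im_subc; apply: le_trans (Im_le_normc _) (zzk i j t k ij).
pose v t k : R[i] := projT1 (cid (re_ex t k)) +i* projT1 (cid (im_ex t k)).
have vre t k i : `|complex.Re (z i t k) - complex.Re (v t k)| <= (2 ^+ i)^-1 * u t.
  by rewrite /v /=; case: cid => l /= h; rewrite distrC.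
have vim t k i : `|complex.Im (z i t k) - complex.Im (v t k)| <= (2 ^+ i)^-1 * u t.
  by rewrite /v /=; case: (cid (im_ex t k)) => l /= h; rewrite distrC.
have vz t k i : cn (z i t k - v t k) <= 2 * ((2 ^+ i)^-1 * u t).
  apply: le_trans (normc_le_ReIm _) _; rewrite Re_subc Im_subc mulrDl mul1r.
  by rewrite lerD// ?vre ?vim.
pose rr i t := (2 ^+ i)^-1 * u t.
have rr0 i t : 0 <= rr i t by rewrite mulr_ge0 ?invr_ge0 ?exprn_ge0 ?(ltW (u0 t)).
have rr2 i t : rr i t ^+ 2 <= u t ^+ 2 / 2 ^+ i.
  rewrite /rr exprMn [leRHS]mulrC ler_wpM2r ?sqr_ge0// -[leRHS]mulr1 expr2 ler_wpM2l ?invr_ge0 ?exprn_ge0//.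
  by rewrite invf_le1 ?exprn_gt0// exprn_ege1// ler1n.
have zv i t : Hle a (2 * rr i t ^+ 2) (z i t \- v t).
  move=> S uS; apply/ler_addgt0Pr => e e0; pose W := \sum_(k <- S) `[k] `^ (2 * a).
  have W0 : 0 <= W by apply: sumr_ge0 => k _; exact: powR_ge0.
  (* A Fatou argument: on a finite set [S], the limit is replaced by [z j] with [j] so large that
     the componentwise error, multiplied by the total weight [W], is below [e]. *)
  have [N HN] := small_geometric (8 * W * u t ^+ 2) e0.
  pose j := maxn i N.
  apply: (@le_trans _ _ (\sum_(k <- S) (2 * (`[k] `^ (2 * a) * cn (z i t k - z j t k) ^+ 2) +
      `[k] `^ (2 * a) * (8 * rr j t ^+ 2)))).
    apply: ler_sum => k _ /=.
    have -> : z i t k - v t k = (z i t k - z j t k) + (z j t k - v t k) by ring.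
    have -> : 2 * (`[k] `^ (2 * a) * cn (z i t k - z j t k) ^+ 2) + `[k] `^ (2 * a) * (8 * rr j t ^+ 2) =
       `[k] `^ (2 * a) * (2 * cn (z i t k - z j t k) ^+ 2 + 2 * (2 * rr j t) ^+ 2) by ring.
    apply: ler_wpM2l; first exact: powR_ge0.
    apply: le_trans (normc_sqrD_le _ _) _.
    have h2 : cn (z j t k - v t k) <= 2 * rr j t := vz t k j.
    by rewrite lerD2l ler_pM2l// lerXn2r// nnegrE ?normc_ge0// (le_trans (normc_ge0 _) h2).
  rewrite big_split /= -mulr_sumr -mulr_suml -/W; apply: lerD.
    by rewrite ler_pM2l//; apply: zz => //; exact: leq_maxl.
  apply: le_trans (HN j (leq_maxr _ _)).
  have -> : 8 * W * u t ^+ 2 / 2 ^+ j = W * (8 * (u t ^+ 2 / 2 ^+ j)) by ring.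
  by rewrite ler_wpM2l// ler_pM2l.
have v_0 t : v t 0 = 0.
  apply: (@ceq_geometric _ _ (2 * u t) 0) => i _.
  have [_ zi0 _] := ztraj i; have := vz t 0 i; rewrite zi0 sub0r normcN subr0 => h.
  by apply: le_trans h _; rewrite mulrA mulrAC.
have v_N t k : v t (- k) = conjc (v t k).
  apply: (@ceq_geometric _ _ (4 * u t) 0) => i _.
  have -> : v t (- k) - conjc (v t k) = - (z i t (- k) - v t (- k)) + conjc (z i t k - v t k).
    by rewrite conjcB zN; move: (conjc (z i t k)) (conjc (v t k)) => p q; ring.
  apply: le_trans (ler_normcD _ _) _; rewrite normcN normc_conj.
  apply: le_trans (lerD (vz _ _ i) (vz _ _ i)) _.
  by rewrite le_eqVlt; apply/orP; left; apply/eqP; ring.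
(* A mode outside infinitely many boxes would have $|k|^{-(2s-1)}$ below every [ee i]. From some
   index on, every fixed mode therefore obeys the equation. *)
have in_nn k : k != 0 -> exists N, forall i, (N <= i)%N -> k \in box (nn i).
  move=> k0; have kp : 0 < `[k] `^ (- (2 * s - 1)) by rewrite powR_gt0// fnorm_gt0.
  have [N HN] := small_geometric (4 * (1 + M))^-1 (divr_gt0 kp (ltr0n _ 2)).
  exists N => i /HN h; apply/negPn/negP => /((nnP i).2 k k0) h'.
  have : ee i <= (4 * (1 + M))^-1 / 2 ^+ i.
    rewrite /ee ler_pM2l ?invr_gt0 ?mulr_gt0// lef_pV2 ?posrE ?exprn_gt0//.
    by rewrite lerXn2r ?nnegrE// ler_nat.
  by move: h h' kp; lra.
have v_ini t k : t <= 0 -> v t k = v0 k.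
  move=> t0; have [->|k0] := eqVneq k 0; first by rewrite v_0.
  have [N HN] := in_nn k k0.
  apply: (@ceq_geometric _ _ (2 * u t) N) => i /HN ki.
  rewrite -(zini i t k t0 ki) -normcN opprB.
  by apply: le_trans (vz t k i) _; rewrite mulrA mulrAC.
have vX t : Hle a (2 * E ^+ 2 + 1) (v t).
  have [N HN] := small_geometric (4 * u t ^+ 2) ltr01.
  have -> : v t = z N t \- (z N t \- v t) by apply/funext => k /=; ring.
  have [_ _ zX] := ztraj N.
  apply: Hle_wk (HleB (zX t) (zv N t)); rewrite lerD2l.
  apply: le_trans (HN N (leqnn N)); have := rr2 N t.
  by move: (rr N t ^+ 2) => q; rewrite -mulrA; lra.
have zHc i : Hcont a (z i).
  have [zc _ _] := ztraj i; exact: (Hcont_finite a (uniq_box (nn i)) zc (zsupp i)).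
have uc : continuous u.
  move=> t; apply: continuous_comp; last exact: continuous_expR.
  apply: cvgM; first exact: cvg_cst.
  by apply: continuous_max; [exact: cvg_id|exact: cvg_cst].
have vHc : Hcont a v.
  move=> t e e0; pose U := (u t + 1) ^+ 2.
  have e32 : 0 < e / 32 by rewrite divr_gt0.
  have [N HN] := small_geometric U e32.
  have h1 := zHc N t (e / 16) (divr_gt0 e0 (ltr0n _ 16)).
  have /cvgrPdist_le/(_ 1 ltr01) h2 := uc t.
  near=> r.
  have ur : u r <= u t + 1.
    have : `|u t - u r| <= 1 by near: r; exact: h2.
    by rewrite ler_norml; lra.
  have small x : 0 < u x -> u x <= u t + 1 -> 2 * rr N x ^+ 2 <= e / 16.
    move=> ux0 ux; have := rr2 N x; have := HN N (leqnn N).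
    have : u x ^+ 2 / 2 ^+ N <= U / 2 ^+ N.
      by rewrite ler_pM2r ?invr_gt0 ?exprn_gt0// ler_pXn2r ?nnegrE ?(ltW ux0)// addr_ge0 ?(ltW (u0 t)).
    by move: (rr N x ^+ 2) (u x ^+ 2 / _) (U / _) => *; lra.
  have hr := small r (u0 r) ur; have ht := small t (u0 t) ltac:(by rewrite lerDl).
  have hz : Hle a (e / 16) (z N r \- z N t) by near: r; exact: h1.
  have -> : v r \- v t = \- (z N r \- v r) \+ ((z N r \- z N t) \+ (z N t \- v t)).
    by apply/funext => k /=; ring.
  apply: Hle_wk (HleD (HleN (Hle_wk hr (zv N r))) (HleD hz (Hle_wk ht (zv N t)))).
  by move: e0; lra.
have vcc := Hcont_componentwise a0 v_0 vHc.
have vtraj : trajectory (2 * E ^+ 2 + 1) v by [].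
exists v, (2 * E ^+ 2 + 1); split => //.
have rhs_c (y : R -> coeffs R) X : trajectory X y -> Hcont a y ->
    componentwise_continuous (fun t => evol_rhs s dl dd y t).
  move=> [yc y0 yX] yH k; have [yr yi] := yc k.
  have [nr ni] := nl_continuous a1 a2 s0 s1 k y0 yX yH dlc dl0.
  split.
    rewrite (_ : (fun _ => _) = (fun t => - dd k * complex.Re (y t k) -
        complex.Re (nl s (dl t) (y t) (y t) k))).
      by move=> t; apply: cvgB; [apply: cvgM; [exact: cvg_cst|exact: yr]|exact: nr].
    by apply/funext => t; rewrite /evol_rhs Re_subc -rmorphN Re_realM.
  rewrite (_ : (fun _ => _) = (fun t => - dd k * complex.Im (y t k) -
      complex.Im (nl s (dl t) (y t) (y t) k))).
    by move=> t; apply: cvgB; [apply: cvgM; [exact: cvg_cst|exact: yi]|exact: ni].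
  by apply/funext => t; rewrite /evol_rhs Im_subc -rmorphN Im_realM.
move=> t k t0 _; have [->|k0] := eqVneq k 0.
  have -> : evol_rhs s dl dd v t 0 = 0 by rewrite /evol_rhs v_0 nl_at0 mulr0 subr0.
  by under eq_fun do rewrite v_0; under [X in _ /\ is_derive _ _ X _]eq_fun do rewrite v_0;
    split; exact: is_derive_cst.
have [N HN] := in_nn k k0.
have [C [C0 HC]] := nl_diff_bound a1 a2 s0 s1.
pose X := 2 * E ^+ 2 + 1.
have X0 : 0 <= X by rewrite addr_ge0// mulr_ge0.
have zX' i r : Hle a X (z i r).
  by have [_ _ h] := ztraj i; apply: Hle_wk (h r); rewrite /X; move: E20; lra.
(* The three summands bound the error of the component itself, of the linear term and of the
   nonlinear term. *)
pose D := 1 + (`|dd k| * 2 + Num.sqrt (2 * (C * X))).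
have D0 : 0 <= D by rewrite addr_ge0// addr_ge0 ?sqrtr_ge0// mulr_ge0.
have key i r : 0 < r -> cn (evol_rhs s dl dd (z i) r k - evol_rhs s dl dd v r k) <= D / 2 ^+ i * expR (L * r).
  move=> r0; have [_ zi0 _] := ztraj i.
  have -> : evol_rhs s dl dd (z i) r k - evol_rhs s dl dd v r k =
     - (dd k)%:C * (z i r k - v r k) - (nl s (dl r) (z i r) (z i r) k - nl s (dl r) (v r) (v r) k).
    by rewrite /evol_rhs; ring.
  have h := HC _ _ _ _ _ (dl0 r) (zi0 r) (v_0 r) (zX' i r) (vX r) (zv i r).
  have {}h := Hle_normc k0 (ltac:(by rewrite subr_ge0 ltW) : 0 <= a - 1) h.
  apply: le_trans (ler_normcD _ _) _; rewrite [cn (- (nl _ _ _ _ _ - _))]normcN.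
  rewrite ComplexField.Normc.normcM normcN normc_real.
  have rrE : rr i r = (2 ^+ i)^-1 * expR (L * r) by rewrite /rr /u (max_idPl (ltW r0)).
  have -> : D / 2 ^+ i * expR (L * r) = rr i r + (`|dd k| * (2 * rr i r) + Num.sqrt (2 * (C * X)) * rr i r).
    by rewrite rrE /D; ring.
  rewrite -[leLHS]add0r; apply: lerD => //; apply: lerD.
    by rewrite ler_wpM2l//; exact: vz.
  apply: le_trans h _.
  have -> : C * (X * (2 * rr i r ^+ 2)) = (2 * (C * X)) * rr i r ^+ 2 by ring.
  by rewrite sqrtrM ?mulr_ge0 ?(ltW C0)// sqrtr_sqr ger0_norm.
have key2 i r : 0 < r -> (2 ^+ i)^-1 * u r <= D / 2 ^+ i * expR (L * r).
  move=> r0; rewrite /u (max_idPl (ltW r0)) ler_pM2r ?expR_gt0//.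
  by rewrite ler_peMl ?invr_ge0 ?exprn_ge0// lerDl addr_ge0 ?sqrtr_ge0// mulr_ge0.
have [vrc vic] := rhs_c v _ vtraj vHc k.
split.
  apply: (@limit_derive _ (fun i r => complex.Re (z i r k))
     (fun i r => complex.Re (evol_rhs s dl dd (z i) r k)) _ (fun r => complex.Re (evol_rhs s dl dd v r k))
     (complex.Re (v0 k)) D L N Lp D0) => //; last by move=> r r0; rewrite v_ini.
  move=> i Ni; have [zc _ _] := ztraj i; have [zr _] := zc k.
  have [rc _] := rhs_c _ _ (ztraj i) (zHc i) k.
  split => //.
  - by move=> r r0; have [] := zevol i r k r0 (HN i Ni).
  - by rewrite zini ?HN.
  - move=> r r0; split; first exact: le_trans (vre r k i) (key2 i r r0).
    by rewrite -Re_subc; apply: le_trans (Re_le_normc _) (key i r r0).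
apply: (@limit_derive _ (fun i r => complex.Im (z i r k))
   (fun i r => complex.Im (evol_rhs s dl dd (z i) r k)) _ (fun r => complex.Im (evol_rhs s dl dd v r k))
   (complex.Im (v0 k)) D L N Lp D0) => //; last by move=> r r0; rewrite v_ini.
move=> i Ni; have [zc _ _] := ztraj i; have [_ zi] := zc k.
have [_ ic] := rhs_c _ _ (ztraj i) (zHc i) k.
split => //.
- by move=> r r0; have [] := zevol i r k r0 (HN i Ni).
- by rewrite zini ?HN.
- move=> r r0; split; first exact: le_trans (vim r k i) (key2 i r r0).
  by rewrite -Im_subc; apply: le_trans (Im_le_normc _) (key i r r0).
Unshelve. all: by end_near. Qed.

End wellposedness.

(** * The probability that a Wiener process stays below a line *)

Section gaussian.
Context {R : realType}.
Local Notation mu := (@lebesgue_measure R).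
Local Open Scope ereal_scope.

Lemma integral_normal_prob (m sg : R) (g : R -> \bar R) :
  measurable_fun [set: R] g -> (forall x, 0 <= g x) ->
  \int[normal_prob m sg]_x g x = \int[mu]_x (g x * (normal_pdf m sg x)%:E).
Proof.
move=> mg g0; have dom := @normal_prob_dominates R m sg.
have mpdf : measurable_fun [set: R] (fun x => (normal_pdf m sg x)%:E).
  by apply/measurable_EFinP; exact: measurable_normal_pdf.
have fint := @Radon_Nikodym_SigmaFinite.f_integrable _ _ _ (normal_prob m sg) mu dom.
rewrite -(Radon_Nikodym_SigmaFinite.change_of_variables dom)//.
apply: ae_eq_integral => //.
- apply: emeasurable_funM => //; exact: measurable_int fint.
- exact: emeasurable_funM.
- apply: ae_eqe_mul2l; apply: integral_ae_eq => //.
  move=> E _ mE; rewrite -(Radon_Nikodym_SigmaFinite.f_integral dom)//.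
Qed.

(** Completing the square: multiplying by $e^{lx}$ shifts the mean to $l\,sg^2$, up to the stated
    factor. *)
Lemma normal_mgf (sg l : R) : sg != 0%R ->
  \int[normal_prob 0 sg]_x (expR (l * x))%:E = (expR (l ^+ 2 * sg ^+ 2 / 2))%:E.
Proof.
move=> sg0; rewrite integral_normal_prob; last 2 first.
- by apply/measurable_EFinP; apply: measurableT_comp => //; exact: measurable_funM.
- by move=> x; rewrite lee_fin expR_ge0.
transitivity (\int[mu]_x ((expR (l ^+ 2 * sg ^+ 2 / 2))%:E * (normal_pdf (l * sg ^+ 2) sg x)%:E)); last first.
  rewrite ge0_integralZl//.
  - by rewrite integral_normal_pdf mule1.
  - by apply/measurable_EFinP; exact: measurable_normal_pdf.
  - by move=> x _; rewrite lee_fin normal_pdf_ge0.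
apply: eq_integral => x _; rewrite -!EFinM !normal_pdfE//; congr EFin.
rewrite /normal_fun mulrCA [RHS]mulrCA -!expRD; congr (_ * expR _)%R.
by field.
Qed.

End gaussian.

Section independence.
Context {R : realType} {d d' : measure_display} {T : measurableType d} {T' : measurableType d'}.
Variables (P : probability T R).
Local Open Scope ereal_scope.

(** The joint law is the product of the marginals by uniqueness on rectangles, so Tonelli applies.
    Replacing $x$ by $\max(x,0)$ makes the integrand nonnegative everywhere without changing it on
    the range of [X]. *)
Lemma integral_indep (X : {mfun T >-> R}) (Y : {mfun T >-> T'}) (g : T' -> R) :
  (forall B C, measurable B -> measurable C ->
     P (X @^-1` B `&` Y @^-1` C) = P (X @^-1` B) * P (Y @^-1` C)) ->
  (forall x, 0 <= X x)%R -> (forall y, 0 <= g y)%R -> measurable_fun [set: T'] g ->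
  \int[P]_x (X x * g (Y x))%:E = \int[P]_x (X x)%:E * \int[P]_x (g (Y x))%:E.
Proof.
move=> XY X0 g0 mg.
have mZ : measurable_fun [set: T] (fun x => (X x, Y x)) by exact: measurable_fun_pair.
pose Z : {mfun T >-> (R * T')%type} := HB.pack (fun x => (X x, Y x)) (isMeasurableFun.Build _ _ _ _ _ mZ).
pose PX := distribution P X; pose PY := distribution P Y; pose PZ := distribution P Z.
pose m (x : R) : R := Num.max x 0%R.
have m0 x : (0 <= m x)%R by rewrite le_max lexx orbT.
have mm : measurable_fun [set: R] m by exact: measurable_maxr.
have mX x : m (X x) = X x by apply/max_idPl.
pose f (z : R * T') := (m z.1 * g z.2)%:E.
have f0 z : 0 <= f z by rewrite lee_fin mulr_ge0.
have mf : measurable_fun [set: R * T'] f.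
  apply/measurable_EFinP; apply: measurable_funM.
    by apply: (measurableT_comp mm); exact: measurable_fst.
  by apply: (measurableT_comp mg); exact: measurable_snd.
have E1 : \int[P]_x (X x * g (Y x))%:E = \int[PZ]_z f z.
  rewrite /PZ /distribution ge0_integral_pushforward//.
  by apply: eq_integral => x _; rewrite /f /= mX.
have E2 : \int[PZ]_z f z = \int[PX \x PY]_z f z.
  apply: eq_measure_integral => A mA _; apply/esym.
  by apply: product_measure_unique mA; exact: XY.
rewrite E1 E2 fubini_tonelli1//.
have gPY : \int[PY]_y (g y)%:E = \int[P]_x (g (Y x))%:E.
  by rewrite /PY /distribution ge0_integral_pushforward//; [exact/measurable_EFinP|move=> y _; rewrite lee_fin].
have gPY0 : 0 <= \int[PY]_y (g y)%:E by apply: integral_ge0 => y _; rewrite lee_fin.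
transitivity (\int[PX]_x ((m x)%:E * \int[PY]_y (g y)%:E)).
  apply: eq_integral => x _; rewrite /fubini_F /f /=.
  under eq_integral do rewrite EFinM.
  rewrite ge0_integralZl//.
  - exact/measurable_EFinP.
  - by move=> y _; rewrite lee_fin.
  - by rewrite lee_fin.
rewrite ge0_integralZr//; last 2 first.
- exact/measurable_EFinP.
- by move=> x _; rewrite lee_fin.
rewrite gPY; congr (_ * _).
rewrite /PX /distribution ge0_integral_pushforward//; last 2 first.
- exact/measurable_EFinP.
- by move=> x _; rewrite lee_fin.
by apply: eq_integral => x _; rewrite /= mX.
Qed.

End independence.

Lemma continuous_pos_part {R : realType} : continuous (fun r : R => Num.max r 0).
Proof. by move=> r; apply: (@continuous_max _ _ (fun r : R => r) (fun=> 0)) => //; exact: cvg_cst. Qed.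

Lemma continuous_pos_part_comp {R : realType} (f : R -> R) :
  {within [set t : R | 0 <= t], continuous f} -> continuous (fun r : R => f (Num.max r 0)).
Proof.
move=> fc; apply: (within_comp fc (@continuous_pos_part R)) => r /=.
by rewrite le_max lexx orbT.
Qed.

Section line_crossing.
Context {R : realType} {d : measure_display} {T : measurableType d}.
Variables (P : probability T R) (W : R -> T -> R).
Hypothesis hW : standard_wiener P W.

Section grid.
Variables (h b c : R).
Hypotheses (h0 : 0 < h) (b0 : 0 < b) (c0 : 0 < c).

Let S n x := W (n%:R * h) x.
Let xi n x := S n.+1 x - S n x.

Lemma S_ge0 n : 0 <= n%:R * h.
Proof. by rewrite mulr_ge0 ?(ltW h0) ?(ltW c0). Qed.

Lemma measurable_S n : measurable_fun [set: T] (S n).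
Proof. exact: (wiener_measurable hW (S_ge0 n)). Qed.

Lemma measurable_xi n : measurable_fun [set: T] (xi n).
Proof. by apply: measurable_funB; exact: measurable_S. Qed.

Lemma S0 x : S 0 x = 0.
Proof. by rewrite /S mul0r (wiener_start hW). Qed.

Lemma S_sum n x : S n x = \sum_(i < n) xi i x.
Proof.
elim: n => [|n IH]; first by rewrite big_ord0 S0.
by rewrite big_ord_recr /= -IH /xi addrC subrK.
Qed.

(** The cylinder events of the first [n] increments. They form a $\pi$-system, so the product rule
    assumed for a Wiener process extends to the $\sigma$-algebra that they generate, by uniqueness
    of finite measures. *)
Definition past n : set (set T) := [set F | exists B : nat -> set R,
  (forall i, measurable (B i)) /\ F = [set x | forall i, (i < n)%N -> B i (xi i x)]].

Lemma past_measurable n : past n `<=` @measurable _ T.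
Proof.
move=> F [B [mB ->]].
have -> : [set x | forall i, (i < n)%N -> B i (xi i x)] =
    \bigcap_i (if (i < n)%N then xi i @^-1` (B i) else setT).
  apply/seteqP; split => x /= H i; first by move=> _; case: ifPn => // /H.
  by move=> ni; have := H i I; rewrite ni.
apply: bigcapT_measurable => i; case: ifP => // _; rewrite -[X in measurable X]setTI.
exact: measurable_xi.
Qed.

Lemma past_setI n : setI_closed (past n).
Proof.
move=> F F' [B [mB ->]] [B' [mB' ->]]; exists (fun i => B i `&` B' i); split.
  by move=> i; exact: measurableI.
apply/seteqP; split => x /=.
  by move=> [H H'] i ni; split; [exact: H|exact: H'].
by move=> H; split => i /H[].
Qed.

Lemma increment_indep n F (C : set R) : <<s past n >> F -> measurable C ->
  (P (F `&` xi n @^-1` C) = P F * P (xi n @^-1` C))%E.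
Proof.
move=> Fn mC.
have mD : measurable (xi n @^-1` C) by rewrite -[X in measurable X]setTI; exact: measurable_xi.
have fin : P (xi n @^-1` C) \is a fin_num by exact: fin_num_measure.
have r0 : 0 <= fine (P (xi n @^-1` C)) by exact: fine_ge0.
pose m1 : {measure set T -> \bar R} := mrestr P mD.
pose m2 : {measure set T -> \bar R} := mscale (NngNum r0) P.
have : m1 F = m2 F.
  apply: (@g_sigma_algebra_measure_unique _ _ _ (past n) (@past_measurable n) (fun=> setT)) => //.
  - move=> _; exists (fun=> setT); split => //; apply/seteqP; split => x //= _ i _ //.
  - by apply/seteqP; split => x //= _; exists 0%N.
  - exact: (@past_setI n).
  - move=> _ [B [mB ->]]; rewrite -[m1 _]/(P (_ `&` _)) -[m2 _]/((fine (P (xi n @^-1` C)))%:E * P _)%E fineK// muleC.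
    pose B' i := if i == n then C else B i.
    have mB' i : measurable (B' i) by rewrite /B'; case: ifP.
    have inc (m : nat) (B'' : nat -> set R) :=
      @wiener_independent _ _ _ _ _ hW m (fun i => i%:R * h) B''.
    have tmono (i : nat) : i%:R * h < i.+1%:R * h by rewrite ltr_pM2r// ltr_nat.
    have t00 : 0 <= 0%:R * h by rewrite mul0r.
    have e1 := inc n.+1 B' t00 tmono mB'; have e2 := inc n B' t00 tmono mB'.
    have s2 : [set x | forall i, (i < n)%N -> B' i (W (i.+1%:R * h) x - W (i%:R * h) x)] =
       [set x | forall i, (i < n)%N -> B i (xi i x)].
      apply/seteqP; split => x /= H i ni; have := H i ni; rewrite /B' ltn_eqF//.
    have s1 : [set x | forall i, (i < n.+1)%N -> B' i (W (i.+1%:R * h) x - W (i%:R * h) x)] =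
       [set x | forall i, (i < n)%N -> B i (xi i x)] `&` xi n @^-1` C.
      rewrite -s2; apply/seteqP; split => x /=.
        move=> H; split => [i ni|]; first by apply: H; exact: ltnW.
        by have := H n (ltnSn n); rewrite /B' eqxx.
      move=> [H HC] i; rewrite ltnS leq_eqVlt => /predU1P[->|ni]; last exact: H.
      by rewrite /B' eqxx.
    rewrite s1 big_ord_recr /= -e2 s2 in e1; rewrite e1; congr (_ * P _)%E.
    by rewrite /B' eqxx.
  - by move=> _; apply: le_lt_trans (probability_le1 P _) (ltry 1); exact: measurableI.
by rewrite -[m1 _]/(P (_ `&` _)) -[m2 _]/((fine (P (xi n @^-1` C)))%:E * P _)%E fineK// muleC.
Qed.

(** The events decrease in [n] by construction, so the complement of [below n.+1] within [below n]
    is a first crossing. *)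
Fixpoint below n : set T := [set x | S n x <= b + c * (n%:R * h)] `&`
  if n is n'.+1 then below n' else setT.

(* The exponential martingale [exp(2cW - 2c^2 t)] on the paths that have stayed
   below the line; it exceeds [exp(2bc)] at the first crossing. *)
Definition mart n x := expR (2 * c * S n x - 2 * c ^+ 2 * (n%:R * h)) * \1_(below n) x.

Let pT n := g_sigma_algebraType (past n).

Lemma past_xi n i : (i < n)%N -> measurable_fun [set: pT n] (xi i : pT n -> R).
Proof.
move=> ni _ B mB; rewrite setTI; apply: sub_sigma_algebra.
exists (fun j => if j == i then B else setT); split; first by move=> j; case: ifP.
apply/seteqP; split => x /=.
  by move=> H j _; case: eqP => [->|].
by move=> /(_ i ni); rewrite eqxx.
Qed.

Lemma past_S n k : (k <= n)%N -> measurable_fun [set: pT n] (S k : pT n -> R).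
Proof.
move=> kn; rewrite (_ : S k = fun x => \sum_(i < k) xi i x); last by apply/funext => x; exact: S_sum.
by apply: measurable_sum => i; apply: past_xi; exact: leq_trans (ltn_ord i) kn.
Qed.

Lemma past_below n k : (k <= n)%N -> @measurable _ (pT n) (below k).
Proof.
have H j : (j <= n)%N -> @measurable _ (pT n) [set x | S j x <= b + c * (j%:R * h)].
  move=> jn; have := past_S jn measurableT (measurable_itv `]-oo, b + c * (j%:R * h)]).
  by rewrite setTI; congr measurable; apply/seteqP; split => x; rewrite /= in_itv.
elim: k => [|k IH] kn; first by rewrite /= setIT; exact: H.
by apply: measurableI; [exact: H|exact: IH (ltnW kn)].
Qed.

Lemma measurable_below n : measurable (below n).
Proof. 
have H j : measurable [set x | S j x <= b + c * (j%:R * h)].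
  have := measurable_S j measurableT (measurable_itv `]-oo, b + c * (j%:R * h)]).
  by rewrite setTI; congr measurable; apply/seteqP; split => x; rewrite /= in_itv.
by elim: n => [|n IH]; [rewrite /= setIT; exact: H|apply: measurableI].
Qed.

Lemma past_mart n : measurable_fun [set: pT n] (mart n : pT n -> R).
Proof.
apply: measurable_funM.
  apply: (measurableT_comp (@measurable_expR R)); apply: measurable_funB => //.
  by apply: measurable_funM => //; exact: past_S.
by apply: measurable_indic; exact: past_below.
Qed.

Lemma mart_measurable n : measurable_fun [set: T] (mart n).
Proof.
apply: measurable_funM.
  apply: (measurableT_comp (@measurable_expR R)); apply: measurable_funB => //.
  by apply: measurable_funM => //; exact: measurable_S.
by apply: measurable_indic; exact: measurable_below.
Qed.

Lemma mart_ge0 n x : 0 <= mart n x.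
Proof. by rewrite mulr_ge0 ?expR_ge0// indicE. Qed.

Lemma mart_step n :
  (\int[P]_x (mart n x * expR (2 * c * xi n x))%:E =
   \int[P]_x (mart n x)%:E * (expR (2 * c ^+ 2 * h))%:E)%E.
Proof.
pose X : {mfun T >-> R} := HB.pack (mart n) (isMeasurableFun.Build _ _ _ _ _ (mart_measurable n)).
have mY : measurable_fun [set: T] (xi n : T -> measurableTypeR R) := measurable_xi n.
pose Y : {mfun T >-> measurableTypeR R} :=
  HB.pack (xi n : T -> measurableTypeR R) (isMeasurableFun.Build _ _ T (measurableTypeR R) _ mY).
pose g (y : measurableTypeR R) : R := expR (2 * c * y).
have mg : measurable_fun [set: measurableTypeR R] g by apply: measurableT_comp => //; exact: measurable_funM.
have g0 y : 0 <= g y by exact: expR_ge0.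
have -> : (\int[P]_x (mart n x * expR (2 * c * xi n x))%:E =
   \int[P]_x (X x)%:E * \int[P]_x (g (Y x))%:E)%E.
  apply: (integral_indep (P:=P) (X:=X) (Y:=Y) (g:=g)) => //; last exact: mart_ge0.
  move=> B C mB mC; apply: increment_indep => //.
  have H := @past_mart n measurableT B mB.
  suff <- : [set: pT n] `&` (mart n : pT n -> R) @^-1` B = X @^-1` B by exact: H.
  exact: setTI.
congr (_ * _)%E.
have -> : (\int[P]_x (g (Y x))%:E = \int[distribution P Y]_y (g y)%:E)%E.
  rewrite /distribution ge0_integral_pushforward//; first exact/measurable_EFinP.
  by move=> y _; rewrite lee_fin.
have -> : (\int[distribution P Y]_y (g y)%:E = \int[normal_prob 0 (Num.sqrt h)]_y (g y)%:E)%E.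
  apply: eq_measure_integral => B mB _.
  have := wiener_gaussian hW (S_ge0 n) (ltac:(by rewrite ltr_pM2r// ltr_nat) : n%:R * h < n.+1%:R * h) mB.
  have -> : n.+1%:R * h - n%:R * h = h by rewrite -natr1; ring.
  by [].
rewrite /g normal_mgf ?gt_eqF ?sqrtr_gt0// sqr_sqrtr ?ltW//; congr (expR _)%:E.
by field.
Qed.

(** A discrete optional stopping argument: mass leaving [below] at step $n+1$ has $S>b+ct$ at
    $t=(n+1)h$, so its exponential $e^{2cS-2c^2t}$ exceeds $e^{2bc}$ and pays for the growth of the
    second term. *)
Lemma mart_le n : (\int[P]_x (mart n x)%:E + (expR (2 * b * c))%:E * P (~` below n) <= 1)%E.
Proof.
have e0 : (0 <= (expR (2 * b * c))%:E)%E by rewrite lee_fin expR_ge0.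
have mB n' : measurable (~` below n') by apply: measurableC; exact: measurable_below.
elim: n => [|n IH].
  have b0E : below 0 = setT.
    by apply/seteqP; split => x //= _; rewrite S0 mul0r mulr0 addr0; split => //; exact: ltW.
  rewrite b0E setCT measure0 mule0 adde0 (eq_integral (cst 1%E)).
    by rewrite integral_cst//= probability_setT mule1.
  by move=> x _; rewrite /mart b0E indicT S0 mul0r !mulr0 subrr expR0 mulr1.
apply: le_trans IH.
have EP n' : ((expR (2 * b * c))%:E * P (~` below n') =
    \int[P]_x (expR (2 * b * c) * \1_(~` below n') x)%:E)%E.
  under eq_integral do rewrite EFinM.
  rewrite ge0_integralZl//.
  - by rewrite integral_indic// setIT.
  by apply/measurable_EFinP; exact: measurable_indic.
rewrite !EP.
have mI n' : measurable_fun [set: T] (fun x => (expR (2 * b * c) * \1_(~` below n') x)%:E).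
  by apply/measurable_EFinP; apply: measurable_funM => //; exact: measurable_indic.
have I0 n' x : (0 <= (expR (2 * b * c) * \1_(~` below n') x)%:E)%E.
  by rewrite lee_fin mulr_ge0 ?expR_ge0// indicE.
have mM n' : measurable_fun [set: T] (fun x => (mart n' x)%:E).
  by apply/measurable_EFinP; exact: mart_measurable.
have M0 n' x : (0 <= (mart n' x)%:E)%E by rewrite lee_fin mart_ge0.
(* The factor $e^{-2c^2h}$ compensates the mean of $e^{2c\xi}$ for an increment of variance $h$. *)
pose k := expR (- (2 * c ^+ 2 * h)).
have kE : (\int[P]_x (mart n x)%:E =
    \int[P]_x (k * (mart n x * expR (2 * c * xi n x)))%:E)%E.
  under [RHS]eq_integral do rewrite EFinM.
  rewrite ge0_integralZl//.
  - rewrite mart_step muleCA -EFinM /k -expRD addNr expR0 mule1//.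
  - apply/measurable_EFinP; apply: measurable_funM; first exact: mart_measurable.
    by apply: measurableT_comp => //; apply: measurable_funM => //; exact: measurable_xi.
  - by move=> x _; rewrite lee_fin mulr_ge0 ?expR_ge0// mart_ge0.
  - by rewrite lee_fin expR_ge0.
rewrite kE -!ge0_integralD//.
- apply: ge0_le_integral => //.
  + by move=> x _; rewrite adde_ge0.
  + exact: emeasurable_funD.
  + by apply: emeasurable_funD => //; apply/measurable_EFinP; apply: measurable_funM => //;
      apply: measurable_funM; [exact: mart_measurable|apply: measurableT_comp => //; apply: measurable_funM => //; exact: measurable_xi].
  move=> x _; rewrite -!EFinD lee_fin.
  have mE : k * (mart n x * expR (2 * c * xi n x)) =
      expR (2 * c * S n.+1 x - 2 * c ^+ 2 * (n.+1%:R * h)) * \1_(below n) x.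
    have AC (p q r u : R) : p * (q * u * r) = p * q * r * u by ring.
    rewrite /mart /k AC -!expRD; congr (expR _ * _).
    by rewrite /xi -natr1; ring.
  rewrite mE /mart !indicE !in_setC /=.
  have [xn|xn] := boolP (x \in below n); last first.
    have -> : (x \in below n.+1) = false.
      by apply/negbTE; apply: contra xn; rewrite !inE => -[].
    by rewrite !mulr0 !add0r.
  have [xn1|xn1] := boolP (x \in below n.+1); first by [].
  rewrite /= !mulr0 add0r addr0 !mulr1 ler_expR.
  have : ~~ (S n.+1 x <= b + c * (n.+1%:R * h)).
    apply: contra xn1 => H; rewrite inE; split => //; by rewrite inE in xn.
  rewrite -ltNge => /ltW H; have := ler_wpM2l (ltac:(by rewrite mulr_ge0 ?(ltW h0) ?(ltW c0)) : 0 <= 2 * c) H.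
  by lra.
- by move=> x _; rewrite lee_fin mulr_ge0 ?expR_ge0// mulr_ge0 ?expR_ge0// mart_ge0.
- by apply/measurable_EFinP; apply: measurable_funM => //;
    apply: measurable_funM; [exact: mart_measurable|apply: measurableT_comp => //; apply: measurable_funM => //; exact: measurable_xi].
Qed.

Lemma below_prob n : measurable (below n) /\ (P (~` below n) <= (expR (- (2 * b * c)))%:E)%E.
Proof.
split; first exact: measurable_below.
have := mart_le n.
have mn : (0 <= \int[P]_x (mart n x)%:E)%E by apply: integral_ge0 => x _; rewrite lee_fin mart_ge0.
have fin : P (~` below n) \is a fin_num by apply: fin_num_measure; apply: measurableC; exact: measurable_below.
move=> H; have {H} : ((expR (2 * b * c))%:E * P (~` below n) <= 1)%E.
  by apply: le_trans H; rewrite leeDr.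
rewrite -(fineK fin) -EFinM !lee_fin expRN => H.
by rewrite -[leRHS]mul1r ler_pdivlMr ?expR_gt0// mulrC.
Qed.

Lemma belowP n x : below n x <-> forall i, (i <= n)%N -> W (i%:R * h) x <= b + c * (i%:R * h).
Proof.
elim: n => [|n IH] /=.
  split=> [[H _] i|H]; first by rewrite leqn0 => /eqP ->.
  by split => //; exact: (H 0%N).
split=> [[H /IH H'] i|H].
  by rewrite leq_eqVlt => /predU1P[->//|]; rewrite ltnS => /H'.
by split; [exact: (H n.+1)|apply/IH => i ni; apply: H; exact: ltnW].
Qed.

End grid.

(** Grids of step $2^{-m}$ with horizon $m$ are nested, so the bad events increase and their union
    obeys the common bound; continuity of the path extends the conclusion to all times. *)
Lemma wiener_below_line (b c : R) : 0 < b -> 0 < c ->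
  exists A : set T, [/\ measurable A,
    exists2 p : R, P A = p%:E & 1 - expR (- (2 * b * c)) <= p &
    forall x, A x -> forall t : R, 0 <= t -> W t x <= b + c * t].
Proof.
move=> b0 c0.
pose h m : R := (2 ^+ m)^-1.
have h0 m : 0 < h m by rewrite invr_gt0 exprn_gt0.
pose A m : set T := below (h m) b c (m * 2 ^ m)%N.
have mA m : measurable (A m) := (below_prob (h0 m) b0 c0 _).1.
have PA m : (P (~` A m) <= (expR (- (2 * b * c)))%:E)%E := (below_prob (h0 m) b0 c0 _).2.
pose U := \bigcup_m ~` A m.
have mU : measurable U by apply: bigcupT_measurable => m; exact: measurableC.
have nd : nondecreasing_seq (fun m => ~` A m).
  apply/nondecreasing_seqP => m; apply/subsetPset => x /=; apply: contra_not.
  rewrite /A !belowP => H i im.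
  have e : i%:R * h m = (2 * i)%:R * h m.+1.
    by rewrite /h exprS invfM natrM mulrACA mulfV// mul1r.
  by rewrite e; apply: H; rewrite expnS mulnCA leq_mul2l /= mulSn (leq_trans im) ?leq_addl.
have PU : (P U <= (expR (- (2 * b * c)))%:E)%E.
  have H := nondecreasing_cvg_mu (fun m => measurableC (mA m)) mU nd.
  have := cvg_lim (@ereal_hausdorff R) (H R P) => <-.
  apply: lime_le; first by apply/cvg_ex; eexists; exact: (H R P).
  by apply: nearW => m; exact: PA.
exists (~` U); split; first exact: measurableC.
  have fU : P U \is a fin_num by exact: fin_num_measure.
  exists (1 - fine (P U)); last by rewrite lerB// -lee_fin fineK.
  by rewrite probability_setC// EFinB fineK.
move=> x Ax t t0; rewrite leNgt; apply/negP => lt.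
pose f (r : R) := W (Num.max r 0) x - (b + c * Num.max r 0).
have fc : continuous f.
  have wc := continuous_pos_part_comp (@wiener_continuous _ _ _ _ _ hW x).
  move=> r; apply: (@continuousB R _ _ (fun r : R => W (Num.max r 0) x : R^o)); first exact: wc.
  by apply: cvgD; [exact: cvg_cst|apply: cvgM; [exact: cvg_cst|exact: continuous_pos_part]].
have ft : 0 < f t by rewrite /f max_l// subr_gt0.
have /nbhs_ballP[e /= e0 He] : nbhs t [set r | 0 < f r].
  by have := fc t; move=> /cvgr_gt /(_ _ ft).
(* As $m<2^m$, this choice gives both $t<m$ and $2^{-m}<e$: the grid reaches beyond $t$ and has a
   point within [e] to the left of it. *)
pose m := (Num.truncn (t + e^-1)).+1.
have te : t + e^-1 < m%:R by rewrite truncnS_gt.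
have e1 : 0 < e^-1 by rewrite invr_gt0.
have tm : t < m%:R by apply: lt_trans te; rewrite ltrDl.
have me : h m < e.
  rewrite /h invf_plt ?posrE ?exprn_gt0//.
  apply: (@lt_trans _ _ m%:R); first by apply: le_lt_trans te; rewrite lerDr.
  by rewrite -natrX ltr_nat ltn_expl.
have p2 : 0 < 2 ^+ m :> R by rewrite exprn_gt0.
have t2 : 0 <= t * 2 ^+ m by rewrite mulr_ge0// ltW.
pose i := Num.truncn (t * 2 ^+ m).
have /andP[i1 i2] := truncn_itv t2; rewrite -/i in i1 i2.
have ih0 : 0 <= i%:R * h m by rewrite mulr_ge0// ltW.
have iht : i%:R * h m <= t by rewrite ler_pdivrMr.
have iht' : t - h m < i%:R * h m.
  by rewrite ltrBlDr -{2}[h m]mul1r -mulrDl natr1 ltr_pdivlMr.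
have : 0 < f (i%:R * h m).
  apply: He; rewrite /ball /= ger0_norm ?subr_ge0//.
  by apply: lt_trans me; rewrite ltrBlDr addrC -ltrBlDr.
rewrite /f max_l// subr_gt0 ltNge => /negP; apply.
have Am : A m x by apply: contrapT => nA; apply: Ax; exists m.
move: Am; rewrite /A belowP; apply.
rewrite -(ler_nat R) natrM natrX; apply: le_trans i1 _.
by rewrite ler_pM2r// ltW.
Qed.

End line_crossing.

(** * Pathwise well-posedness *)

Section sobolev_norm.
Context {R : realType}.
Implicit Types (a M X : R) (f : coeffs R).
Local Notation "`[ k ]" := (@fnorm R k).

Lemma Hle_hnorm a X f : Hle a X f -> (hnorm a f <= (Num.sqrt X)%:E)%E.
Proof.
move=> fX; have X0 := sumle_ge0 fX; rewrite -powR12_sqrt// -poweR_EFin.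
have ge0 (x : \bar R) : (0 <= x)%E -> x \in `[0%E, +oo%E].
  by move=> x0; rewrite in_itv/= x0 leey.
apply: gt0_ler_poweR => //; rewrite ?ge0 ?lee_fin//.
  by apply: esum_ge0 => k _; rewrite lee_fin mulr_ge0 ?powR_ge0 ?sqr_ge0.
by apply: esum_le => s us _; exact: fX.
Qed.

Lemma hnorm_Hle a M f : 0 < a -> 0 <= M -> (hnorm a f <= M%:E)%E -> Hle a (M ^+ 2) f.
Proof.
move=> a0 M0; rewrite /hnorm; set S := esum _ _ => SM.
have S0 : (0 <= S)%E by apply: esum_ge0 => k _; rewrite lee_fin mulr_ge0 ?powR_ge0 ?sqr_ge0.
have {}SM : (S <= (M ^+ 2)%:E)%E.
  case: S SM S0 => [x| |]; last 2 first.
  - by rewrite poweRyr ?invr_eq0 ?pnatr_eq0.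
  - by [].
  rewrite poweR_EFin !lee_fin => + x0; rewrite powR12_sqrt// => h.
  by rewrite -(sqr_sqrtr x0) ler_pXn2r ?nnegrE ?sqrtr_ge0.
move=> s us; rewrite -lee_fin; apply: le_trans SM.
have -> : \sum_(k <- s) `[k] `^ (2 * a) * cn (f k) ^+ 2 =
    \sum_(k <- [seq k <- s | k != 0]) `[k] `^ (2 * a) * cn (f k) ^+ 2.
  rewrite [RHS]big_filter [RHS]big_mkcond; apply: eq_bigr => k _; case: eqP => //= ->.
  by rewrite fnorm0 powR0 ?mul0r// mulf_neq0 ?gt_eqF.
apply: sum_le_esum; first exact: filter_uniq.
by move=> k; rewrite mem_filter => /andP[].
Qed.

Lemma cvg_to_0e (T : Type) (F : set_system T) (FF : Filter F) (h : T -> \bar R) :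
  (forall t, 0 <= h t)%E -> (forall e, 0 < e -> \forall t \near F, (h t <= e%:E)%E) ->
  h t @[t --> F] --> 0%E.
Proof.
move=> h0 he; apply/fine_cvgP; split.
  by move: (he 1 ltr01); apply: filterS => t ht; rewrite ge0_fin_numE// (le_lt_trans ht) ?ltry.
apply/cvgrPdist_le => e e0; move: (he e e0); apply: filterS => t ht /=.
rewrite sub0r normrN ger0_norm ?fine_ge0//.
by rewrite -lee_fin fineK// ge0_fin_numE// (le_lt_trans ht) ?ltry.
Qed.

Lemma hnorm_ge0 a f : (0 <= hnorm a f)%E.
Proof. exact: poweR_ge0. Qed.

Lemma Hcont_hnorm a (v : R -> coeffs R) t : Hcont a v -> 
  hnorm a (v r \- v t) @[r --> within [set r | 0 <= r] (nbhs t)] --> 0%E.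
Proof.
move=> vc; apply: cvg_to_0e => [r|e e0]; first exact: hnorm_ge0.
apply: cvg_within; have e20 : 0 < e ^+ 2 by rewrite exprn_gt0.
move: (vc t _ e20); apply: filterS => r /Hle_hnorm.
by rewrite sqrtr_sqr gtr0_norm.
Qed.

(** Freezing the function at its value at 0 for negative times turns one-sided continuity into
    continuity on the line, where the evolution lemmas live. *)
Lemma hnorm_Hcont a (v : R -> coeffs R) : 0 < a -> (forall t, 0 <= t ->
    hnorm a (v r \- v t) @[r --> within [set r | 0 <= r] (nbhs t)] --> 0%E) ->
  Hcont a (fun t => v (Num.max t 0)).
Proof.
move=> a0 vc t e e0; have t0 : 0 <= Num.max t 0 by rewrite le_max lexx orbT.
have e1 : 0 < Num.sqrt e by rewrite sqrtr_gt0.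
have /fine_cvgP[/= h1 /cvgrPdist_le/(_ _ e1) h2] := vc _ t0.
have : \forall r \near Num.max t 0, 0 <= r -> Hle a e (v r \- v (Num.max t 0)).
  have H : \forall r \near within [set r | 0 <= r] (nbhs (Num.max t 0)),
      Hle a e (v r \- v (Num.max t 0)).
    near=> r; rewrite -[X in Hle _ X]sqr_sqrtr ?(ltW e0)//; apply: hnorm_Hle => //.
    have hf : hnorm a (v r \- v (Num.max t 0)) \is a fin_num by near: r; exact: h1.
    rewrite -(fineK hf) lee_fin.
    have : `|0 - fine (hnorm a (v r \- v (Num.max t 0)))| <= Num.sqrt e by near: r; exact: h2.
    by rewrite sub0r normrN; apply: le_trans; exact: ler_norm.
  exact: H.
move=> H.
have : \forall r \near t, 0 <= Num.max r 0 -> Hle a e (v (Num.max r 0) \- v (Num.max t 0)).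
  exact: @continuous_pos_part R t _ H.
by apply: filterS => r; apply; rewrite le_max lexx orbT.
Unshelve. all: by end_near. Qed.

(* Splitting off finitely many modes reduces the continuity of
   [t |-> e^{- dl t |\nabla|^s} f] to that of its components. *)
Lemma Hcont_exp_grad a X s f (dl : R -> R) : Hle a X f -> continuous dl ->
  (forall t, 0 <= dl t) -> Hcont a (fun t => exp_grad (- dl t) s f).
Proof.
move=> fX dlc dl0 t e e0.
have w1 r k : 0 <= expR (- dl r * `[k] `^ s) <= 1.
  by rewrite expR_ge0 -expR0 ler_expR mulNr oppr_le0 mulr_ge0 ?powR_ge0.
have fX' : sumle (fun k => `| `[k] `^ (2 * a) * cn (f k) ^+ 2|) X.
  by apply: sumleW fX => k; rewrite [leLHS]ger0_norm//; apply: mulr_ge0; [exact: powR_ge0|exact: sqr_ge0].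
have e4 : 0 < e / 4 by rewrite divr_gt0.
have [S [uS tail]] := sumle_tail e4 fX'.
pose y (r : R) : coeffs R := fun k => if k \in S then exp_grad (- dl r) s f k else 0.
have yS r k : k \notin S -> y r k = 0 by move=> kS; rewrite /y (negbTE kS).
have yc : componentwise_continuous y.
  move=> k; rewrite /y; case: (k \in S); last by split => r; exact: cvg_cst.
  have wc : continuous (fun r => expR (- dl r * `[k] `^ s)).
    move=> r; apply: continuous_comp; last exact: continuous_expR.
    by apply: cvgM; [apply: cvgN; exact: dlc|exact: cvg_cst].
  rewrite /exp_grad /multiplier; case: (f k) => p q; split.
    under eq_fun do rewrite /= mul0r subr0.
    by move=> r; apply: cvgM; [exact: wc|exact: cvg_cst].
  under eq_fun do rewrite /= mul0r addr0.
  by move=> r; apply: cvgM; [exact: wc|exact: cvg_cst].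
move: (@Hcont_finite _ _ a _ uS yc yS t _ e4); apply: filterS => r yr.
have out : Hle a (e / 4) (fun k => if k \in S then 0 else
    exp_grad (- dl r) s f k - exp_grad (- dl t) s f k).
  apply: sumleW tail => k; case: (k \in S); first by rewrite /= expr0n /= addr0 sqrtr0 expr0n mulr0.
  rewrite [leRHS]ger0_norm; last by apply: mulr_ge0; [exact: powR_ge0|exact: sqr_ge0].
  rewrite /exp_grad /multiplier -mulrBl -rmorphB ComplexField.Normc.normcM normc_real exprMn.
  rewrite ler_wpM2l ?powR_ge0// ler_piMl ?sqr_ge0// expr_le1//.
  have := w1 r k; have := w1 t k; move: (expR _) (expR _) => x z.
  by rewrite ler_norml; lra.
have := HleD yr out; rewrite (_ : 2 * (e / 4) + 2 * (e / 4) = e); last by lra.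
by congr Hle; apply/funext => k /=; rewrite /y; case: (k \in S); rewrite ?addr0// subr0 add0r.
Qed.

End sobolev_norm.

Section nonlinearity_coefficients.
Context {R : realType}.
Local Notation "`[ k ]" := (@fnorm R k).
Implicit Types (z w : freq -> R[i]) (f : coeffs R).

Lemma csumD z w B B' : sumle (fun k => cn (z k)) B -> sumle (fun k => cn (w k)) B' ->
  csum z + csum w = csum (fun k => z k + w k).
Proof.
move=> zB wB; have zwB : sumle (fun k => cn (z k + w k)) (B + B').
  by apply: sumleW (sumleD zB wB) => k; exact: ler_normcD.
have -> : csum z = csum (fun k => z k + w k) - csum w; last by rewrite subrK.
by rewrite (csumB zwB wB); congr csum; apply/funext => k; rewrite addrK.
Qed.

Lemma csumZ z (c : R) B : sumle (fun k => cn (z k)) B ->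
  csum (fun k => c%:C * z k) = c%:C * csum z.
Proof.
move=> zB; have [zr zi] := sumle_ReIm zB.
have czB : sumle (fun k => cn (c%:C * z k)) (`|c| * B).
  by apply: sumleW (sumleZ (normr_ge0 c) zB) => k; rewrite ComplexField.Normc.normcM normc_real.
have [czr czi] := sumle_ReIm czB.
apply/eqP; rewrite eq_complex Re_realM Im_realM /csum /=; apply/andP; split; apply/eqP.
  apply: has_sum_unique (has_sum_rsum czr) _.
  by under [X in has_sum X]eq_fun do rewrite Re_realM; exact: has_sumZ (has_sum_rsum zr).
apply: has_sum_unique (has_sum_rsum czi) _.
by under [X in has_sum X]eq_fun do rewrite Im_realM; exact: has_sumZ (has_sum_rsum zi).
Qed.

Lemma csummable_sumle z B : sumle (fun k => cn (z k)) B -> csummable z.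
Proof. by move=> /sumle_ReIm[zr zi]; split; [exact: summable_sumle zr|exact: summable_sumle zi]. Qed.

Variables (a X : R) (f : coeffs R).
Hypotheses (a1 : 1 < a) (f0 : f 0 = 0) (fX : Hle a X f).

(** The product is at most the sum of the squares, and both squares are controlled by the $\dot H^a$
    energy because $a\ge1$. *)
Lemma gradient_product_sumle k : sumle (fun j => cn (f j) * (`[k - j] * cn (f (k - j)))) (2 * X).
Proof.
have inj : injective (fun j => k - j) by move=> x y /addrI/oppr_inj.
have XX : X + X = 2 * X by lra.
rewrite -XX; apply: sumleW (sumleD fX (sumle_inj inj fX)) => j.
have sq (x y p q : R) : 0 <= x -> 0 <= y -> x ^+ 2 <= p -> y ^+ 2 <= q -> x * y <= p + q.
  move=> x0 y0 xp yq; apply: le_trans (lerD xp yq); rewrite -subr_ge0.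
  have -> : x ^+ 2 + y ^+ 2 - x * y = (x - y) ^+ 2 + x * y by ring.
  by rewrite addr_ge0 ?sqr_ge0// mulr_ge0.
apply: sq; rewrite ?mulr_ge0 ?normc_ge0 ?fnorm_ge0//.
  have [->|j0] := eqVneq j 0; first by rewrite f0 /= expr0n /= addr0 sqrtr0 expr0n mulr0.
  rewrite ler_peMl ?sqr_ge0//; apply: powR_ge1; [exact: fnorm_ge1|by rewrite mulr_ge0// ltW// (lt_trans ltr01)].
rewrite /= exprMn; set l := k - j.
have [->|l0] := eqVneq l 0; first by rewrite f0 /= expr0n /= addr0 sqrtr0 expr0n !mulr0.
apply: ler_wpM2r; first exact: sqr_ge0.
rewrite -powR_mulrn ?fnorm_ge0//; apply: ler_powR; first exact: fnorm_ge1.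
by rewrite ler_peMr// ltW.
Qed.

Let coord1_le k : `|k.1%:~R| <= `[k].
Proof.
rewrite -(@ler_pXn2r _ 2) ?nnegrE ?fnorm_ge0// real_normK ?num_real// fnorm_sqr rmorphD /= !rmorphXn /=.
by rewrite lerDl sqr_ge0.
Qed.

Let coord2_le k : `|k.2%:~R| <= `[k].
Proof.
rewrite -(@ler_pXn2r _ 2) ?nnegrE ?fnorm_ge0// real_normK ?num_real// fnorm_sqr rmorphD /= !rmorphXn /=.
by rewrite lerDr sqr_ge0.
Qed.

Let ratio_le1 (x : R) j : `|x| <= `[j] -> `|x / `[j]| <= 1.
Proof.
move=> xj; have [->|j0] := eqVneq j 0; first by rewrite fnorm0 invr0 mulr0 normr0.
by rewrite normrM normfV (ger0_norm (fnorm_ge0 _)) ler_pdivrMr ?fnorm_gt0// mul1r.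
Qed.

Let normc_imag (x : R) : cn (0 +i* x) = `|x|.
Proof. by rewrite /= expr0n /= add0r sqrtr_sqr. Qed.

Let term1_sumle k : sumle (fun j => cn ((\- riesz2 f) j * partial1 f (k - j))) (2 * X).
Proof.
apply: sumleW (gradient_product_sumle k) => j.
rewrite /= /riesz2 /partial1 /multiplier ComplexField.Normc.normcM normcN !ComplexField.Normc.normcM.
rewrite !normc_imag normrN; apply: ler_pM; rewrite ?mulr_ge0 ?normc_ge0//.
  by rewrite ler_piMl ?normc_ge0// ratio_le1.
by rewrite ler_wpM2r ?normc_ge0.
Qed.

Let term2_sumle k : sumle (fun j => cn (riesz1 f j * partial2 f (k - j))) (2 * X).
Proof.
apply: sumleW (gradient_product_sumle k) => j.
rewrite /= /riesz1 /partial2 /multiplier !ComplexField.Normc.normcM.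
rewrite !normc_imag normrN; apply: ler_pM; rewrite ?mulr_ge0 ?normc_ge0//.
  by rewrite ler_piMl ?normc_ge0// ratio_le1.
by rewrite ler_wpM2r ?normc_ge0.
Qed.

Lemma nonlinearity_definedT : nonlinearity_defined f.
Proof.
by split=> k; [exact: csummable_sumle (term1_sumle k)|exact: csummable_sumle (term2_sumle k)].
Qed.

Lemma nonlinearity_csum k :
  nonlinearity f k = csum (fun j => (sqg_symbol j (k - j))%:C * (f j * f (k - j))).
Proof.
rewrite /nonlinearity /= /product (csumD (term1_sumle k) (term2_sumle k)).
congr csum; apply/funext => j.
have h (p q x y : R) (z w : R[i]) : - ((0 -i* p) * z) * ((0 +i* q) * w) + (0 -i* x) * z * ((0 +i* y) * w) =
    (x * y - p * q)%:C * (z * w).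
  by case: z w => z1 z2 [w1 w2]; apply/eqP; rewrite eq_complex; apply/andP; split; apply/eqP => /=; ring.
move: (k - j) => l; rewrite /sqg_symbol /crossp.
have -> : (j.1 * l.2 - j.2 * l.1)%:~R / `[j] = j.1%:~R / `[j] * l.2%:~R - j.2%:~R / `[j] * l.1%:~R :> R.
  by rewrite rmorphB /= !rmorphM /=; ring.
exact: h.
Qed.

End nonlinearity_coefficients.

Section scalar_duhamel.
Context {R : realType}.
Implicit Types (q t : R) (v n : R -> R).

Lemma is_derive_expZ q t : is_derive t 1 (fun x => expR (q * x)) (q * expR (q * t)).
Proof.
by apply: trigger_derive; rewrite /GRing.scale /=; ring.
Qed.

Lemma continuous_expZ q : continuous (fun x : R => expR (q * x)).
Proof. by apply: continuous_is_derive => t; exact: is_derive_expZ. Qed.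

(** Variation of constants for one scalar mode, through the derivative of $e^{qx}v(x)$;
    [duhamel_ode] is the converse, needed to treat an arbitrary mild solution. *)
Lemma ode_duhamel q v n t : continuous v -> continuous n ->
  (forall x : R, 0 < x -> is_derive x 1 v (- q * v x - n x)) -> 0 <= t ->
  v t = expR (- (q * t)) * (v 0 - prim (fun x => expR (q * x) * n x) t).
Proof.
move=> vc nc vd t0.
have wc : continuous (fun x => expR (q * x) * v x).
  by move=> x; apply: cvgM; [exact: continuous_expZ|exact: vc].
have dc : continuous (fun x => - 1 * (expR (q * x) * n x)).
  by move=> x; apply: cvgM; [exact: cvg_cst|apply: cvgM; [exact: continuous_expZ|exact: nc]].
have wd (x : R) : 0 < x ->
    is_derive x 1 (fun x => expR (q * x) * v x) (- 1 * (expR (q * x) * n x)).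
  move=> x0; apply: (is_derive_eq (is_deriveM (is_derive_expZ q x) (vd x x0))).
  by rewrite /GRing.scale /=; ring.
have := prim_derive wc dc wd t0; rewrite mulr0 expR0 mul1r primZ; last first.
  by move=> x; apply: cvgM; [exact: continuous_expZ|exact: nc].
by rewrite mulN1r => <-; rewrite mulrA -expRD addNr expR0 mul1r.
Qed.

Lemma duhamel_ode q v n c t : continuous n ->
  (forall t, 0 <= t -> v t = expR (- (q * t)) * (c - prim (fun x => expR (q * x) * n x) t)) ->
  0 < t -> is_derive t 1 v (- q * v t - n t).
Proof.
move=> nc vE t0.
have ec : continuous (fun x => expR (q * x) * n x).
  by move=> x; apply: cvgM; [exact: continuous_expZ|exact: nc].
pose y (x : R) := expR (- q * x) * (c - prim (fun x => expR (q * x) * n x) x).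
have yd : is_derive t 1 y (- q * v t - n t).
  apply: (is_derive_eq (is_deriveM (is_derive_expZ (- q) t)
    (is_deriveB (is_derive_cst c t 1) (is_derive_prim ec t0)))).
  rewrite (vE t (ltW t0)) /GRing.scale /= sub0r mulNr.
  have e : expR (- (q * t)) * expR (q * t) = 1 by rewrite -expRD addNr expR0.
  have -> : (cst c - prim (fun x : R => expR (q * x) * n x)) t =
    c - prim (fun x => expR (q * x) * n x) t by [].
  by rewrite mulrN mulrA e mul1r; ring.
apply: (near_eq_is_derive _ yd).
near=> x; rewrite /y vE ?mulNr//; near: x.
by apply: filterS (lt_nbhsr t0) => x /ltW.
Unshelve. all: by end_near. Qed.

End scalar_duhamel.

(** * Equivalence of the mild equation for $u$ with the evolution of $v$ *)

Section solution.
Context {R : realType}.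
Variables (s sigma nu a0 beta lam : R) (w phi dl : R -> R) (dd : freq -> R).
Local Notation a := (sigma * s).
Local Notation "`[ k ]" := (@fnorm R k).
Hypotheses (s0 : 0 < s) (s1 : s <= 1) (a1 : 1 < a) (a2 : a <= 2)
  (lamE : lam = nu ^+ 2 / 2) (phiE : forall t, phi t = a0 + beta * t)
  (dlE : forall t : R, 0 <= t -> dl t = phi t - nu * w t)
  (ddE : forall k, dd k = lam * `[k] `^ (2 * s) - beta * `[k] `^ s)
  (dlc : continuous dl) (dl0 : forall t, 0 <= dl t).

Lemma exp_gradK x y f : exp_grad x s (exp_grad y s f) = exp_grad (x + y) s f.
Proof.
apply/funext => k; rewrite /exp_grad /multiplier mulrA -rmorphM /= -expRD.
by rewrite -mulrDl.
Qed.

Lemma exp_grad0 f : exp_grad 0 s f = f.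
Proof. by apply/funext => k; rewrite /exp_grad /multiplier mul0r expR0 mul1r. Qed.

Lemma Hle_exp_grad x X f : x <= 0 -> Hle a X f -> Hle a X (exp_grad x s f).
Proof.
move=> x0; apply: sumleW => k; rewrite /exp_grad /multiplier.
rewrite ComplexField.Normc.normcM normc_real ger0_norm ?expR_ge0// exprMn.
apply: ler_wpM2l; first exact: powR_ge0.
rewrite ler_piMl ?sqr_ge0// expr_le1 ?expR_ge0// -[leRHS]expR0 ler_expR.
by rewrite mulr_le0_ge0// powR_ge0.
Qed.

Section transform.
Variables (u v : R -> coeffs R) (X : R).
Hypotheses (vX : trajectory a X v) (vc : Hcont a v)
  (uv : forall t : R, 0 <= t -> v t = exp_grad (phi t) s (u t)).

(** This is $\theta$ as $e^{-\delta|\nabla|^s}v$; as $\delta\ge0$, it inherits the bounds of $v$. *)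
Let uE t : 0 <= t -> Gamma_inv s nu w t (u t) = exp_grad (- dl t) s (v t).
Proof.
move=> t0; rewrite uv// exp_gradK /Gamma_inv dlE//; congr (exp_grad _ s _); ring.
Qed.

Let theta_bound t : 0 <= t ->
  Gamma_inv s nu w t (u t) 0 = 0 /\ Hle a X (Gamma_inv s nu w t (u t)).
Proof.
move=> t0; have [_ v0 vX'] := vX; rewrite uE//; split.
  by rewrite /exp_grad /multiplier v0 mulr0.
by apply: Hle_exp_grad => //; rewrite oppr_le0.
Qed.

Lemma transform_defined t : 0 <= t -> nonlinearity_defined (Gamma_inv s nu w t (u t)).
Proof. by move=> t0; have [h0 hX] := theta_bound t0; exact: nonlinearity_definedT a1 h0 hX. Qed.

Lemma transform_nonlinearity t k : 0 <= t ->
  nonlinearity (Gamma_inv s nu w t (u t)) k =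
  (expR (- dl t * `[k] `^ s))%:C * nl s (dl t) (v t) (v t) k.
Proof.
move=> t0; have [h0 hX] := theta_bound t0; have [_ v0 vX'] := vX.
rewrite (nonlinearity_csum a1 h0 hX) uE//.
have [B hB] := nl_term_summable a1 a2 s0 s1 k (dl0 t) (v0 t) (v0 t) (vX' t) (vX' t).
rewrite /nl -(csumZ _ hB); congr csum; apply/funext => j.
rewrite /nl_term /gevrey_weight /exp_grad /multiplier.
have e : expR (- dl t * `[k] `^ s) * expR (dl t * `[k] `^ s) = 1 by rewrite -expRD mulNr addNr expR0.
have -> : expR (- (dl t * (`[j] `^ s + `[k - j] `^ s - `[k] `^ s))) =
    expR (- dl t * `[j] `^ s) * expR (- dl t * `[k - j] `^ s) * expR (dl t * `[k] `^ s).
  rewrite -!expRD; congr expR; move: (`[j] `^ s) (`[k - j] `^ s) (`[k] `^ s) (dl t) => *; ring.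
have alg (A B' C D G : R) (x y : R[i]) : D * C = 1 ->
    G%:C * ((A%:C * x) * (B'%:C * y)) = D%:C * ((G * (A * B' * C))%:C * (x * y)).
  move=> DC; have -> : D%:C * ((G * (A * B' * C))%:C * (x * y)) = (D * C)%:C * (G%:C * ((A%:C * x) * (B'%:C * y))).
    by rewrite !rmorphM /=; ring.
  by rewrite DC mul1r.
exact: alg.
Qed.

(** The dependence on $w$ cancels, and the dependence on $t$ factors out of the integral, leaving
    the continuous integrand of a scalar Duhamel formula. *)
Lemma transform_integrand t tau k : 0 <= tau ->
  duhamel_integrand s nu w u t tau k =
  (expR (- phi t * `[k] `^ s - dd k * t))%:C *
  ((expR (dd k * tau))%:C * nl s (dl tau) (v tau) (v tau) k).
Proof.
move=> tau0; rewrite /duhamel_integrand /heat /Gamma /exp_grad /multiplier.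
rewrite transform_nonlinearity// !mulrA -!rmorphM /= -!expRD; congr ((expR _)%:C * _).
by rewrite dlE// !phiE ddE lamE; field.
Qed.

Let nlc k := nl_continuous a1 a2 s0 s1 k (let: And3 _ v0 _ := vX in v0)
  (let: And3 _ _ h := vX in h) vc dlc dl0.

Let NL k t := nl s (dl t) (v t) (v t) k.

Let integrand_re k : continuous (fun x => expR (dd k * x) * complex.Re (NL k x)).
Proof. by move=> x; apply: cvgM; [exact: continuous_expZ|exact: (nlc k).1]. Qed.

Let integrand_im k : continuous (fun x => expR (dd k * x) * complex.Im (NL k x)).
Proof. by move=> x; apply: cvgM; [exact: continuous_expZ|exact: (nlc k).2]. Qed.

Let in_segment_ge0 (t x : R) : x \in `[0, t]%classic -> 0 <= x.
Proof. by rewrite inE /= in_itv /= => /andP[]. Qed.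

Lemma transform_integrable t k :
  cintegrable `[0, t] (fun tau => duhamel_integrand s nu w u t tau k).
Proof.
split.
- pose f x := expR (- phi t * `[k] `^ s - dd k * t) * (expR (dd k * x) * complex.Re (NL k x)).
  have fc : continuous f by move=> x; apply: cvgM; [exact: cvg_cst|exact: integrand_re].
  apply: eq_integrable (integrable_continuous t fc) => // x /in_segment_ge0 x0.
  by rewrite transform_integrand// !Re_realM.
- pose f x := expR (- phi t * `[k] `^ s - dd k * t) * (expR (dd k * x) * complex.Im (NL k x)).
  have fc : continuous f by move=> x; apply: cvgM; [exact: cvg_cst|exact: integrand_im].
  apply: eq_integrable (integrable_continuous t fc) => // x /in_segment_ge0 x0.
  by rewrite transform_integrand// !Im_realM.
Qed.

Lemma transform_integral t k :
  cintegral `[0, t] (fun tau => duhamel_integrand s nu w u t tau k) =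
  (expR (- phi t * `[k] `^ s - dd k * t))%:C *
  (prim (fun x => expR (dd k * x) * complex.Re (NL k x)) t +i*
   prim (fun x => expR (dd k * x) * complex.Im (NL k x)) t).
Proof.
have cRe D z : complex.Re (cintegral D z) = \int[@lebesgue_measure R]_(x in D) complex.Re (z x) by [].
have cIm D z : complex.Im (cintegral D z) = \int[@lebesgue_measure R]_(x in D) complex.Im (z x) by [].
set P := prim _ t; set Q := prim _ t.
apply/eqP; rewrite eq_complex Re_realM Im_realM cRe cIm -[complex.Re (P +i* Q)]/P -[complex.Im (P +i* Q)]/Q.
apply/andP; split; apply/eqP.
- rewrite /P -primZ; last exact: integrand_re.
  apply: eq_Rintegral => x /in_segment_ge0 x0.
  by rewrite transform_integrand// !Re_realM.
- rewrite /Q -primZ; last exact: integrand_im.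
  apply: eq_Rintegral => x /in_segment_ge0 x0.
  by rewrite transform_integrand// !Im_realM.
Qed.

Let formula (theta0 : coeffs R) t k := u t k = heat (t / 2 * nu ^+ 2) s theta0 k -
  cintegral `[0, t] (fun tau => duhamel_integrand s nu w u t tau k).

Let formulaE theta0 t k : 0 <= t -> formula theta0 t k <->
  v t k = (expR (- (dd k * t)))%:C * (exp_grad a0 s theta0 k -
    (prim (fun x => expR (dd k * x) * complex.Re (NL k x)) t +i*
     prim (fun x => expR (dd k * x) * complex.Im (NL k x)) t)).
Proof.
move=> t0; rewrite /formula transform_integral uv//.
set I := _ +i* _; rewrite /exp_grad /heat /multiplier.
have e : expR (phi t * `[k] `^ s) != 0 by rewrite gt_eqF ?expR_gt0.
have E1 : (expR (- (dd k * t)) : R) = expR (phi t * `[k] `^ s) * expR (- phi t * `[k] `^ s - dd k * t).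
  by rewrite -expRD; congr expR; ring.
have E2 : (expR (- (dd k * t)) * expR (a0 * `[k] `^ s) : R) =
    expR (phi t * `[k] `^ s) * expR (- (t / 2 * nu ^+ 2) * `[k] `^ (2 * s)).
  by rewrite -!expRD; congr expR; rewrite ddE phiE lamE; field.
have -> : (expR (- (dd k * t)))%:C * ((expR (a0 * `[k] `^ s))%:C * theta0 k - I) =
    (expR (phi t * `[k] `^ s))%:C * ((expR (- (t / 2 * nu ^+ 2) * `[k] `^ (2 * s)))%:C * theta0 k -
    (expR (- phi t * `[k] `^ s - dd k * t))%:C * I).
  move: (theta0 k) I => th J; move: (expR (phi t * _)) (expR (a0 * _)) E1 E2 => Q T' E1 E2.
  rewrite mulrBr mulrA -rmorphM E2 E1 !rmorphM /=; ring.
split=> [->//|]; apply: mulfI; rewrite eq_complex /= negb_and e//.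
Qed.

Lemma evolves_mild theta0 : evolves s dl dd predT v ->
  (forall k, v 0 k = exp_grad a0 s theta0 k) ->
  forall t k, 0 <= t -> u t k = heat (t / 2 * nu ^+ 2) s theta0 k -
  cintegral `[0, t] (fun tau => duhamel_integrand s nu w u t tau k).
Proof.
move=> vE v00 t k t0; apply/(formulaE theta0 k t0); have [vcc _ _] := vX.
rewrite -v00; apply/eqP; rewrite eq_complex Re_realM Im_realM Re_subc Im_subc /=.
apply/andP; split; apply/eqP.
  apply: (ode_duhamel (vcc k).1 (nlc k).1) t0 => x x0; have [+ _] := vE x k x0 isT.
  by rewrite /evol_rhs Re_subc mulNr -mulNr -rmorphN Re_realM.
apply: (ode_duhamel (vcc k).2 (nlc k).2) t0 => x x0; have [_ +] := vE x k x0 isT.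
  by rewrite /evol_rhs Im_subc mulNr -mulNr -rmorphN Im_realM.
Qed.

Lemma mild_evolves theta0 : (forall t k, 0 <= t -> u t k = heat (t / 2 * nu ^+ 2) s theta0 k -
    cintegral `[0, t] (fun tau => duhamel_integrand s nu w u t tau k)) ->
  evolves s dl dd predT v /\ forall k, v 0 k = exp_grad a0 s theta0 k.
Proof.
move=> uM.
have H k t : 0 <= t -> _ := fun t0 => (formulaE theta0 k t0).1 (uM t k t0).
split=> [t k t0 _|k]; last first.
  by rewrite H// !prim0 mulr0 oppr0 expR0 mul1r subr0.
rewrite /evol_rhs Re_subc Im_subc -rmorphN Re_realM Im_realM; split.
- apply: (duhamel_ode (c := complex.Re (exp_grad a0 s theta0 k)) (nlc k).1 _ t0) => x x0.
  by rewrite H// Re_realM Re_subc.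
- apply: (duhamel_ode (c := complex.Im (exp_grad a0 s theta0 k)) (nlc k).2 _ t0) => x x0.
  by rewrite H// Im_realM Im_subc.
Qed.

End transform.

End solution.

Lemma exp_grad_real {R : realType} (x s : R) (f : coeffs R) :
  real_valued f -> real_valued (exp_grad x s f).
Proof. by move=> fr k; rewrite /exp_grad /multiplier fnormN fr conjcRM. Qed.

Lemma Hle_Hdot {R : realType} (a X : R) (f : coeffs R) : real_valued f -> f 0 = 0 ->
  Hle a X f -> Hdot a f.
Proof. by move=> fr f0 fX; split => //; exact: le_lt_trans (Hle_hnorm fX) (ltry _). Qed.

Lemma trajectory_wk {R : realType} (a X Y : R) (v : R -> coeffs R) : X <= Y ->
  trajectory a X v -> trajectory a Y v.
Proof. by move=> XY [vc v0 vX]; split => // t; exact: Hle_wk XY (vX t). Qed.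

Lemma Hcont_exp_grad_trajectory {R : realType} (s sigma X : R) (dl : R -> R) (v : R -> coeffs R) :
  continuous dl -> (forall t, 0 <= dl t) -> trajectory (sigma * s) X v ->
  Hcont (sigma * s) v -> Hcont (sigma * s) (fun t => exp_grad (- dl t) s (v t)).
Proof.
move=> dlc dl0 [_ _ vX] vc t e e0; have e4 : 0 < e / 4 by rewrite divr_gt0.
near=> r.
have h1 : Hle (sigma * s) (e / 4) (exp_grad (- dl r) s (v r \- v t)).
  by apply: Hle_exp_grad; [rewrite oppr_le0|near: r; exact: vc].
have h2 : Hle (sigma * s) (e / 4) (exp_grad (- dl r) s (v t) \- exp_grad (- dl t) s (v t)).
  by near: r; exact: (Hcont_exp_grad s (vX t) dlc dl0 t e4).
have := HleD h1 h2; rewrite (_ : 2 * (e / 4) + 2 * (e / 4) = e); last by lra.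
by congr Hle; apply/funext => k; rewrite /exp_grad /multiplier /= mulrBr addrA subrK.
Unshelve. all: by end_near. Qed.

Lemma pathwise_wellposed {R : realType} (s sigma nu E a0 beta : R) (w : R -> R) (theta0 : coeffs R) :
  0 < s -> s <= 1 -> s^-1 < sigma -> sigma < 2 -> 0 < E -> 0 < beta -> E < nu ^+ 2 / 2 - beta ->
  {within [set t : R | 0 <= t], continuous w} ->
  (forall t : R, 0 <= t -> nu * w t <= a0 + beta * t) ->
  real_valued theta0 -> mean_zero theta0 ->
  Hle (sigma * s) (E ^+ 2) (exp_grad a0 s theta0) ->
  unique_global_solution s sigma nu (fun t => a0 + beta * t) theta0 w.
Proof.
move=> s0 s1 sig1 sig2 E0 beta0 Ec wc wphi tr t0 tE.
pose a := sigma * s; rewrite -/a in tE.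
pose lam := nu ^+ 2 / 2; have lamE : lam = nu ^+ 2 / 2 by [].
pose phi t := a0 + beta * t; have phiE (t : R) : phi t = a0 + beta * t by [].
pose dl (t : R) := phi (Num.max t 0) - nu * w (Num.max t 0).
pose dd k := lam * fnorm k `^ (2 * s) - beta * fnorm k `^ s.
have a1 : 1 < a by rewrite /a -ltr_pdivrMr// mul1r.
have as_ : a <= 2 * s by rewrite /a ler_pM2r// ltW.
have a2 : a <= 2 by apply: le_trans as_ _; rewrite ler_piMr.
have ap : 0 < a by exact: lt_trans a1.
have c0 : 0 < lam - beta by apply: lt_trans Ec.
have dlE (t : R) : 0 <= t -> dl t = phi t - nu * w t by move=> t_ge0; rewrite /dl max_l.
have dl0 t : 0 <= dl t by rewrite subr_ge0 wphi// le_max lexx orbT.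
have dlc : continuous dl.
  have wc' := continuous_pos_part_comp wc; move=> t.
  apply: cvgB; last by apply: cvgM; [exact: cvg_cst|exact: wc'].
  by apply: cvgD; [exact: cvg_cst|apply: cvgM; [exact: cvg_cst|exact: continuous_pos_part]].
have ddN k : dd (- k) = dd k by rewrite /dd !fnormN.
have ddE k : dd k = lam * fnorm k `^ (2 * s) - beta * fnorm k `^ s by [].
(* Raising the Gevrey radius at rate $\beta$ costs $\beta|k|^s\le\beta|k|^{2s}$ for $|k|\ge1$, which
   lowers the dissipation constant to $\nu^2/2-\beta$. *)
have ddc k : (lam - beta) * fnorm k `^ (2 * s) <= dd k.
  rewrite /dd mulrBl lerB// ler_wpM2l ?(ltW beta0)//.
  have [->|k0] := eqVneq k 0.
    by rewrite fnorm0 (powR0 (lt0r_neq0 s0)) powR_ge0.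
  by apply: ler_powR; [exact: fnorm_ge1|rewrite ler_peMl ?(ltW s0)// ler1n].
have [|||v [X [vX vc vN vini vE]]] := evol_exists (E := E) (v0 := exp_grad a0 s theta0)
    a1 a2 as_ s1 c0 dlc dl0 ddN ddc _ _ _ tE.
- by rewrite E0.
- exact: exp_grad_real.
- by rewrite /exp_grad /multiplier t0 mulr0.
pose u t := exp_grad (- phi t) s (v t).
have uv t : v t = exp_grad (phi t) s (u t) by rewrite exp_gradK subrr exp_grad0.
have uv' t : 0 <= t -> v t = exp_grad (phi t) s (u t) by move=> _; exact: uv.
pose theta t := exp_grad (- dl t) s (v t).
have thetaE t : 0 <= t -> theta t = Gamma_inv s nu w t (u t).
  by move=> t_ge0; rewrite /Gamma_inv exp_gradK /theta dlE// opprB.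
have [_ v00 vH] := vX.
have vini0 k : v 0 k = exp_grad a0 s theta0 k by exact: vini.
exists theta; split.
- split=> [t _|t _].
    apply: (@Hle_Hdot _ _ X); first by apply: exp_grad_real => k; exact: vN.
      by rewrite /theta /exp_grad /multiplier v00 mulr0.
    by apply: Hle_exp_grad; rewrite ?oppr_le0.
  exact: Hcont_hnorm (Hcont_exp_grad_trajectory dlc dl0 vX vc).
- exists u => //; split.
  + have -> : gevrey_space s sigma phi u = (continuous_Hdot a v /\ bounded_Hdot a v).
      by rewrite (_ : v = fun t => exp_grad (phi t) s (u t))//; apply/funext => t; exact: uv.
    split; last by exists (Num.sqrt X) => t _; exact: Hle_hnorm.
    split=> [t _|t _]; last exact: Hcont_hnorm.
    by apply: (@Hle_Hdot _ _ X) => // k; exact: vN.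
  + move=> t t_ge0; exact: (transform_defined a1 dlE dl0 vX uv').
  + move=> t k _; exact: (transform_integrable s0 s1 a1 a2 lamE phiE dlE ddE dlc dl0 vX vc uv').
  + move=> t k t_ge0.
    exact: (evolves_mild s0 s1 a1 a2 lamE phiE dlE ddE dlc dl0 vX vc uv' vE vini0).
- move=> theta' [u' [[u'c [M u'M]] _ _ u'm] theta'E] t t_ge0.
  (* A competing solution comes with its own bound [M], possibly large. [evol_unique] asks only for
     a common bound, so the larger of the two serves. *)
  pose v' t := exp_grad (phi (Num.max t 0)) s (u' (Num.max t 0)).
  have pos (r : R) : 0 <= Num.max r 0 by rewrite le_max lexx orbT.
  have v'c : Hcont a v' := hnorm_Hcont ap u'c.2.
  have v'0 r : v' r 0 = 0 by have [_ h _] := u'c.1 _ (pos r).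
  have M0 : 0 <= M by rewrite -lee_fin; apply: le_trans (u'M 0 (lexx 0)); exact: hnorm_ge0.
  have v'X : trajectory a (M ^+ 2) v'.
    split=> //; first exact: Hcont_componentwise (ltW ap) v'0 v'c.
    by move=> r; apply: hnorm_Hle => //; exact: u'M.
  have u'v' r : 0 <= r -> v' r = exp_grad (phi r) s (u' r) by move=> r0; rewrite /v' max_l.
  have [v'E v'ini] := mild_evolves s0 s1 a1 a2 lamE phiE dlE ddE dlc dl0 v'X v'c u'v' u'm.
  pose Y := Num.max X (M ^+ 2).
  have XY : X <= Y by rewrite le_max lexx.
  have MY : M ^+ 2 <= Y by rewrite le_max lexx orbT.
  have vv' : v t = v' t.
    apply/funext => k; apply: (evol_unique a1 a2 as_ s1 c0 dl0 ddc (trajectory_wk XY vX)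
      (trajectory_wk MY v'X) vE v'E _ k t_ge0) => j.
    by rewrite vini0 v'ini.
  rewrite theta'E// thetaE// /u vv' u'v'// exp_gradK addNr exp_grad0 //.
Qed.

Lemma solvable_below_line {R : realType} (s sigma nu E alpha epsilon beta : R)
    (d : measure_display) (Omega : measurableType d) (P : probability Omega R) (W : R -> Omega -> R) :
  0 < s -> s <= 1 -> s^-1 < sigma -> sigma < 2 -> 0 < nu -> 0 < E -> 0 < beta ->
  E < nu ^+ 2 / 2 - beta -> 0 < epsilon < alpha -> standard_wiener P W ->
  exists p : R, 1 - expR (- 2 * ((alpha - epsilon) * beta / nu ^+ 2)) <= p /\
    forall theta0 : coeffs R, Hdot (sigma * s) theta0 ->
      hnorm (sigma * s) (exp_grad alpha s theta0) = E%:E ->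
      solvable_with_probability P W s sigma nu (fun t => (alpha - epsilon) + beta * t) theta0 p.
Proof.
move=> s0 s1 sig1 sig2 nu0 E0 beta0 Ec /andP[eps0 epsa] hW.
(* Dividing $\delta\ge0$ by $\nu$ gives the line $b+ct$ with $b=(\alpha-\epsilon)/\nu$ and
   $c=\beta/\nu$, whence the exponent $2bc$. *)
have b0 : 0 < (alpha - epsilon) / nu by rewrite divr_gt0 ?subr_gt0.
have c0 : 0 < beta / nu by rewrite divr_gt0.
have [A [mA [p PA pE] HA]] := wiener_below_line hW b0 c0.
exists p; split.
  apply: le_trans pE; rewrite lerD2l lerN2 ler_expR le_eqVlt; apply/orP; left; apply/eqP.
  by field; rewrite gt_eqF.
move=> theta0 [tr t0 _] tE; exists A; split => // x Ax.
have ap : 0 < sigma * s by rewrite mulr_gt0// (lt_trans _ sig1)// invr_gt0.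
apply: (pathwise_wellposed s0 s1 sig1 sig2 E0 beta0 Ec) => //.
- exact: (@wiener_continuous _ _ _ _ _ hW x).
- move=> t t_ge0; have := HA x Ax t t_ge0; rewrite -(ler_pM2l nu0) => h.
  by apply: le_trans h _; rewrite le_eqVlt; apply/orP; left; apply/eqP; field; rewrite gt_eqF.
- have -> : exp_grad (alpha - epsilon) s theta0 = exp_grad (- epsilon) s (exp_grad alpha s theta0).
    by rewrite exp_gradK addrC.
  apply: Hle_exp_grad; first by rewrite oppr_le0 ltW.
  by apply: hnorm_Hle; rewrite ?tE// ltW.
Qed.

Theorem theorem1p1 (R : realType) (s sigma : R)
  (s_gt0 : 0 < s) (s_le1 : s <= 1)
  (sigma_gt : s^-1 < sigma) (sigma_lt : sigma < 2) :
  exists beta : R -> R -> R,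
    (forall nu E : R, 0 < nu -> 0 < E -> E < nu ^+ 2 / 2 ->
      0 < beta nu E < E /\
      forall (alpha epsilon : R), 0 < alpha -> 0 < epsilon < alpha ->
      forall (d : measure_display) (Omega : measurableType d)
        (P : probability Omega R) (W : R -> Omega -> R),
      standard_wiener P W ->
      exists p : R,
        1 - expR (- 2 * ((alpha - epsilon) * beta nu E / nu ^+ 2)) <= p /\
        forall theta0 : coeffs R,
          Hdot (sigma * s) theta0 ->
          hnorm (sigma * s) (exp_grad alpha s theta0) = E%:E ->
          solvable_with_probability P W s sigma nu
            (fun t => (alpha - epsilon) + beta nu E * t) theta0 p) /\
    (forall p0 E : R, 0 < p0 < 1 -> 0 < E ->
      exists nu alpha epsilon : R,
        [/\ 0 < nu, 0 < alpha, 0 < epsilon < alpha, E < nu ^+ 2 / 2 &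
        forall (d : measure_display) (Omega : measurableType d)
          (P : probability Omega R) (W : R -> Omega -> R),
        standard_wiener P W ->
        exists p : R, p0 <= p /\
          forall theta0 : coeffs R,
            Hdot (sigma * s) theta0 ->
            hnorm (sigma * s) (exp_grad alpha s theta0) = E%:E ->
            solvable_with_probability P W s sigma nu
              (fun t => (alpha - epsilon) + beta nu E * t) theta0 p]).
Proof.
(* Half of the minimum makes both $\beta<E$ and $E+\beta<\nu^2/2$ strict. *)
pose beta nu E : R := Num.min E (nu ^+ 2 / 2 - E) / 2.
have betaP nu E : 0 < E -> E < nu ^+ 2 / 2 ->
    [/\ 0 < beta nu E, beta nu E < E & E < nu ^+ 2 / 2 - beta nu E].
  move=> E0 Enu; rewrite /beta; set x := nu ^+ 2 / 2 in Enu *.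
  by have [h|h] := leP E (x - E); split; lra.
exists beta; split.
  move=> nu E nu0 E0 Enu; have [b0 bE bc] := betaP nu E E0 Enu; split; first by rewrite b0.
  move=> alpha epsilon alpha0 eps d Omega P W hW.
  exact: (solvable_below_line s_gt0 s_le1 sigma_gt sigma_lt nu0 E0 b0 bc eps hW).
(* With $\nu^2=4E$ both terms of the minimum equal $E$, so $\beta=E/2$. With $\epsilon=1$ and
   $\alpha=L+1$ the exponent is $-L/4$, and $L=-4\ln(1-p_0)$ makes the bound exactly $p_0$. *)
move=> p0 E /andP[p00 p01] E0; pose nu := 2 * Num.sqrt E.
have nu0 : 0 < nu by rewrite mulr_gt0// sqrtr_gt0.
have nuE : nu ^+ 2 = 4 * E by rewrite exprMn sqr_sqrtr ?(ltW E0)//; ring.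
have Enu : E < nu ^+ 2 / 2 by rewrite nuE; lra.
have [b0 bE bc] := betaP nu E E0 Enu.
have b_eq : beta nu E = E / 2 by rewrite /beta nuE min_l//; lra.
have q0 : 0 < 1 - p0 by lra.
pose L := - 4 * ln (1 - p0).
have L0 : 0 < L by rewrite /L mulNr oppr_gt0 pmulr_rlt0// ln_lt0//; lra.
have eps : (0 : R) < 1 < L + 1 by rewrite ltr01 ltrDr.
exists nu, (L + 1), 1; split => //; first by rewrite addr_gt0.
move=> d Omega P W hW.
have [p [pL H]] := solvable_below_line s_gt0 s_le1 sigma_gt sigma_lt nu0 E0 b0 bc eps hW.
exists p; split => //; apply: le_trans pL.
have -> : - 2 * ((L + 1 - 1) * beta nu E / nu ^+ 2) = ln (1 - p0).
  by rewrite b_eq nuE /L; field; rewrite gt_eqF.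
by rewrite lnK ?posrE//; lra.
Qed.
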